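(* Let $f=\frac1n\sum_{i=1}^n f_i:\mathbb{R}^{d_1}\times\mathbb{R}^{d_2}\to\mathbb{R}$ with $\{f_i\}_{i=1}^n$ $L$-averaged smooth, $f(x,\cdot)$ $\mu$-strongly concave for every $x$, $\kappa=L/\mu$, and $\Delta=\Phi(x_0)-\inf_x\Phi(x)<\infty$. Run the Catalyst algorithm for NC-SC minimax problems (described in the context) with subproblem solver $\mathcal{M}$ equal to SVRG or SAGA (for strongly-convex-strongly-concave finite-sum minimax problems), with $\tau=\max\left\{\frac{L}{\sqrt n}-\mu,0\right\}$, $\alpha_0=\frac{\mu^5}{576\max\{1,L^7\}}$, $\alpha_t=\frac{\mu^5}{504L^5}$ for $t>0$, and $\epsilon^t_k=\frac{\sqrt2\mu}{2}(1-\rho)^k\,\mathrm{gap}_{\hat f_t}(x_0^t,y_0^t)$ with $\rho=0.9\sqrt{q}$, $q=\frac{\mu}{\mu+\tau}$. Then the expected total number of component gradient evaluations needed to find an $\epsilon$-stationary point of $\Phi$ is $$\tilde O\left(\left(n+n^{3/4}\sqrt{\kappa}\right)L(\Delta+D_y^0)\,\epsilon^{-2}\right),$$ where $D_y^0=\|y_0-y^*(x_0)\|^2$ and $y^*(x_0)=\operatorname{argmax}_{y}f(x_0,y)$.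
   Context: $\{f_i\}_{i=1}^n$ is $L$-averaged smooth if each $f_i$ is differentiable and $\frac1n\sum_{i=1}^n\|\nabla f_i(x_1,y_1)-\nabla f_i(x_2,y_2)\|^2\le L^2(\|x_1-x_2\|^2+\|y_1-y_2\|^2)$ for all arguments. $\Phi(x)=\max_y f(x,y)$. For a function $g(x,y)$, $\mathrm{gap}_g(\bar x,\bar y)=\max_y g(\bar x,y)-\min_x g(x,\bar y)$. A point $\bar x$ is an $\epsilon$-stationary point of $\Phi$ if $\|\nabla\Phi(\bar x)\|\le\epsilon$; for the randomly sampled output $\hat x_T$ this is meant in the sense $\mathbb{E}\|\nabla\Phi(\hat x_T)\|^2\le\epsilon^2$. Catalyst algorithm. Input: $f$, initial point $(x_0,y_0)$, $L$, $\mu$, parameter $\tau\ge0$, solver $\mathcal{M}$, tolerances $\alpha_t,\epsilon^t_k>0$. Set $(x_0^0,y_0^0)=(x_0,y_0)$, $q=\frac{\mu}{\mu+\tau}$. For $t=0,1,\dots,T$: set $z_1=y_0^t$, $k=1$ and $\hat f_t(x,y)=f(x,y)+L\|x-x_0^t\|^2$. Repeat: using $\mathcal{M}$ started at $(x^t_{k-1},y^t_{k-1})$, find an inexact solution $(x^t_k,y^t_k)$ of $\min_x\max_y\tilde f_{t,k}(x,y)$, where $\tilde f_{t,k}(x,y)=\hat f_t(x,y)-\frac{\tau}{2}\|y-z_k\|^2$, such that $\|\nabla\tilde f_{t,k}(x^t_k,y^t_k)\|^2\le\epsilon^t_k$; set $z_{k+1}=y^t_k+\frac{\sqrt q-q}{\sqrt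 q+q}(y^t_k-y^t_{k-1})$ and increase $k$ by one; until the latest iterate satisfies $\|\nabla\hat f_t(x^t_k,y^t_k)\|^2\le\alpha_t\|\nabla\hat f_t(x^t_0,y^t_0)\|^2$. Set $(x_0^{t+1},y_0^{t+1})$ to be this latest iterate $(x^t_k,y^t_k)$. Output $\hat x_T$ sampled uniformly from $x_0^1,\dots,x_0^T$. Known fact about the solvers used: SVRG and SAGA, applied to the finite-sum subproblem $\min_x\max_y\tilde f_{t,k}$ with solution $(x^*,y^* )$, satisfy $\mathbb{E}[\|x_N-x^*\|^2+\|y_N-y^*\|^2]\le(1-1/\Lambda)^N[\|x_0-x^*\|^2+\|y_0-y^*\|^2]$, where $N$ is counted in component gradient evaluations up to a constant factor, and $\Lambda\ge1$ is proportional (up to a universal constant) to $n+\left(\frac{L+\sqrt2\max\{2L,\tau\}}{\min\{L,\mu+\tau\}}\right)^2$. $\tilde O$ hides universal constants and poly-logarithmic factors in $L,\mu,\kappa$, but no dependence on $\epsilon$. *)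

(* Defs.v *)
From HB Require Import structures.
From mathcomp Require Import all_boot all_order all_algebra.
From mathcomp Require Import all_classical all_reals all_analysis.

Set Implicit Arguments.
Unset Strict Implicit.
Unset Printing Implicit Defensive.

Import Order.TTheory GRing.Theory Num.Theory.
Import numFieldNormedType.Exports.

Local Open Scope classical_set_scope.
Local Open Scope ring_scope.

(* The library norm on 'rV[R]_d and on products is the sup norm, so the
   Euclidean norm is introduced through its square.  Differentiability does not
   depend on this choice. *)
Definition sqn (R : realType) (d : nat) (v : 'rV[R]_d) : R :=
  \sum_(i < d) v ord0 i ^+ 2.

Definition sqn2 (R : realType) (d1 d2 : nat)
  (p : 'rV[R]_d1 * 'rV[R]_d2) : R := sqn p.1 + sqn p.2.

Definition grad (R : realType) (d : nat) (g : 'rV[R]_d -> R) (x : 'rV[R]_d) :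
  'rV[R]_d := \row_(i < d) 'D_(delta_mx ord0 i) g x.

Definition grad2 (R : realType) (d1 d2 : nat)
  (g : 'rV[R]_d1 -> 'rV[R]_d2 -> R) (p : 'rV[R]_d1 * 'rV[R]_d2) :
  'rV[R]_d1 * 'rV[R]_d2 := (grad (g ^~ p.2) p.1, grad (g p.1) p.2).

Definition average (R : realType) (n d1 d2 : nat)
  (F : 'I_n -> 'rV[R]_d1 -> 'rV[R]_d2 -> R) (x : 'rV[R]_d1) (y : 'rV[R]_d2) :
  R := n%:R^-1 * \sum_(i < n) F i x y.

Definition averaged_smooth (R : realType) (n d1 d2 : nat) (L : R)
  (F : 'I_n -> 'rV[R]_d1 -> 'rV[R]_d2 -> R) : Prop :=
  (forall i p, differentiable
     (fun u : 'rV[R]_d1 * 'rV[R]_d2 => F i u.1 u.2) p) /\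
  (forall p q : 'rV[R]_d1 * 'rV[R]_d2,
     n%:R^-1 * \sum_(i < n) sqn2 (grad2 (F i) p - grad2 (F i) q)
       <= L ^+ 2 * sqn2 (p - q)).

Definition strongly_concave (R : realType) (d : nat) (mu : R)
  (g : 'rV[R]_d -> R) : Prop :=
  forall (y1 y2 : 'rV[R]_d) (a : R), 0 <= a <= 1 ->
    a * g y1 + (1 - a) * g y2 + mu / 2 * a * (1 - a) * sqn (y1 - y2)
      <= g (a *: y1 + (1 - a) *: y2).

(* In the uses below all maxima and minima are attained, so that they are given
   by sup and inf. *)
Definition primal (R : realType) (d1 d2 : nat)
  (g : 'rV[R]_d1 -> 'rV[R]_d2 -> R) (x : 'rV[R]_d1) : R :=
  sup (range (g x)).

Definition argmax (R : realType) (d : nat) (g : 'rV[R]_d -> R) : 'rV[R]_d :=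
  [get y | forall y', g y' <= g y].

Definition gap (R : realType) (d1 d2 : nat)
  (g : 'rV[R]_d1 -> 'rV[R]_d2 -> R) (p : 'rV[R]_d1 * 'rV[R]_d2) : R :=
  sup (range (g p.1)) - inf (range (g ^~ p.2)).

Definition is_saddle (R : realType) (d1 d2 : nat)
  (g : 'rV[R]_d1 -> 'rV[R]_d2 -> R) (p : 'rV[R]_d1 * 'rV[R]_d2) : Prop :=
  (forall y, g p.1 y <= g p.1 p.2) /\ (forall x, g p.1 p.2 <= g x p.2).

(* \hat f_t, with c = x_0^t *)
Definition stage_obj (R : realType) (d1 d2 : nat) (L : R)
  (g : 'rV[R]_d1 -> 'rV[R]_d2 -> R) (c : 'rV[R]_d1)
  (x : 'rV[R]_d1) (y : 'rV[R]_d2) : R := g x y + L * sqn (x - c).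

(* \tilde f_{t,k}, with c = x_0^t and z = z_k.  Applied to the components of f
   it gives the finite-sum structure of \tilde f_{t,k}. *)
Definition sub_obj (R : realType) (d1 d2 : nat) (L tau : R)
  (g : 'rV[R]_d1 -> 'rV[R]_d2 -> R) (c : 'rV[R]_d1) (z : 'rV[R]_d2)
  (x : 'rV[R]_d1) (y : 'rV[R]_d2) : R :=
  stage_obj L g c x y - tau / 2 * sqn (y - z).

(* A randomized method: from the components of a finite sum, a starting point
   and a random seed, it produces the sequence of iterates. *)
Definition solver (R : realType) (n d1 d2 : nat) (S : Type) : Type :=
  ('I_n -> 'rV[R]_d1 -> 'rV[R]_d2 -> R) -> 'rV[R]_d1 * 'rV[R]_d2 ->
  S -> nat -> 'rV[R]_d1 * 'rV[R]_d2.

Definition borel (R : realType) (d : nat) :=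
  g_sigma_algebraType (@open 'rV[R]_d).

(* The guarantee known for SVRG and SAGA on the subproblems, with rate
   1 - 1 / Lam in expectation over the seed; the measurability clause makes the
   guarantee applicable to subproblems and starting points that are themselves
   random. *)
Definition linearly_convergent (R : realType) (n d1 d2 : nat)
  (F : 'I_n -> 'rV[R]_d1 -> 'rV[R]_d2 -> R) (L tau Lam : R)
  (dS : measure_display) (S : measurableType dS) (Q : probability S R)
  (M : solver R n d1 d2 S) : Prop :=
  [/\ (forall G p s, M G p s 0%N = p),
      (forall N : nat, measurable_fun [set: _]
         (fun u : borel R d1 * borel R d2 * (borel R d1 * borel R d2) * S =>
            M (fun i => sub_obj L tau (F i) u.1.1.1 u.1.1.2) u.1.2 u.2 N
            : borel R d1 * borel R d2)) &
      (forall c z p r, is_saddle (sub_obj L tau (average F) c z) r ->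
         forall N : nat,
         ('E_Q[fun s =>
            sqn2 (M (fun i => sub_obj L tau (F i) c z) p s N - r)%R]
          <= ((1 - Lam^-1) ^+ N * sqn2 (p - r))%:E)%E)].

(* The case where J is a singleton says that every xi i has law Q. *)
Definition iid (R : realType) (I : choiceType)
  (dO dS : measure_display) (Omega : measurableType dO) (S : measurableType dS)
  (P : probability Omega R) (Q : probability S R) (xi : I -> Omega -> S) :
  Prop :=
  (forall i, measurable_fun [set: Omega] (xi i)) /\
  (forall (J : seq I) (A : I -> set S), uniq J ->
     (forall i, measurable (A i)) ->
     P (\bigcap_(i in [set` J]) (xi i @^-1` A i))
       = (\prod_(i <- J) fine (Q (A i)))%:E).

Definition first_index (A : nat -> Prop) : nat :=
  xget 0%N [set N | A N /\ forall m, (m < N)%N -> ~ A m].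

Definition hitting_time (R : realType) (A : nat -> Prop) : \bar R :=
  if `[< exists N, A N >] then (first_index A)%:R%:E else +oo%E.

Section Catalyst.
Context (R : realType) (n d1 d2 : nat).
Local Notation E := ('rV[R]_d1 * 'rV[R]_d2)%type.
Context (F : 'I_n -> 'rV[R]_d1 -> 'rV[R]_d2 -> R) (L mu tau : R)
  (S : Type) (M : solver R n d1 d2 S).
(* alpha t is the stage tolerance; tol t p k is the tolerance \epsilon^t_k when
   (x_0^t, y_0^t) = p. *)
Context (alpha : nat -> R) (tol : nat -> E -> nat -> R).

Let f := average F.
Let q := mu / (mu + tau).
Let momentum := (Num.sqrt q - q) / (Num.sqrt q + q).

Section Stage.
Context (t : nat) (p0 : E) (seed : nat -> S).

Definition sub_run (p : E) (z : 'rV[R]_d2) (k : nat) : nat -> E :=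
  M (fun i => sub_obj L tau (F i) p0.1 z) p (seed k).

Definition sub_solved (p : E) (z : 'rV[R]_d2) (k N : nat) : Prop :=
  sqn2 (grad2 (sub_obj L tau f p0.1 z) (sub_run p z k N)) <= tol t p0 k.

(* ((x_k, y_k), z_{k+1}).  The sequence is continued past the stopping index of
   the stage, which is read off afterwards. *)
Fixpoint inner (k : nat) : E * 'rV[R]_d2 :=
  if k is j.+1 then
    let: (p, z) := inner j in
    let p' := sub_run p z k (first_index (sub_solved p z k)) in
    (p', p'.2 + momentum *: (p'.2 - p.2))
  else (p0, p0.2).

Definition stage_stop (k : nat) : Prop :=
  (0 < k)%N /\
  sqn2 (grad2 (stage_obj L f p0.1) (inner k).1)
    <= alpha t * sqn2 (grad2 (stage_obj L f p0.1) p0).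

Definition stage_output : E := (inner (first_index stage_stop)).1.

(* Number of iterations of M in the k-th subproblem (k >= 1). *)
Definition inner_time (k : nat) : \bar R :=
  hitting_time R (sub_solved (inner k.-1).1 (inner k.-1).2 k).

(* cN component gradients per iteration of M, and one full gradient of f at
   (x_0^t, y_0^t) and at each (x_k^t, y_k^t) for the stopping test.  The value
   is +oo if one of the loops does not stop. *)
Definition stage_cost (cN : R) : \bar R :=
  if `[< exists k, stage_stop k >] then
    (n%:R%:E +
     \sum_(1 <= k < (first_index stage_stop).+1)
       (cN%:E * inner_time k + n%:R%:E))%E
  else +oo%E.

End Stage.

Context (p0 : E) (seed : nat -> nat -> S).

(* (x_0^t, y_0^t) *)
Fixpoint outer (t : nat) : E :=
  if t is u.+1 then stage_output u (outer u) (seed u) else p0.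

Definition total_cost (cN : R) (T : nat) : \bar R :=
  (\sum_(0 <= t < T.+1) stage_cost t (outer t) (seed t) cN)%E.

(* Conditional mean of |grad Phi (\hat x_T)|^2 given the trajectory, when
   \hat x_T is uniform on x_0^1, ..., x_0^T. *)
Definition output_sq_grad (T : nat) : R :=
  T%:R^-1 * \sum_(1 <= t < T.+1) sqn (grad (primal f) (outer t).1).

End Catalyst.

Definition stage_tol (R : realType) (L mu : R) (t : nat) : R :=
  if t is 0 then mu ^+ 5 / (576 * Num.max 1 (L ^+ 7))
  else mu ^+ 5 / (504 * L ^+ 5).

Definition inner_tol (R : realType) (n d1 d2 : nat)
  (F : 'I_n -> 'rV[R]_d1 -> 'rV[R]_d2 -> R) (L mu tau : R)
  (t : nat) (p : 'rV[R]_d1 * 'rV[R]_d2) (k : nat) : R :=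
  let rho := 9 / 10 * Num.sqrt (mu / (mu + tau)) in
  Num.sqrt 2 * mu / 2 * (1 - rho) ^+ k
    * gap (stage_obj L (average F) p.1) p.

(* Main.v *)
Require Import Defs.
From HB Require Import structures.
From mathcomp Require Import all_boot all_order all_algebra.
From mathcomp Require Import all_classical all_reals all_analysis.
From mathcomp Require Import measurable_realfun ring lra.

Set Implicit Arguments.
Unset Strict Implicit.
Unset Printing Implicit Defensive.

Import Order.TTheory GRing.Theory Num.Theory.
Import numFieldNormedType.Exports.

Local Open Scope classical_set_scope.
Local Open Scope ring_scope.

(** The algorithm nests three loops, and each has its own reason for stopping
    early.

    Outer loop.  A stage replaces [f] by [f + L |x - c|^2] with [c] the current
    point, so up to its tolerance it performs a proximal point step on the primal
    function [Phi x = max_y f x y].  Call [kappa^2] times the squared gradient of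
    the stage objective at its end the error of a stage.  The stage objective is
    strongly convex in [x]; comparing it at the old and at the new point shows
    that [L^2] times the squared step is at most [L] times the decrease of [Phi]
    plus the error ([stage_descent]).  The relative stopping rule makes the error
    of a stage a small fraction of the preceding step and error ([later_stage]),
    and the error of the first stage is at most [L * (Delta + Dy0)]
    ([first_stage]).
    Since the gradient of [Phi] is the partial gradient of [f] at the maximizer
    ([primal_quadratic], a quantitative Danskin theorem), it is small when the
    step and the error are, and summation gives
    [sum_t |grad Phi (x_t)|^2 <= 26 * L * (Delta + Dy0)]
    ([sum_grad_primal_le]).  Hence [T] of order [L * (Delta + Dy0) / eps^2]
    stages suffice.

    One stage.  Minimizing over [x] leaves a [mu]-strongly concave dual function
    of [y], on which the iteration is an inexact accelerated proximal method.
    With [q = mu / (mu + tau)] the usual potential contracts by [1 - sqrt q] per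
    step, up to the tolerances ([lyapunov_step]).  These decay slightly more
    slowly, at rate [1 - 0.9 * sqrt q], and so does everything else; in
    particular the stopping test of the stage holds after a number [K] of
    iterations that is logarithmic up to the factor [1 / sqrt q]
    ([stage_decay], [exists_stage_length]).  Moreover each subproblem starts
    within a factor polynomial in [kappa] of its own tolerance ([warm_start]).

    One subproblem.  The solver contracts the expected squared distance by
    [1 - 1 / Lam] per step, so by Markov's inequality the subproblem is still
    unsolved after [N] steps with probability at most
    [B * (1 - 1 / Lam) ^ N], where [B] is polynomial in [kappa]
    ([unsolved_probability], [unsolved_decay_uniform]).  Summing over [N]
    gives an expected waiting time of at most [Lam * (ln B + 2)]
    ([sum_survival_le]).  The subproblem is itself
    random, but it depends on earlier seeds only; since all oracles and iterates
    are measurable, Fubini's theorem allows the fresh seed to be integrated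
    first ([past_fubini], [past_bound], [expected_waiting]).  Almost surely
    every subproblem is solved ([stuck_negligible]), and then the deterministic
    bounds on stages and iterations apply.  The expected cost is therefore at
    most the sum, over [T + 1] stages and [K] iterations per stage, of the
    expected costs of single iterations.

    Sizes.  The choice of [tau] makes [Lam] of order [n] ([solver_rate_le]) and
    [n / sqrt q] at most [n + n^(3/4) * sqrt kappa] ([acceleration_cost]); this
    is the cost of a stage up to logarithms, one factor from [K] and one from
    [ln B]. *)

(** * Euclidean geometry *)

Section Euclid.
Context (R : realType).

Definition dot (d : nat) (u v : 'rV[R]_d) : R :=
  \sum_(i < d) u ord0 i * v ord0 i.

Section OneSpace.
Context (d : nat).
Implicit Types u v w : 'rV[R]_d.

Lemma dotC u v : dot u v = dot v u.
Proof. by apply: eq_bigr => i _; rewrite mulrC. Qed.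

Lemma dotDl u v w : dot (u + v) w = dot u w + dot v w.
Proof. by rewrite -big_split; apply: eq_bigr => i _; rewrite mxE mulrDl. Qed.

Lemma dotZl a u v : dot (a *: u) v = a * dot u v.
Proof. by rewrite mulr_sumr; apply: eq_bigr => i _; rewrite mxE mulrA. Qed.

Lemma dotNl u v : dot (- u) v = - dot u v.
Proof. by rewrite -scaleN1r dotZl mulN1r. Qed.

Lemma dotDr u v w : dot w (u + v) = dot w u + dot w v.
Proof. by rewrite dotC dotDl !(dotC w). Qed.

Lemma dotZr a u v : dot u (a *: v) = a * dot u v.
Proof. by rewrite dotC dotZl dotC. Qed.

Lemma dotNr u v : dot u (- v) = - dot u v.
Proof. by rewrite dotC dotNl dotC. Qed.

Lemma dot0l u : dot 0 u = 0.
Proof. by rewrite -(scale0r u) dotZl mul0r. Qed.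

Lemma dot0r u : dot u 0 = 0.
Proof. by rewrite dotC dot0l. Qed.

Definition dotE := (dotDl, dotDr, dotNl, dotNr, dotZl, dotZr, dot0l, dot0r).

Lemma sqn_dot u : sqn u = dot u u.
Proof. by apply: eq_bigr => i _; rewrite expr2. Qed.

Lemma sqn_ge0 u : 0 <= sqn u.
Proof. by apply: sumr_ge0 => i _; rewrite sqr_ge0. Qed.

Lemma sqn_eq0 u : (sqn u == 0) = (u == 0).
Proof.
apply/idP/eqP => [|->]; last by rewrite sqn_dot dot0l eqxx.
rewrite psumr_eq0 => [/allP h|i _]; last exact: sqr_ge0.
apply/rowP => i; rewrite mxE; apply/eqP; rewrite -sqrf_eq0.
by apply: (implyP (h i _)) => //; rewrite mem_index_enum.
Qed.

Lemma sqn0 : sqn (0 : 'rV[R]_d) = 0.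
Proof. by apply/eqP; rewrite sqn_eq0. Qed.

Lemma sqnZ a u : sqn (a *: u) = a ^+ 2 * sqn u.
Proof. by rewrite !sqn_dot !dotE mulrA expr2. Qed.

Lemma sqnN u : sqn (- u) = sqn u.
Proof. by rewrite !sqn_dot !dotE opprK. Qed.

Lemma sqnB_sym u v : sqn (u - v) = sqn (v - u).
Proof. by rewrite -sqnN opprB. Qed.

Lemma sqnD u v : sqn (u + v) = sqn u + 2 * dot u v + sqn v.
Proof. by rewrite !sqn_dot !dotE (dotC v u); ring. Qed.

Lemma sqnB u v : sqn (u - v) = sqn u - 2 * dot u v + sqn v.
Proof. by rewrite sqnD sqnN dotNr; ring. Qed.

Lemma dot_young a u v : 0 < a -> dot u v <= a / 2 * sqn u + a^-1 / 2 * sqn v.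
Proof.
move=> a0; have := sqn_ge0 (a *: u - v); rewrite sqnB sqnZ dotZl => h.
have -> : a / 2 * sqn u + a^-1 / 2 * sqn v =
    a^-1 / 2 * (a ^+ 2 * sqn u - 2 * (a * dot u v) + sqn v) + dot u v.
  by field; rewrite gt_eqF.
by rewrite lerDr mulr_ge0// divr_ge0// invr_ge0 ltW.
Qed.

Lemma sqnD_le u v : sqn (u + v) <= 2 * sqn u + 2 * sqn v.
Proof. by have := sqn_ge0 (u - v); rewrite sqnB sqnD; lra. Qed.

Lemma sqnB_le u v : sqn (u - v) <= 2 * sqn u + 2 * sqn v.
Proof. by rewrite -(sqnN v) sqnD_le. Qed.

Lemma sqn_norm_le u : `|u| ^+ 2 <= sqn u.
Proof.
rewrite [`|u|]mx_normrE.
apply: (big_ind (fun r : R => r ^+ 2 <= sqn u)) => [|x y hx hy|[i j] _].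
- by rewrite expr0n sqn_ge0.
- by rewrite /Num.max; case: ifP.
- rewrite real_normK ?num_real// /sqn (bigD1 j)//= -[leLHS]addr0 (ord1 i).
  by apply: lerD => //; apply: sumr_ge0 => k _; exact: sqr_ge0.
Qed.

Lemma sqn_le_norm u : sqn u <= d%:R * `|u| ^+ 2.
Proof.
have -> : d%:R * `|u| ^+ 2 = \sum_(i < d) `|u| ^+ 2.
  by rewrite sumr_const card_ord mulr_natl.
apply: ler_sum => i _.
rewrite -real_normK ?num_real// lerXn2r ?nnegrE ?normr_ge0//.
by rewrite [`|u|]mx_normrE; apply/bigmax_geP; right; exists (ord0, i).
Qed.

End OneSpace.

Section TwoSpaces.
Context (d1 d2 : nat).
Local Notation E := ('rV[R]_d1 * 'rV[R]_d2)%type.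
Implicit Types p q : E.

Lemma sqn2_ge0 p : 0 <= sqn2 p.
Proof. by rewrite addr_ge0// sqn_ge0. Qed.

Lemma sqn2_eq0 p : (sqn2 p == 0) = (p == 0).
Proof.
rewrite paddr_eq0 ?sqn_ge0// !sqn_eq0; case: p => x y /=.
by apply/andP/eqP => [[/eqP -> /eqP ->]//|[-> ->]].
Qed.

Lemma sqn2_0 : sqn2 (0 : E) = 0. Proof. by apply/eqP; rewrite sqn2_eq0. Qed.

Lemma sqn2D_le p q : sqn2 (p + q) <= 2 * sqn2 p + 2 * sqn2 q.
Proof.
by have := sqnD_le p.1 q.1; have := sqnD_le p.2 q.2; rewrite /sqn2 /=; lra.
Qed.

Lemma sqn2B_le p q : sqn2 (p - q) <= 2 * sqn2 p + 2 * sqn2 q.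
Proof.
by have := sqnB_le p.1 q.1; have := sqnB_le p.2 q.2; rewrite /sqn2 /=; lra.
Qed.

End TwoSpaces.

Lemma sqn_row_mx d1 d2 (x : 'rV[R]_d1) (y : 'rV[R]_d2) :
  sqn (row_mx x y) = sqn x + sqn y.
Proof.
rewrite /sqn big_split_ord /=; congr (_ + _); apply: eq_bigr => i _.
  by rewrite row_mxEl.
by rewrite row_mxEr.
Qed.

End Euclid.

(** * Gradients and quadratic bounds *)

Section Gradient.
Context (R : realType) (d : nat).
Implicit Types (g : 'rV[R]_d -> R) (x h v : 'rV[R]_d).

(** Directional derivatives that are linear in the direction.  Unlike
    differentiability, this follows at once from a two-sided quadratic bound,
    which is how the maximum function of the minimax problem is treated. *)
Definition has_grad g x v : Prop := forall h, is_derive x h g (dot v h).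

Lemma dot_delta v i : dot v (delta_mx ord0 i) = v ord0 i.
Proof.
rewrite /dot (bigD1 i)//= mxE !eqxx mulr1 big1 ?addr0// => j ji.
by rewrite mxE (negbTE ji) andbF mulr0.
Qed.

Lemma has_gradE g x v : has_grad g x v -> grad g x = v.
Proof.
move=> hg; apply/rowP => i; rewrite mxE.
by have [_ ->] := hg (delta_mx ord0 i); rewrite dot_delta.
Qed.

Lemma differentiable_has_grad g x :
  differentiable g x -> has_grad g x (grad g x).
Proof.
move=> dg h; apply: DeriveDef; first exact: diff_derivable.
rewrite deriveE// [h in LHS]row_sum_delta linear_sum; apply: eq_bigr => i _.
by rewrite linearZ /= mxE deriveE// mulrC.
Qed.

Lemma is_derive_quadratic g x h (l C : R) :
  (forall t : R, `|g (x + t *: h) - g x - t * l| <= C * t ^+ 2) ->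
  is_derive x h g l.
Proof.
move=> gq.
have C0 : 0 <= C by have := gq 1; rewrite expr1n mulr1; exact: le_trans.
suff cv : (fun t => t^-1 *: ((g \o shift x) (t *: h) - g x)) @ 0^' --> l.
  split; first by apply/cvg_ex; exists l.
  exact: cvg_lim.
apply/cvgrPdist_le => e e0; near=> t.
have t0 : t != 0 by near: t; exact: nbhs_dnbhs_neq.
rewrite distrC /= [_ + x]addrC.
have -> : t^-1 *: (g (x + t *: h) - g x) - l = t^-1 * (g (x + t *: h) - g x - t * l).
  by rewrite mulrBr mulKf.
rewrite normrM normfV ler_pdivrMl ?normr_gt0//.
apply: (le_trans (gq t)); rewrite -real_normK ?num_real// expr2 mulrA mulrC.
apply: ler_wpM2l => //.
have Ct : `|t| <= e / (C + 1).
  near: t; apply: dnbhs0_le.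
  by rewrite divr_gt0// ltr_wpDl.
apply: (le_trans (ler_wpM2l C0 Ct)).
rewrite mulrA ler_pdivrMr ?ltr_wpDl// mulrC mulrDr mulr1 lerDl.
exact: ltW.
Unshelve. all: by end_near. Qed.

Lemma has_grad_quadratic (a : R) (c x : 'rV[R]_d) :
  has_grad (fun u => a * sqn (u - c)) x ((2 * a) *: (x - c)).
Proof.
move=> h; apply: (@is_derive_quadratic _ _ _ _ (`|a| * sqn h)) => t.
rewrite (addrAC x (t *: h) (- c)) (sqnD (x - c)) (sqnZ t h) dotZl !dotZr.
have -> : a * (sqn (x - c) + 2 * (t * dot (x - c) h) + t ^+ 2 * sqn h)
   - a * sqn (x - c) - t * (2 * a * dot (x - c) h) = a * sqn h * t ^+ 2 by ring.
by rewrite normrM normrM (ger0_norm (sqn_ge0 _)) [`|t ^+ 2|]ger0_norm ?sqr_ge0.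
Qed.

Lemma has_gradD g1 g2 x v1 v2 :
  has_grad g1 x v1 -> has_grad g2 x v2 ->
  has_grad (fun u => g1 u + g2 u) x (v1 + v2).
Proof. by move=> h1 h2 h; rewrite dotDl; exact: is_deriveD. Qed.

Lemma has_gradN g x v : has_grad g x v -> has_grad (fun u => - g u) x (- v).
Proof. by move=> h1 h; rewrite dotNl; exact: is_deriveN. Qed.

Lemma has_grad_cst (c : R) x : has_grad (fun=> c) x 0.
Proof. by move=> h; rewrite dot0l; exact: is_derive_cst. Qed.

Lemma has_grad_along g x h v (t : R) : has_grad g (x + t *: h) v ->
  is_derive t 1 (fun s : R => g (x + s *: h)) (dot v h).
Proof.
move=> hg; have [ex val] := hg h.
have e : (fun s => s^-1 *: (((fun s : R => g (x + s *: h)) \o shift t) (s *: 1)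
    - g (x + t *: h))) =
    (fun s => s^-1 *: ((g \o shift (x + t *: h)) (s *: h) - g (x + t *: h))).
  apply/funext => s /=; congr (_ *: (g _ - _)).
  by rewrite scalerDl addrCA addrC /GRing.scale /= mulr1 addrC addrA addrAC.
split; first by rewrite /derivable e.
by rewrite -val /derive e.
Qed.

Lemma mean_value g (G : 'rV[R]_d -> 'rV[R]_d) x h :
  (forall u, has_grad g u (G u)) ->
  exists2 t : R, 0 < t < 1 & g (x + h) - g x = dot (G (x + t *: h)) h.
Proof.
move=> hG.
have dv (t : R) : is_derive t 1 (fun s : R => g (x + s *: h))
    (dot (G (x + t *: h)) h) by exact: has_grad_along.
have [|t] := @MVT R (fun s : R => g (x + s *: h)) _ 0 1 ltr01 (fun t _ => dv t).
  apply: derivable_within_continuous => t _.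
  exact: ex_derive.
rewrite in_itv /= => t01; rewrite scale1r scale0r addr0 subr0 mulr1 => e.
by exists t.
Qed.

(** Adding the parabola of curvature [L] turns the gradient into a field that
    is monotone along the segment, which gives the sharp constant [L / 2]; the
    constant matters, as the proximal term added later has curvature [2 * L]. *)
Lemma quadratic_lower_bound g (G : 'rV[R]_d -> 'rV[R]_d) (L : R) x u :
  0 < L -> (forall z, has_grad g z (G z)) ->
  (forall z, sqn (G z - G x) <= L ^+ 2 * sqn (z - x)) ->
  g x + dot (G x) (u - x) - L / 2 * sqn (u - x) <= g u.
Proof.
move=> L0 hG hL.
pose k z := g z + (L / 2 * sqn (z - x) + - dot (G x) (z - x)).
have hl z : has_grad (fun w => dot (G x) (w - x)) z (G x).
  move=> h; apply: (@is_derive_quadratic _ _ _ _ 0) => t.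
  by rewrite !dotE mul0r normr_le0; apply/eqP; ring.
have hk z : has_grad k z (G z + ((2 * (L / 2)) *: (z - x) + - G x)).
  apply: has_gradD => //; apply: has_gradD; first exact: has_grad_quadratic.
  exact: has_gradN.
have [t /andP[t0 _]] := mean_value x (u - x) hk.
rewrite [x + _]addrC subrK /k subrr sqn0 dot0r.
set y := x + _; have yx : y - x = t *: (u - x) by rewrite /y addrC addKr.
suff h0 : 0 <= dot (G y + ((2 * (L / 2)) *: (y - x) + - G x)) (u - x) by lra.
rewrite -(pmulr_rge0 _ t0) -dotZr -yx.
have Li : 0 < L^-1 by rewrite invr_gt0.
have := dot_young (G x - G y) (y - x) Li; rewrite invrK.
have := hL y; rewrite sqnB_sym => h1 h2.
have h3 : L^-1 / 2 * sqn (G x - G y) <= L / 2 * sqn (y - x).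
  have -> : L / 2 * sqn (y - x) = L^-1 / 2 * (L ^+ 2 * sqn (y - x)).
    by field; rewrite gt_eqF.
  by apply: ler_wpM2l h1; rewrite divr_ge0// ltW.
have -> : G y + ((2 * (L / 2)) *: (y - x) - G x) =
    L *: (y - x) - (G x - G y).
  by rewrite [2 * _]mulrC divfK// opprB addrCA.
by rewrite dotDl dotNl dotZl -sqn_dot; lra.
Qed.

(** First-order form of strong concavity: divide the defining inequality by the
    weight [a] and let [a] tend to zero. *)
Lemma strongly_concave_grad (mu : R) g x v u :
  strongly_concave mu g -> has_grad g x v ->
  g u <= g x + dot v (u - x) - mu / 2 * sqn (u - x).
Proof.
move=> sc hg; rewrite -subr_ge0.
have [ex val] := hg (u - x).
have cv : (fun t : R => t^-1 *: ((g \o shift x) (t *: (u - x)) - g x)) @ 0^'+ -->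
    dot v (u - x).
  rewrite -val; exact: cvg_dnbhs_at_right ex.
have cv2 : (fun t : R => g u - g x + mu / 2 * (1 - t) * sqn (u - x)) @ 0^'+ -->
    g u - g x + mu / 2 * (1 - 0) * sqn (u - x).
  apply: cvgD; first exact: cvg_cst.
  apply: cvgMl; apply: cvgMr; apply: cvgB; first exact: cvg_cst.
  exact: cvg_at_right_filter.
suff : g u - g x + mu / 2 * (1 - 0) * sqn (u - x) <= dot v (u - x) by lra.
apply: ler_cvg_to cv2 cv _; near=> t.
have t0 : 0 < t by [].
have t1 : t <= 1 by near: t; apply: nbhs_right_le.
rewrite /= -(ler_pM2l t0) /GRing.scale /= mulVKf ?gt_eqF//.
have /(_ u x t) := sc; rewrite (ltW t0) t1 => /(_ isT).
have -> : t *: u + (1 - t) *: x = t *: (u - x) + x.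
  by rewrite scalerBr scalerBl scale1r addrA addrAC.
by lra.
Unshelve. all: by end_near. Qed.

End Gradient.

(** * Fixed points of Euclidean contractions *)

Section Contraction.
Context (R : realType).

HB.instance Definition _ d := Complete.on 'rV[R]_d.

(** The library norm on row vectors is the sup norm, for which a Euclidean
    contraction need not be one; a high iterate is. *)
Lemma euclid_contraction_row d (T : 'rV[R]_d -> 'rV[R]_d) (th : R) :
  0 <= th < 1 -> (forall u v, sqn (T u - T v) <= th * sqn (u - v)) ->
  exists u, T u = u.
Proof.
move=> /andP[th0 th1] hT.
have hN N u v : sqn (iter N T u - iter N T v) <= th ^+ N * sqn (u - v).
  elim: N => [|N IH]; first by rewrite expr0 mul1r.
  by rewrite /= (le_trans (hT _ _))// exprS -mulrA ler_wpM2l.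
(* the sup norm is within a factor [d] of the squared Euclidean norm *)
have [N hth] : exists N, th ^+ N * d%:R <= 2^-1 ^+ 2.
  have /cvgrPdist_le /(_ ((2^-1 ^+ 2) / (d%:R + 1))) : (GRing.exp th : R^nat) @ \oo --> 0.
    by apply: cvg_expr; rewrite ger0_norm.
  case=> [|N _ /(_ N (leqnn N))].
    by rewrite divr_gt0 ?exprn_gt0 ?invr_gt0// ltr_wpDl ?ler0n.
  rewrite sub0r normrN ger0_norm ?exprn_ge0// ler_pdivlMr ?ltr_wpDl ?ler0n//.
  move=> h; exists N; apply: le_trans h; rewrite mulrDr mulr1 lerDl.
  exact: exprn_ge0.
have h2 : (0 : R) <= 2^-1 by rewrite invr_ge0.
have ctr : is_contraction (totalfun (iter N T)).
  exists (NngNum h2); split => /=; first by rewrite invf_lt1// ltr1n.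
  move=> [u v] _ /=.
  rewrite -(@ler_pXn2r _ 2)// ?nnegrE ?mulr_ge0 ?normr_ge0// exprMn.
  apply: (le_trans (sqn_norm_le _)); apply: (le_trans (hN _ _ _)).
  apply: (@le_trans _ _ (th ^+ N * (d%:R * `|u - v| ^+ 2))).
    by rewrite ler_wpM2l ?exprn_ge0// sqn_le_norm.
  by rewrite mulrA ler_wpM2r ?sqr_ge0.
have [|u _ /= hu] := banach_fixed_point ctr closedT; first by exists 0.
have {}hu : iter N T u = u by exact/esym.
exists u; apply/eqP; rewrite -subr_eq0 -sqn_eq0.
have := hN N (T u) u; rewrite -iterSr iterS hu => h.
have := sqn_ge0 (T u - u); rewrite le_eqVlt => /orP[/eqP <-//|s0].
have d0 : (0 < d)%N.
  rewrite lt0n; apply/eqP => d0; move: s0; rewrite /sqn big1 ?ltxx// => i _.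
  by move: (ltn_ord i); rewrite {2}d0.
have thN : th ^+ N < 1.
  apply: (le_lt_trans (y := 2^-1 ^+ 2)).
    apply: le_trans hth; rewrite -[leLHS]mulr1 ler_wpM2l ?exprn_ge0//.
    by rewrite ler1n.
  by rewrite expr_lt1// invf_lt1// ltr1n.
move: h; rewrite leNgt => /negP[]; rewrite -subr_gt0 -{1}(mul1r (sqn _)) -mulrBl.
by rewrite mulr_gt0// subr_gt0.
Qed.

Lemma euclid_contraction d1 d2
    (T : 'rV[R]_d1 * 'rV[R]_d2 -> 'rV[R]_d1 * 'rV[R]_d2) (th : R) :
  0 <= th < 1 -> (forall p q, sqn2 (T p - T q) <= th * sqn2 (p - q)) ->
  exists p, T p = p.
Proof.
move=> hth hT.
pose pr (u : 'rV[R]_(d1 + d2)) := (lsubmx u, rsubmx u).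
pose T' u := row_mx (T (pr u)).1 (T (pr u)).2.
have e u v : sqn (u - v) = sqn2 (pr u - pr v).
  by rewrite -{1}(hsubmxK u) -{1}(hsubmxK v) opp_row_mx add_row_mx sqn_row_mx.
have [u v|u hu] := @euclid_contraction_row _ T' th hth.
  rewrite e; have -> : pr (T' u) = T (pr u).
    by rewrite /pr row_mxKl row_mxKr -surjective_pairing.
  have -> : pr (T' v) = T (pr v).
    by rewrite /pr row_mxKl row_mxKr -surjective_pairing.
  by rewrite (le_trans (hT _ _))// e.
exists (pr u); rewrite -{2}hu /pr row_mxKl row_mxKr.
exact: surjective_pairing.
Qed.

End Contraction.

(** * Saddle problems given by first-order inequalities *)

Section SaddleField.
Context (R : realType) (d1 d2 : nat).
Local Notation E := ('rV[R]_d1 * 'rV[R]_d2)%type.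
Implicit Types (g : 'rV[R]_d1 -> 'rV[R]_d2 -> R) (G : E -> E).

(** [G] is the gradient field of a function of curvature at least [a] in its
    first and at most [- b] in its second argument.  All that is used of a
    minimax problem is contained in these first-order inequalities. *)
Definition saddle_field (a b l : R) g G : Prop :=
  [/\ forall x y u, g x y + dot (G (x, y)).1 (u - x) + a / 2 * sqn (u - x) <= g u y,
      forall x y v, g x v <= g x y + dot (G (x, y)).2 (v - y) - b / 2 * sqn (v - y) &
      forall p q, sqn2 (G p - G q) <= l ^+ 2 * sqn2 (p - q)].

Section Theory.
Context (a b l : R) (g : 'rV[R]_d1 -> 'rV[R]_d2 -> R) (G : E -> E).
Hypothesis sf : saddle_field a b l g G.

(** Adding the four first-order inequalities between two points eliminates the
    function values. *)
Lemma saddle_monotone (p q : E) :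
  a * sqn (p.1 - q.1) + b * sqn (p.2 - q.2) <=
  dot (G p - G q).1 (p.1 - q.1) - dot (G p - G q).2 (p.2 - q.2).
Proof.
have [hx hy _] := sf; case: p q => [x y] [u v] /=.
have := hx x y u; have := hy x y v; have := hx u v x; have := hy u v y.
rewrite -(opprB x u) -(opprB y v) !sqnN !dotNr !dotDl !dotNl.
by lra.
Qed.

Lemma monotone_y x y v :
  b * sqn (y - v) <= - dot ((G (x, y)).2 - (G (x, v)).2) (y - v).
Proof. by have := saddle_monotone (x, y) (x, v); rewrite /= subrr sqn0 dot0r; lra. Qed.

Lemma monotone_x x u y :
  a * sqn (x - u) <= dot ((G (x, y)).1 - (G (u, y)).1) (x - u).
Proof. by have := saddle_monotone (x, y) (u, y); rewrite /= subrr sqn0 dot0r; lra. Qed.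

(** A small field means a point close to its zero: this turns stopping tests on
    gradients into distances. *)
Lemma saddle_expansion m (p q : E) : 0 < m -> m <= a -> m <= b ->
  m ^+ 2 * sqn2 (p - q) <= sqn2 (G p - G q).
Proof.
move=> m0 ma mb; have := saddle_monotone p q.
have hm : m * sqn2 (p - q) <= a * sqn (p.1 - q.1) + b * sqn (p.2 - q.2).
  by rewrite /sqn2 /= mulrDr lerD// ler_wpM2r// sqn_ge0.
have mi : 0 < m^-1 by rewrite invr_gt0.
have := dot_young (G p - G q).1 (p.1 - q.1) mi.
have := dot_young (- (G p - G q).2) (p.2 - q.2) mi.
rewrite invrK dotNl sqnN => h1 h2 h3.
have h : m * sqn2 (p - q) <= m^-1 / 2 * sqn2 (G p - G q) + m / 2 * sqn2 (p - q).
  by move: hm h1 h2 h3; rewrite /sqn2 /=; lra.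
have {}h : m / 2 * sqn2 (p - q) <= m^-1 / 2 * sqn2 (G p - G q) by lra.
rewrite -(ler_pM2l (divr_gt0 (ltr0n R 2) m0)).
have e1 : 2 / m * (m ^+ 2 * sqn2 (p - q)) = 4 * (m / 2 * sqn2 (p - q)).
  by field; rewrite gt_eqF.
have e2 : 2 / m * sqn2 (G p - G q) = 4 * (m^-1 / 2 * sqn2 (G p - G q)).
  by field; rewrite gt_eqF.
rewrite e1 e2; lra.
Qed.

(** Gradient descent-ascent with step [m / l ^+ 2] contracts, where [m] is the
    smaller curvature. *)
Lemma saddle_zero : 0 < a -> 0 < b -> 0 < l -> exists p, G p = 0.
Proof.
move=> a0 b0 l0; have [_ _ hl0] := sf.
(* the contraction factor [1 - m ^+ 2 / l ^+ 2] is nonnegative once [m <= l] *)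
pose l' := Num.max l (Num.max a b).
have l'0 : 0 < l' by rewrite lt_max l0.
have hl p q : sqn2 (G p - G q) <= l' ^+ 2 * sqn2 (p - q).
  apply: (le_trans (hl0 p q)); rewrite ler_wpM2r ?sqn2_ge0//.
  by rewrite lerXn2r ?nnegrE ?(ltW l'0) ?(ltW l0)// le_max lexx.
have la : a <= l' by rewrite !le_max lexx orbT.
pose m := Num.min a b.
have m0 : 0 < m by rewrite lt_min a0.
have l20 : 0 < l' ^+ 2 by rewrite exprn_gt0.
pose s := m / l' ^+ 2.
have s0 : 0 < s by rewrite divr_gt0.
pose T (p : E) : E := (p.1 - s *: (G p).1, p.2 + s *: (G p).2).
have [||p hp] := @euclid_contraction R d1 d2 T (1 - s * m).
- rewrite subr_ge0 gtrBl mulr_gt0// andbT /s mulrAC ler_pdivrMr// mul1r -expr2.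
  by rewrite lerXn2r ?nnegrE ?(ltW m0) ?(ltW l'0)// ge_min la.
- move=> p q; have := saddle_monotone p q; have := hl p q.
  rewrite {1 3}/sqn2 /T /=.
  have -> : p.1 - s *: (G p).1 - (q.1 - s *: (G q).1) =
      (p.1 - q.1) - s *: (G p - G q).1.
    by apply/rowP => i; rewrite !mxE; ring.
  have -> : p.2 + s *: (G p).2 - (q.2 + s *: (G q).2) =
      (p.2 - q.2) + s *: (G p - G q).2.
    by rewrite /= scalerBr opprD addrACA.
  rewrite (sqnB _ (s *: _)) (sqnD _ (s *: _)) !(sqnZ s) !dotZr.
  rewrite (dotC (p.1 - q.1)) (dotC (p.2 - q.2)) => h1 h2.
  have hm : m * sqn2 (p - q) <= a * sqn (p.1 - q.1) + b * sqn (p.2 - q.2).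
    by rewrite /sqn2 /= mulrDr lerD// ler_wpM2r ?sqn_ge0// ge_min lexx ?orbT.
  have h3 := ler_wpM2l (ltW s0) (le_trans hm h2).
  have h4 := ler_wpM2l (sqr_ge0 s) h1.
  have e : s ^+ 2 * (l' ^+ 2 * sqn2 (p - q)) = s * (m * sqn2 (p - q)).
    by rewrite /s; field; rewrite gt_eqF.
  rewrite e in h4; rewrite /= in h2 h3 h4 *.
  move: h3 h4; rewrite /sqn2 /=; lra.
exists p; case: p hp => x y; rewrite /T /=; case: (G (x, y)) => u v /= [hu hv].
have su : s *: u = 0 by apply/oppr_inj; rewrite oppr0; apply: (addrI x); rewrite addr0.
have sv : s *: v = 0 by apply: (addrI y); rewrite addr0.
have -> : u = 0 by apply: (scalerI (lt0r_neq0 s0)); rewrite scaler0.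
by have -> : v = 0 by apply: (scalerI (lt0r_neq0 s0)); rewrite scaler0.
Qed.

Lemma zero_is_saddle r : 0 <= a -> 0 <= b -> G r = 0 -> is_saddle g r.
Proof.
move=> a0 b0; have [hx hy _] := sf; case: r => x y Gr; split => [v|u] /=.
- have := hy x y v; rewrite Gr dot0l.
  by have := mulr_ge0 b0 (sqn_ge0 (v - y)); lra.
- have := hx x y u; rewrite Gr dot0l.
  by have := mulr_ge0 a0 (sqn_ge0 (u - x)); lra.
Qed.

Lemma stationary_max x y v : (G (x, y)).2 = 0 ->
  g x v <= g x y - b / 2 * sqn (v - y).
Proof. by have [_ hy _] := sf; have := hy x y v => + e; rewrite e dot0l addr0. Qed.

Lemma stationary_min x y u : (G (x, y)).1 = 0 ->
  g x y + a / 2 * sqn (u - x) <= g u y.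
Proof. by have [hx _ _] := sf; have := hx x y u => + e; rewrite e dot0l addr0. Qed.

Lemma max_ascent x y v : 0 < b -> g x v <= g x y + b^-1 / 2 * sqn (G (x, y)).2.
Proof.
move=> b0; have [_ hy _] := sf; have bi : 0 < b^-1 by rewrite invr_gt0.
have := hy x y v; have := dot_young (G (x, y)).2 (v - y) bi.
by rewrite invrK; lra.
Qed.

Lemma max_descent x y u : 0 < a -> g x y - a^-1 / 2 * sqn (G (x, y)).1 <= g u y.
Proof.
move=> a0; have [hx _ _] := sf; have ai : 0 < a^-1 by rewrite invr_gt0.
have := hx x y u; have := dot_young (- (G (x, y)).1) (u - x) ai.
by rewrite invrK sqnN dotNl; lra.
Qed.

End Theory.

(** The other variable is made harmless by giving it the objective
    [sqn u / 2], whose only critical point is the origin. *)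
Lemma exists_argmax a b l g G x : saddle_field a b l g G -> 0 < b -> 0 < l ->
  exists y, (G (x, y)).2 = 0.
Proof.
move=> [_ hy hl] b0 l0.
pose g' (u : 'rV[R]_d1) y := 1 / 2 * sqn u + g x y.
pose G' (p : E) : E := (p.1, (G (x, p.2)).2).
have sf' : saddle_field 1 b (1 + l) g' G'.
  split => [u y v|u y v|p q] /=.
  - by have := sqnB v u; rewrite /g' dotDr dotNr -sqn_dot (dotC v u); lra.
  - by have := hy x y v; rewrite /g'; lra.
  - have := hl (x, p.2) (x, q.2); rewrite /sqn2 /= subrr sqn0 add0r.
    have := sqn_ge0 ((G (x, p.2)).1 - (G (x, q.2)).1).
    have l2 : l ^+ 2 <= (1 + l) ^+ 2 by rewrite sqrrD; nra.
    have l1 : 1 <= (1 + l) ^+ 2 by rewrite sqrrD; nra.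
    have := ler_wpM2r (sqn_ge0 (p.2 - q.2)) l2.
    have := ler_wpM2r (sqn_ge0 (p.1 - q.1)) l1.
    by lra.
have [|p [_ hp]] := saddle_zero sf' ltr01 b0; first by rewrite addr_gt0.
by exists p.2.
Qed.

Lemma exists_argmin a b l g G y : saddle_field a b l g G -> 0 < a -> 0 < l ->
  exists x, (G (x, y)).1 = 0.
Proof.
move=> [hx _ hl] a0 l0.
pose g' x (v : 'rV[R]_d2) := g x y - 1 / 2 * sqn v.
pose G' (p : E) : E := ((G (p.1, y)).1, - p.2).
have sf' : saddle_field a 1 (1 + l) g' G'.
  split => [x v u|x v w|p q] /=.
  - by have := hx x y u; rewrite /g'; lra.
  - by have := sqnB w v; rewrite /g' dotNl dotDr dotNr -sqn_dot (dotC w v); lra.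
  - have := hl (p.1, y) (q.1, y); rewrite /sqn2 /= subrr sqn0 addr0.
    have := sqn_ge0 ((G (p.1, y)).2 - (G (q.1, y)).2).
    have l2 : l ^+ 2 <= (1 + l) ^+ 2 by rewrite sqrrD; nra.
    have l1 : 1 <= (1 + l) ^+ 2 by rewrite sqrrD; nra.
    have := ler_wpM2r (sqn_ge0 (p.2 - q.2)) l1.
    have := ler_wpM2r (sqn_ge0 (p.1 - q.1)) l2.
    by rewrite -opprD sqnN; lra.
have [|p [hp _]] := saddle_zero sf' a0 ltr01; first by rewrite addr_gt0.
by exists p.1.
Qed.

End SaddleField.

(** * The duality gap *)

Section Gap.
Context (R : realType).

Lemma sup_range_max (T : Type) (h : T -> R) t :
  (forall s, h s <= h t) -> sup (range h) = h t.
Proof.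
move=> ht; apply/eqP; rewrite eq_le; apply/andP; split.
  by apply: ge_sup; [exists (h t); exists t|move=> _ [s _ <-]].
by apply: ub_le_sup; [exists (h t) => _ [s _ <-]|exists t].
Qed.

Lemma inf_range_min (T : Type) (h : T -> R) t :
  (forall s, h t <= h s) -> inf (range h) = h t.
Proof.
move=> ht; apply/eqP; rewrite eq_le; apply/andP; split.
  by apply: ge_inf; [exists (h t) => _ [s _ <-]|exists t].
by apply: lb_le_inf; [exists (h t); exists t|move=> _ [s _ <-]].
Qed.

Context (d1 d2 : nat) (a b l : R).
Context (g : 'rV[R]_d1 -> 'rV[R]_d2 -> R).
Context (G : 'rV[R]_d1 * 'rV[R]_d2 -> 'rV[R]_d1 * 'rV[R]_d2).
Hypothesis sf : saddle_field a b l g G.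
Hypotheses (a0 : 0 < a) (b0 : 0 < b) (l0 : 0 < l).

Lemma sup_stationary x y : (G (x, y)).2 = 0 -> sup (range (g x)) = g x y.
Proof.
move=> e; apply: sup_range_max => v; apply: le_trans (stationary_max sf v e) _.
by rewrite gerBl mulr_ge0 ?sqn_ge0// divr_ge0// ltW.
Qed.

Lemma inf_stationary x y : (G (x, y)).1 = 0 -> inf (range (g^~ y)) = g x y.
Proof.
move=> e; rewrite (@inf_range_min _ _ x)// => u.
apply: le_trans (stationary_min sf u e).
by rewrite lerDl mulr_ge0 ?sqn_ge0// divr_ge0// ltW.
Qed.

Lemma range_sup_ge x y : g x y <= sup (range (g x)).
Proof.
have [v e] := exists_argmax x sf b0 l0; rewrite (sup_stationary e).
apply: le_trans (stationary_max sf y e) _.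
by rewrite gerBl mulr_ge0 ?sqn_ge0// divr_ge0// ltW.
Qed.

Lemma range_inf_le x y : inf (range (g^~ y)) <= g x y.
Proof.
have [u e] := exists_argmin y sf a0 l0; rewrite (inf_stationary e).
apply: le_trans (stationary_min sf x e).
by rewrite lerDl mulr_ge0 ?sqn_ge0// divr_ge0// ltW.
Qed.

Lemma gap_le p :
  gap g p <= a^-1 / 2 * sqn (G p).1 + b^-1 / 2 * sqn (G p).2.
Proof.
case: p => x y; rewrite /gap /=.
have [v ev] := exists_argmax x sf b0 l0; rewrite (sup_stationary ev).
have [u eu] := exists_argmin y sf a0 l0; rewrite (inf_stationary eu).
by have := max_ascent sf x y v b0; have := max_descent sf x y u a0; lra.
Qed.

Section AtSaddle.
Context (xs : 'rV[R]_d1) (ys : 'rV[R]_d2).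
Hypothesis Gs : G (xs, ys) = 0.

Let Gs1 : (G (xs, ys)).1 = 0. Proof. by rewrite Gs. Qed.
Let Gs2 : (G (xs, ys)).2 = 0. Proof. by rewrite Gs. Qed.

Lemma dual_gap_le p : g xs ys - inf (range (g^~ p.2)) <= gap g p.
Proof.
rewrite /gap lerB//; apply: le_trans (range_sup_ge _ ys).
apply: le_trans (stationary_min sf p.1 Gs1).
by rewrite lerDl mulr_ge0 ?sqn_ge0// divr_ge0// ltW.
Qed.

Lemma dual_gap_ge y : b / 2 * sqn (y - ys) <= g xs ys - inf (range (g^~ y)).
Proof. by have := stationary_max sf y Gs2; have := range_inf_le xs y; lra. Qed.

Lemma gap_ge p : a / 2 * sqn (p.1 - xs) + b / 2 * sqn (p.2 - ys) <= gap g p.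
Proof.
have := dual_gap_ge p.2; have := stationary_min sf p.1 Gs1.
by have := range_sup_ge p.1 ys; rewrite /gap; lra.
Qed.

Lemma gap_ge_sqn2 m p : 0 < m -> m <= a -> m <= b ->
  m / 2 * sqn2 (p - (xs, ys)) <= gap g p.
Proof.
move=> m0 ma mb; apply: le_trans (gap_ge p).
by rewrite /sqn2 /= mulrDr lerD// ler_wpM2r ?sqn_ge0// ler_pM2r// invr_gt0.
Qed.

End AtSaddle.
End Gap.

Section StageObjective.
Context (R : realType) (d1 d2 : nat).

Lemma stage_objE (g : 'rV[R]_d1 -> 'rV[R]_d2 -> R) (L : R) c z :
  stage_obj L g c = sub_obj L 0 g c z.
Proof.
apply/funext => x; apply/funext => y.
by rewrite /sub_obj !mul0r subr0.
Qed.

End StageObjective.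

(** * Finite sums and their regularized subproblems *)

Section FiniteSum.
Context (R : realType) (n d1 d2 : nat).
Local Notation E := ('rV[R]_d1 * 'rV[R]_d2)%type.
Context (F : 'I_n -> 'rV[R]_d1 -> 'rV[R]_d2 -> R).

Definition joint (g : 'rV[R]_d1 -> 'rV[R]_d2 -> R) (u : E) := g u.1 u.2.

Lemma differentiable_left g (p : E) :
  differentiable (joint g) p -> differentiable (g ^~ p.2) p.1.
Proof.
case: p => x y /= hg.
have e : g^~ y = joint g \o (fun u => (u, y)) by [].
rewrite e; apply: differentiable_comp => //.
Qed.

Lemma differentiable_right g (p : E) :
  differentiable (joint g) p -> differentiable (g p.1) p.2.
Proof.
case: p => x y /= hg.
have e : g x = joint g \o (fun u => (x, u)) by [].
rewrite e; apply: differentiable_comp => //.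
Qed.

Lemma differentiable_average p :
  (forall i, differentiable (joint (F i)) p) ->
  differentiable (joint (average F)) p.
Proof.
move=> hF.
have -> : joint (average F) = n%:R^-1 *: (\sum_(i < n) joint (F i)).
  by apply/funext => u; rewrite /joint /average /= fctE fct_sumE.
by apply: differentiableZ; apply: differentiable_sum.
Qed.

Lemma has_grad_average_left p : (forall i, differentiable (joint (F i)) p) ->
  has_grad (average F ^~ p.2) p.1
    (n%:R^-1 *: \sum_(i < n) (grad2 (F i) p).1).
Proof.
move=> hF h.
have -> : (average F)^~ p.2 = n%:R^-1 *: (\sum_(i < n) (F i)^~ p.2).
  by apply/funext => u; rewrite /average /= fctE fct_sumE.
have -> : dot (n%:R^-1 *: \sum_(i < n) (grad2 (F i) p).1) h =
    n%:R^-1 *: \sum_(i < n) dot (grad2 (F i) p).1 h.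
  rewrite dotZl; congr (_ * _).
  by elim/big_rec2: _ => [|i u v _ <-]; rewrite ?dot0l ?dotDl.
apply: is_deriveZ; apply: is_derive_sum => i.
exact/differentiable_has_grad/differentiable_left.
Qed.

Lemma has_grad_average_right p : (forall i, differentiable (joint (F i)) p) ->
  has_grad (average F p.1) p.2
    (n%:R^-1 *: \sum_(i < n) (grad2 (F i) p).2).
Proof.
move=> hF h.
have -> : (average F) p.1 = n%:R^-1 *: (\sum_(i < n) (F i) p.1).
  by apply/funext => u; rewrite /average /= fctE fct_sumE.
have -> : dot (n%:R^-1 *: \sum_(i < n) (grad2 (F i) p).2) h =
    n%:R^-1 *: \sum_(i < n) dot (grad2 (F i) p).2 h.
  rewrite dotZl; congr (_ * _).
  by elim/big_rec2: _ => [|i u v _ <-]; rewrite ?dot0l ?dotDl.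
apply: is_deriveZ; apply: is_derive_sum => i.
exact/differentiable_has_grad/differentiable_right.
Qed.

(** Convexity of the squared norm, from the nonnegativity of the variance. *)
Lemma sqn_average_le d (v : 'I_n -> 'rV[R]_d) : (0 < n)%N ->
  sqn (n%:R^-1 *: \sum_(i < n) v i) <= n%:R^-1 * \sum_(i < n) sqn (v i).
Proof.
move=> n0; set w := n%:R^-1 *: _.
have nR : (0 : R) < n%:R by rewrite ltr0n.
have : 0 <= \sum_(i < n) sqn (v i - w) by apply: sumr_ge0 => i _; exact: sqn_ge0.
have e : \sum_(i < n) sqn (v i - w) = \sum_(i < n) sqn (v i) - n%:R * sqn w.
  under eq_bigr do rewrite sqnB.
  rewrite big_split sumrB /= -mulr_sumr sumr_const card_ord -[_ *+ n]mulr_natl.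
  have -> : \sum_(i < n) dot (v i) w = n%:R * sqn w.
    rewrite sqn_dot {2}/w dotZl mulVKf ?gt_eqF//.
    by elim/big_rec2: _ => [|i u z _ ->]; rewrite ?dot0l ?dotDl.
  by lra.
by rewrite e ler_pdivlMl//; lra.
Qed.

Context (L mu : R).
Hypotheses (n0 : (0 < n)%N) (d20 : (0 < d2)%N) (L0 : 0 < L) (mu0 : 0 < mu).
Hypothesis sm : averaged_smooth L F.
Hypothesis sc : forall x, strongly_concave mu (average F x).
Let f := average F.

Lemma grad2_average p : grad2 f p =
  (n%:R^-1 *: \sum_(i < n) (grad2 (F i) p).1,
   n%:R^-1 *: \sum_(i < n) (grad2 (F i) p).2).
Proof.
have [df _] := sm; congr pair; apply: has_gradE.
  by apply: has_grad_average_left => i; exact: df.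
by apply: has_grad_average_right => i; exact: df.
Qed.

Lemma has_grad_left p : has_grad (f ^~ p.2) p.1 (grad2 f p).1.
Proof. by rewrite grad2_average; apply: has_grad_average_left => i; exact: sm.1. Qed.

Lemma has_grad_right p : has_grad (f p.1) p.2 (grad2 f p).2.
Proof. by rewrite grad2_average; apply: has_grad_average_right => i; exact: sm.1. Qed.

Lemma grad2_average_lipschitz p q :
  sqn2 (grad2 f p - grad2 f q) <= L ^+ 2 * sqn2 (p - q).
Proof.
apply: le_trans (sm.2 p q); rewrite !grad2_average /sqn2 /= -!scalerBr -!sumrB.
by rewrite [X in _ <= _ * X]big_split mulrDr /= lerD// sqn_average_le.
Qed.

Lemma saddle_field_average : saddle_field (- L) mu L f (grad2 f).
Proof.
split => [x y u|x y v|]; last exact: grad2_average_lipschitz.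
- have := @quadratic_lower_bound _ _ (f^~ y) (fun u => (grad2 f (u, y)).1) L x u L0.
  rewrite mulNr mulNr; apply => z; first exact: (has_grad_left (z, y)).
  have := grad2_average_lipschitz (z, y) (x, y).
  rewrite /sqn2 /= subrr sqn0 addr0; apply: le_trans.
  by rewrite lerDl sqn_ge0.
- exact: (strongly_concave_grad v (sc x) (has_grad_right (x, y))).
Qed.

(** Strong monotonicity and the Lipschitz bound meet along a nonzero direction,
    which exists because [d2] is positive. *)
Lemma strong_concavity_le_smoothness : mu <= L.
Proof.
pose v : 'rV[R]_d2 := const_mx 1.
have v0 : 0 < sqn v.
  rewrite /sqn (eq_bigr (fun=> 1)) => [|i _]; last by rewrite mxE expr1n.
  by rewrite sumr_const card_ord ltr0n.
have := monotone_y saddle_field_average (0 : 'rV_d1) v 0.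
have h1 := grad2_average_lipschitz ((0 : 'rV_d1), v) (0, 0).
have e2 : sqn2 (((0 : 'rV[R]_d1), v) - (0, 0)) = sqn v.
  by rewrite /sqn2 /= !subr0 sqn0 add0r.
rewrite {}e2 in h1.
rewrite !subr0 -dotNl => h2; rewrite -(ler_pM2r v0).
have Li : 0 < L^-1 by rewrite invr_gt0.
apply: (le_trans h2); apply: (le_trans (dot_young _ _ Li)); rewrite invrK sqnN.
set w := sqn _; have : w <= L ^+ 2 * sqn v.
  by apply: le_trans h1; rewrite lerDr sqn_ge0.
move=> h3; have := ler_wpM2l (ltW Li) h3.
by rewrite expr2 mulrA mulrA mulVf ?gt_eqF// mul1r; lra.
Qed.

Section Subproblem.
Context (tau : R) (c : 'rV[R]_d1) (z : 'rV[R]_d2).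

Definition sub_grad (p : E) : E :=
  grad2 f p + ((2 * L) *: (p.1 - c), - (tau *: (p.2 - z))).

Lemma grad2_sub_obj p : grad2 (sub_obj L tau f c z) p = sub_grad p.
Proof.
rewrite /grad2 /sub_grad; congr pair; apply: has_gradE => /=.
- have -> : (fun x => sub_obj L tau f c z x p.2) =
      (fun x => f x p.2 + L * sqn (x - c) + - (tau / 2 * sqn (p.2 - z))) by [].
  rewrite -[X in has_grad _ _ X]addr0; apply: has_gradD.
    apply: has_gradD; first exact: has_grad_left.
    exact: has_grad_quadratic.
  exact: has_grad_cst.
- have -> : sub_obj L tau f c z p.1 =
      (fun y => f p.1 y + L * sqn (p.1 - c) + - (tau / 2 * sqn (y - z))) by [].
  apply: has_gradD.
    rewrite -[X in has_grad _ _ X]addr0; apply: has_gradD.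
      exact: has_grad_right.
    exact: has_grad_cst.
  apply: has_gradN; have := @has_grad_quadratic _ _ (tau / 2) z p.2.
  by rewrite [2 * _]mulrC divfK.
Qed.

(** The term [L * sqn (x - c)] has curvature [2 * L] and outweighs the weak
    convexity [- L] of the average. *)
Lemma saddle_field_sub : 0 <= tau -> tau <= L ->
  saddle_field L (mu + tau) (4 * L) (sub_obj L tau f c z) (grad2 (sub_obj L tau f c z)).
Proof.
move=> t0 tL; have [hx hy hl] := saddle_field_average.
split => [x y u|x y v|p q]; rewrite ?grad2_sub_obj /sub_grad /sub_obj /stage_obj /=.
- have := hx x y u; have e : u - c = (x - c) + (u - x).
    by apply/rowP => i; rewrite !mxE; ring.
  by rewrite e (sqnD (x - c)) (dotDl _ (_ *: _)) dotZl; lra.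
- have := hy x y v; have e : v - z = (y - z) + (v - y).
    by apply/rowP => i; rewrite !mxE; ring.
  rewrite e (sqnD (y - z)) [dot (_ + - (tau *: _)) _]dotDl (dotNl (tau *: _)) dotZl.
  by lra.
- set A := grad2 f p; set B := grad2 f q.
  pose D : E := ((2 * L) *: (p.1 - q.1), - (tau *: (p.2 - q.2))).
  have -> : A + ((2 * L) *: (p.1 - c), - (tau *: (p.2 - z))) -
      (B + ((2 * L) *: (q.1 - c), - (tau *: (q.2 - z)))) = (A - B) + D.
    rewrite /D; case: (A) => a1 a2; case: (B) => b1 b2.
    by congr pair; apply/rowP => i; rewrite !mxE; ring.
  apply: (le_trans (sqn2D_le _ _)); have := hl p q; rewrite -/A -/B => h1.
  have h2 : sqn2 D <= 4 * L ^+ 2 * sqn2 (p - q).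
    rewrite /D /sqn2 /= sqnN !sqnZ mulrDr lerD//.
      by rewrite exprMn -natrX.
    rewrite ler_wpM2r ?sqn_ge0//; nra.
  have := sqn2_ge0 (p - q); have := sqr_ge0 L; nra.
Qed.

End Subproblem.

End FiniteSum.

(** * Accelerated inexact proximal iterations *)

Section Lyapunov.
Context (R : realType) (d : nat).
Implicit Types A B C b : 'rV[R]_d.

(** The whole acceleration mechanism.  The potential of an accelerated proximal
    step with errors is the objective gap plus [mu / 2] times the squared
    distance of the extrapolated point; vectors are measured from the
    minimizer: [A] and [C] are the iterates before and after the step, [B] and
    [A + s^-1 *: (C - A)] the extrapolated points.  Without errors the potential
    contracts by [1 - s]; the error is paid for by a twentieth of this rate. *)
Lemma lyapunov_step (s mu phi phi' del : R) A B C b :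
  0 < s <= 1 -> 0 < mu ->
  let g := (mu * (1 - s) / s ^+ 2) *: (A + s *: B - (1 + s) *: C) in
  phi' - del - dot (g - b) C + mu / 2 * sqn C <= 0 ->
  phi' - del + dot (g - b) (A - C) + mu / 2 * sqn (A - C) <= phi ->
  mu / 2 * sqn C <= phi' ->
  (1 - s / 20) * (phi' + mu / 2 * sqn (A + s^-1 *: (C - A))) <=
    (1 - s) * (phi + mu / 2 * sqn B) + del + 10 / mu * sqn b.
Proof.
move=> /andP[s0 s1] mu0 g h1 h2 h3.
have gE w : dot g w = mu * (1 - s) / s ^+ 2 *
    (dot A w + s * dot B w - (1 + s) * dot C w) by rewrite /g !dotE.
have ggE : dot g g = (mu * (1 - s) / s ^+ 2) ^+ 2 *
    sqn (A + s *: B - (1 + s) *: C) by rewrite -sqn_dot sqnZ.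
(* exact expansion; the two negative squares are dropped afterwards *)
have key : mu / 2 * sqn (A + s^-1 *: (C - A)) = (1 - s) * (mu / 2 * sqn B)
    + s * (mu / 2 * sqn C - dot g C) + (1 - s) * dot g (A - C)
    - s ^+ 2 / (2 * mu) * dot g g - s * (1 - s) * (mu / 2) * sqn (B - C).
  rewrite ggE dotDr dotNr !gE !sqn_dot !dotE (dotC B A) (dotC C A) (dotC C B).
  by field; rewrite !gt_eqF.
have g0 : 0 <= s ^+ 2 / (2 * mu) * dot g g.
  by rewrite -sqn_dot mulr_ge0 ?sqn_ge0// divr_ge0 ?sqr_ge0// mulr_ge0// ltW.
have BC0 : 0 <= s * (1 - s) * (mu / 2) * sqn (B - C).
  rewrite mulr_ge0 ?sqn_ge0// mulr_ge0 ?divr_ge0 ?(ltW mu0)//.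
  by rewrite mulr_ge0 ?subr_ge0// ltW.
have mi : 0 < mu^-1 by rewrite invr_gt0.
have y1 : dot b (A - C) <= mu^-1 / 2 * sqn b + mu / 2 * sqn (A - C).
  by have := dot_young b (A - C) mi; rewrite invrK.
have y2 : - dot b C <= 10 / mu * sqn b + 1 / 20 * (mu / 2 * sqn C).
  have m20 : 0 < 20 / mu by rewrite divr_gt0.
  have := dot_young (- b) C m20; rewrite invf_div sqnN dotNl => h.
  apply: (le_trans h); rewrite le_eqVlt; apply/orP; left; apply/eqP.
  by field; rewrite gt_eqF.
set X := sqn (A + _) in key *.
move: h1 h2; rewrite (dotDl g) (dotDl g) !dotNl => h1 h2.
have X0 : 0 <= mu / 2 * X by rewrite mulr_ge0 ?sqn_ge0// divr_ge0// ltW.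
have s1' : 0 <= 1 - s by rewrite subr_ge0.
have m1 := ler_wpM2l (ltW s0) h1.
have m2 := ler_wpM2l s1' h2.
have m3 := ler_wpM2l s1' y1.
have m4 := ler_wpM2l (ltW s0) y2.
have m5 := ler_wpM2l (ltW s0) h3.
have b0 := sqn_ge0 b.
have sX : 0 <= s * (mu / 2 * X) by rewrite mulr_ge0// ltW.
have bb : s * (10 / mu * sqn b) + (1 - s) * (mu^-1 / 2 * sqn b) <= 10 / mu * sqn b.
  have : 0 <= mu^-1 * sqn b by rewrite mulr_ge0// ltW.
  have -> : s * (10 / mu * sqn b) = 10 * s * (mu^-1 * sqn b) by ring.
  have -> : (1 - s) * (mu^-1 / 2 * sqn b) = (1 - s) / 2 * (mu^-1 * sqn b) by ring.
  have -> : 10 / mu * sqn b = 10 * (mu^-1 * sqn b) by ring.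
  by move=> h; nra.
move: key m1 m2 m3 m4 m5 g0 BC0 bb sX.
set AC := mu / 2 * sqn (A - C); set CC := mu / 2 * sqn C; set XX := mu / 2 * X.
set BB := mu / 2 * sqn B.
lra.
Qed.

End Lyapunov.

Section InexactProximal.
Context (R : realType) (d1 d2 : nat).
Local Notation E := ('rV[R]_d1 * 'rV[R]_d2)%type.
Context (L mu tau : R) (g : 'rV[R]_d1 -> 'rV[R]_d2 -> R) (G : E -> E).
Hypotheses (mu0 : 0 < mu) (tau0 : 0 <= tau) (mtL : mu + tau <= L).
Hypothesis sf : saddle_field L mu (4 * L) g G.

Let L0 : 0 < L. Proof. by apply: lt_le_trans mtL; rewrite ltr_wpDr. Qed.
Let L40 : 0 < 4 * L. Proof. by rewrite mulr_gt0. Qed.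
Let muL : mu <= L. Proof. by apply: le_trans mtL; rewrite lerDl. Qed.
Let tauL : tau <= L. Proof. by apply: le_trans mtL; rewrite lerDr ltW. Qed.

Let s := Num.sqrt (mu / (mu + tau)).
Let momentum := (s - mu / (mu + tau)) / (s + mu / (mu + tau)).
Let rho := 9 / 10 * s.
Let kappa := L / mu.

Let kappa1 : 1 <= kappa. Proof. by rewrite ler_pdivlMr// mul1r. Qed.
Let kappa0 : 0 <= kappa. Proof. exact: le_trans kappa1. Qed.
Let mk_ge0 k : 0 <= mu * kappa ^+ k.
Proof. by rewrite mulr_ge0 ?exprn_ge0 ?(ltW mu0). Qed.
Let mt0 : 0 < mu + tau. Proof. by rewrite ltr_wpDr. Qed.
Let s2 : s ^+ 2 = mu / (mu + tau).
Proof. by rewrite sqr_sqrtr// divr_ge0// ltW. Qed.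
Let s0 : 0 < s. Proof. by rewrite sqrtr_gt0 divr_gt0. Qed.
Let s1 : s <= 1.
Proof.
rewrite -(@ler_pXn2r _ 2)// ?nnegrE ?(ltW s0)// expr1n s2.
by rewrite ler_pdivrMr// mul1r lerDl.
Qed.

Let xs_ys := xget 0 [set r | G r = 0].
Let Gs : G (xs_ys.1, xs_ys.2) = 0.
Proof.
rewrite -surjective_pairing /xs_ys.
by case: xgetP => [r _ //|/(_ _)]; have [r hr] := saddle_zero sf L0 mu0 L40 => /(_ r).
Qed.
Let xs := xs_ys.1.
Let ys := xs_ys.2.
Let phi y := g xs ys - inf (range (g^~ y)).

Lemma dual_gap_ge_sqn y : mu / 2 * sqn (y - ys) <= phi y.
Proof. exact: (dual_gap_ge sf L0 L40 Gs). Qed.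

(** An inexact solution of the proximal subproblem yields the subgradient
    inequality of an inexact proximal step for the dual gap: [e.1] enters as an
    error of the value, [e.2] as an error of the subgradient.  No
    differentiability of the minimum over the first variable is involved. *)
Lemma prox_inequality (p e : E) (z u : 'rV[R]_d2) :
  e = G p - (0, tau *: (p.2 - z)) ->
  phi p.2 - (2 * L)^-1 * sqn e.1 + dot (tau *: (z - p.2) - e.2) (u - p.2)
    + mu / 2 * sqn (u - p.2) <= phi u.
Proof.
move=> eE; have [_ hy _] := sf; case: p eE => x y eE; rewrite /phi /=.
have e1 : e.1 = (G (x, y)).1 by rewrite eE /= subr0.
have e2 : (G (x, y)).2 = - (tau *: (z - y) - e.2).
  by rewrite eE /= !(scalerBr tau); apply/rowP => i; rewrite !mxE; ring.
have [w Gw] := exists_argmin y sf L0 L40.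
have := hy x y u; have := range_inf_le sf L0 L40 x u.
have := max_descent sf x y w L0; rewrite (inf_stationary sf L0 Gw) -e1 e2 dotNl.
by rewrite invfM; lra.
Qed.

Context (p : nat -> E) (z : nat -> 'rV[R]_d2).
Hypothesis z0 : z 0%N = (p 0%N).2.
Hypothesis zS : forall k,
  z k.+1 = (p k.+1).2 + momentum *: ((p k.+1).2 - (p k).2).
Let res k := G (p k.+1) - (0, tau *: ((p k.+1).2 - z k)).
Let gap0 := gap g (p 0%N).
Hypothesis res_le : forall k, sqn2 (res k) <= mu * (1 - rho) ^+ k.+1 * gap0.

Let y k := (p k).2.
Let v k := if k is j.+1 then y j + s^-1 *: (y k - y j) else y 0%N.
Let V k := phi (y k) + mu / 2 * sqn (v k - ys).

Lemma momentumE : momentum = (1 - s) / (1 + s).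
Proof.
by rewrite /momentum -s2; field; rewrite ?gt_eqF ?addr_gt0 ?mulr_gt0 ?exprn_gt0 ?addr_gt0.
Qed.

(** The momentum is tuned so that the proximal center is a weighted mean of the
    last iterate and of the extrapolated point of the potential. *)
Lemma extrapolated k : (1 + s) *: (z k - ys) = (y k - ys) + s *: (v k - ys).
Proof.
case: k => [|k]; first by rewrite z0 scalerDl scale1r.
rewrite zS momentumE /v -/(y k) -/(y k.+1); apply/rowP => i; rewrite !mxE.
by field; rewrite !gt_eqF ?addr_gt0.
Qed.

Lemma potential_ge0 k : 0 <= V k.
Proof.
have m2 : 0 <= mu / 2 by rewrite divr_ge0// ltW.
apply: addr_ge0; last by rewrite mulr_ge0 ?sqn_ge0.
by apply: le_trans (dual_gap_ge_sqn (y k)); rewrite mulr_ge0 ?sqn_ge0.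
Qed.

Lemma potential_step k :
  V k.+1 <= (1 - 19 / 20 * s) * V k + 20 * (1 - rho) ^+ k.+1 * gap0.
Proof.
have eR : res k = G (p k.+1) - (0, tau *: ((p k.+1).2 - z k)) by [].
have q1 := prox_inequality ys eR; have q2 := prox_inequality (y k) eR.
rewrite -/(y k.+1) in q1 q2.
have gE : tau *: (z k - y k.+1) = (mu * (1 - s) / s ^+ 2) *:
    ((y k - ys) + s *: (v k - ys) - (1 + s) *: (y k.+1 - ys)).
  rewrite -extrapolated -scalerBr scalerA; congr (_ *: _); last first.
    by rewrite opprB addrA subrK.
  have -> : tau = mu * (1 - s ^+ 2) / s ^+ 2.
    by rewrite s2; field; rewrite !gt_eqF.
  by field; rewrite gt_eqF.
have phis : phi ys = 0.
  apply/eqP; rewrite subr_eq0; apply/eqP/esym.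
  by apply: (inf_stationary sf L0); rewrite Gs.
have hs : 0 < s <= 1 by rewrite s0.
have := @lyapunov_step R d2 s mu (phi (y k)) (phi (y k.+1))
  ((2 * L)^-1 * sqn (res k).1) (y k - ys) (v k - ys) (y k.+1 - ys) (res k).2 hs mu0.
rewrite /= -gE.
have dys : ys - y k.+1 = - (y k.+1 - ys) by rewrite opprB.
have dyk : y k - y k.+1 = (y k - ys) - (y k.+1 - ys) by rewrite opprB addrA subrK.
rewrite phis dys dotNr sqnN in q1; rewrite dyk in q2.
move=> /(_ q1 q2 (dual_gap_ge_sqn _)).
have -> : (y k - ys) + s^-1 *: ((y k.+1 - ys) - (y k - ys)) = v k.+1 - ys.
  by rewrite /v; apply/rowP => i; rewrite !mxE; ring.
rewrite -/(V k) -/(V k.+1) => h.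
have hres := res_le k.
have hL : (2 * L)^-1 * sqn (res k).1 <= 10 / mu * sqn (res k).1.
  rewrite ler_wpM2r ?sqn_ge0// ler_pdivlMr// mulrC ler_pdivrMr ?mulr_gt0//.
  by move: muL L0; lra.
have hm : 10 / mu * sqn2 (res k) <= 10 * ((1 - rho) ^+ k.+1 * gap0).
  by rewrite mulrAC ler_pdivrMr// -mulrA ler_wpM2l// [leRHS]mulrC !mulrA.
have h' : (1 - s / 20) * V k.+1 <= (1 - s) * V k + 10 * ((1 - rho) ^+ k.+1 * gap0).
  by move: h hL hm; rewrite /sqn2; lra.
set ee := (1 - rho) ^+ k.+1 * gap0 in h' *.
have -> : 20 * (1 - rho) ^+ k.+1 * gap0 = 20 * ee by rewrite /ee mulrA.
have ee0 : 0 <= ee.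
  have : 0 <= mu * ee by apply: le_trans (sqn2_ge0 _) _; rewrite /ee mulrA; exact: hres.
  by rewrite pmulr_rge0.
have V0 := potential_ge0 k.
have s1' : 0 < 1 - s / 20 by move: s1; lra.
rewrite -(ler_pM2l s1'); apply: (le_trans h').
have a1 : (1 - s) * V k <= (1 - s / 20) * (1 - 19 / 20 * s) * V k.
  by apply: ler_wpM2r => //; have := sqr_ge0 s; lra.
have a2 : 10 * ee <= (1 - s / 20) * 20 * ee by apply: ler_wpM2r => //; move: s1; lra.
by lra.
Qed.

Lemma rho_bounds : 1 / 10 <= 1 - rho < 1.
Proof. by rewrite /rho; move: s1 s0 => h1 h2; apply/andP; split; lra. Qed.

Lemma gap0_ge0 : 0 <= gap0.
Proof.
apply: le_trans (gap_ge sf L0 mu0 L40 Gs _).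
by rewrite addr_ge0// mulr_ge0 ?sqn_ge0// divr_ge0// ltW.
Qed.

(** The potential contracts by [1 - 19 / 20 * s] up to errors that decay like
    [(1 - rho) ^+ k] with [rho = 18 / 20 * s]; the difference of the rates,
    [s / 20], turns the error factor [20] into [400 / s], and the initial
    potential accounts for the remaining [2 <= 2 / s]. *)
Lemma potential_decay k : V k <= 402 / s * gap0 * (1 - rho) ^+ k.
Proof.
have g0 := gap0_ge0; have /andP[r1 r2] := rho_bounds.
elim: k => [|k IH].
  rewrite expr0 mulr1 /V /v.
  have := dual_gap_ge_sqn (y 0%N); have := dual_gap_le sf L0 mu0 L40 Gs (p 0%N).
  rewrite -/(phi _) -/gap0 -/(y 0%N) => h1 h2.
  apply: (@le_trans _ _ (2 * gap0)); first by lra.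
  by rewrite ler_wpM2r// ler_pdivlMr//; move: s1; lra.
apply: (le_trans (potential_step k)).
have h : (1 - 19 / 20 * s) * V k <= (1 - 19 / 20 * s) * (402 / s * gap0 * (1 - rho) ^+ k).
  by apply: ler_wpM2l => //; move: s1; lra.
apply: (@le_trans _ _ ((1 - 19 / 20 * s) * (402 / s * gap0 * (1 - rho) ^+ k)
    + 20 * (1 - rho) ^+ k.+1 * gap0)); first by rewrite lerD2r.
set D := gap0 * (1 - rho) ^+ k.
have D0 : 0 <= D by rewrite mulr_ge0// exprn_ge0//; apply: le_trans r1; lra.
have -> : 402 / s * gap0 * (1 - rho) ^+ k = 402 / s * D by rewrite /D; ring.
have -> : 20 * (1 - rho) ^+ k.+1 * gap0 = 20 * (1 - rho) * D by rewrite /D exprS; ring.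
have -> : 402 / s * gap0 * (1 - rho) ^+ k.+1 = 402 / s * (1 - rho) * D.
  by rewrite /D exprS; ring.
rewrite -subr_ge0.
have -> : 402 / s * (1 - rho) * D - ((1 - 19 / 20 * s) * (402 / s * D)
    + 20 * (1 - rho) * D) = (1 / 10 + 18 * s) * D.
  by rewrite /rho; field; rewrite gt_eqF.
by rewrite mulr_ge0// addr_ge0// mulr_ge0// ltW.
Qed.

Lemma sinv_le : s^-1 <= kappa.
Proof.
have k1 : 1 <= kappa by rewrite ler_pdivlMr// mul1r.
apply: (@le_trans _ _ (s^-1 ^+ 2)).
  by rewrite expr2 ler_peMl ?invr_ge0 ?(ltW s0)// invf_ge1.
by rewrite exprVn s2 invf_div ler_pM2r// invr_gt0.
Qed.

Let D k := gap0 * (1 - rho) ^+ k.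
Let D_ge0 k : 0 <= D k.
Proof.
rewrite mulr_ge0 ?gap0_ge0// exprn_ge0//.
by have /andP[r1 r2] := rho_bounds; lra.
Qed.

Lemma dist_y k : mu * sqn (y k - ys) <= 804 * kappa * D k.
Proof.
have := dual_gap_ge_sqn (y k); have := potential_decay k; have := D_ge0 k.
have v0 : 0 <= mu / 2 * sqn (v k - ys) by rewrite mulr_ge0 ?sqn_ge0// divr_ge0// ltW.
have -> : 402 / s * gap0 * (1 - rho) ^+ k = 402 * (s^-1 * D k) by rewrite /D; ring.
move=> Dk; have := ler_wpM2r Dk sinv_le; rewrite /V; lra.
Qed.

Lemma dist_z k : mu * sqn (z k - ys) <= 804 * kappa * D k.
Proof.
have := dual_gap_ge_sqn (y k); have := potential_decay k; have := D_ge0 k.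
have -> : 402 / s * gap0 * (1 - rho) ^+ k = 402 * (s^-1 * D k) by rewrite /D; ring.
move=> Dk; have := ler_wpM2r Dk sinv_le; rewrite /V => h1 h2 h3.
have /(f_equal (@sqn R d2)) := extrapolated k.
rewrite sqnZ (sqnD (y k - ys)) (sqnZ s) dotZr => e.
have := sqn_ge0 ((y k - ys) - (v k - ys)); rewrite sqnB.
set a := sqn (z k - ys) in e *; set b := sqn (y k - ys) in e h3 *.
set c := sqn (v k - ys) in e h2 *; set w := dot _ _ in e * => w0.
have sq : (1 + s) ^+ 2 * a <= (1 + s) * (b + s * c).
  by rewrite e; have := ler_wpM2l (ltW s0) w0; lra.
have {}sq : (1 + s) * a <= b + s * c.
  by rewrite -(ler_pM2l (addr_gt0 ltr01 s0)) mulrA -expr2.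
have c0 : 0 <= c := sqn_ge0 _.
have b0 : 0 <= b := sqn_ge0 _.
have a0 : 0 <= a := sqn_ge0 _.
have : a <= b + c by move: s1 s0; nra.
by move=> h; have := ler_wpM2l (ltW mu0) h; lra.
Qed.

Lemma sqn2_zero_left (u : 'rV[R]_d2) : sqn2 ((0, u) : E) = sqn u.
Proof. by rewrite /sqn2 sqn0 add0r. Qed.

Let tau_dist (u w : 'rV[R]_d2) (B : R) : mu * sqn (u - ys) <= 804 * kappa * B ->
  mu * sqn (w - ys) <= 804 * kappa * B ->
  sqn (tau *: (u - w)) <= 3216 * (mu * kappa ^+ 3) * B.
Proof.
move=> hu hw; rewrite sqnZ.
have -> : u - w = (u - ys) - (w - ys) by rewrite opprB addrA subrK.
have h := sqnB_le (u - ys) (w - ys).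
have h2 : mu * sqn ((u - ys) - (w - ys)) <= 3216 * kappa * B.
  by have := ler_wpM2l (ltW mu0) h; lra.
rewrite -(ler_pM2l mu0) mulrCA.
have -> : mu * (3216 * (mu * kappa ^+ 3) * B) = L ^+ 2 * (3216 * kappa * B).
  by rewrite /kappa; field; rewrite gt_eqF.
apply: ler_pM => //; rewrite ?sqr_ge0 ?mulr_ge0 ?sqn_ge0 ?(ltW mu0)//.
by rewrite lerXn2r ?nnegrE ?(ltW L0).
Qed.

(** The field at an iterate is the residual of its subproblem plus the proximal
    term, and the latter is small because iterate and center are both close to
    the saddle point. *)
Lemma field_decay k : sqn2 (G (p k)) <= 10 ^+ 5 * (mu * kappa ^+ 3) * D k.
Proof.
have k3 : 1 <= kappa ^+ 3 by rewrite exprn_ege1.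
have k23 : kappa ^+ 2 <= kappa ^+ 3 by rewrite ler_weXn2l.
have mk : 0 <= mu * kappa ^+ 3 by rewrite mulr_ge0 ?exprn_ge0 ?(ltW mu0).
case: k => [|k].
  have [_ _ hl] := sf; have := hl (p 0%N) (xs, ys); rewrite Gs subr0.
  move=> /le_trans; apply.
  have := gap_ge_sqn2 sf L0 mu0 L40 Gs (p 0%N) mu0 muL (lexx _); rewrite -/gap0 => h.
  have -> : (4 * L) ^+ 2 * sqn2 (p 0%N - (xs, ys)) =
      32 * (mu * kappa ^+ 2) * (mu / 2 * sqn2 (p 0%N - (xs, ys))).
    by rewrite /kappa; field; rewrite gt_eqF.
  rewrite /D expr0 mulr1.
  apply: ler_pM => //.
  - by rewrite mulr_ge0// mk_ge0.
  - by rewrite !mulr_ge0 ?(ltW mu0) ?sqn2_ge0.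
  - have := ler_wpM2l (ltW mu0) k23; lra.
have -> : G (p k.+1) = res k + (0, tau *: ((p k.+1).2 - z k)) by rewrite subrK.
apply: (le_trans (sqn2D_le _ _)); rewrite sqn2_zero_left.
have /andP[r1 r2] := rho_bounds.
have D10 : D k <= 10 * D k.+1.
  rewrite /D exprS; have := D_ge0 k; rewrite /D; nra.
have Dd : D k.+1 <= D k.
  rewrite /D exprS; have := D_ge0 k; rewrite /D; nra.
have k0 : 0 <= 804 * kappa := mulr_ge0 (ler0n R 804) kappa0.
have ht := tau_dist (le_trans (dist_y k.+1) (ler_wpM2l k0 Dd)) (dist_z k).
have hr := res_le k.
have eD : mu * (1 - rho) ^+ k.+1 * gap0 = mu * D k.+1 by rewrite /D; ring.
have hD := ler_wpM2l mk D10.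
have hm : mu * D k.+1 <= mu * kappa ^+ 3 * D k.+1.
  by rewrite ler_wpM2r// ler_peMr// ltW.
have h0 := mulr_ge0 mk (D_ge0 k.+1).
rewrite eD in hr; rewrite -/(y k.+1).
move: ht hr hD hm h0; move: (sqn _) (sqn2 _) (mu * kappa ^+ 3) (D k) (D k.+1).
by move=> {}u w K Dk Dk1 ht hr hD hm h0; lra.
Qed.

(** The stopping test of a stage is relative to the gradient at its start, so
    the initial gap is bounded by that gradient. *)
Lemma stage_decay k :
  sqn2 (G (p k)) <= 10 ^+ 5 * kappa ^+ 3 * (1 - rho) ^+ k * sqn2 (G (p 0%N)).
Proof.
apply: (le_trans (field_decay k)); rewrite /D.
have hg : gap0 <= (2 * mu)^-1 * sqn2 (G (p 0%N)).
  apply: (le_trans (gap_le sf L0 mu0 L40 _)).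
  rewrite /sqn2 mulrDr -!invfM [L * 2]mulrC [mu * 2]mulrC lerD2r.
  rewrite ler_wpM2r ?sqn_ge0// lef_pV2 ?posrE ?mulr_gt0//.
  by rewrite ler_pM2l.
have k3 : 0 <= kappa ^+ 3 by rewrite exprn_ge0.
have /andP[r1 r2] := rho_bounds.
have r0 : 0 <= (1 - rho) ^+ k by rewrite exprn_ge0//; lra.
apply: (@le_trans _ _ (10 ^+ 5 * (mu * kappa ^+ 3) *
    ((2 * mu)^-1 * sqn2 (G (p 0%N)) * (1 - rho) ^+ k))).
  apply: ler_wpM2l; first by rewrite mulr_ge0 ?exprn_ge0// mk_ge0.
  exact: ler_wpM2r.
have -> : 10 ^+ 5 * (mu * kappa ^+ 3) *
    ((2 * mu)^-1 * sqn2 (G (p 0%N)) * (1 - rho) ^+ k) =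
    10 ^+ 5 / 2 * kappa ^+ 3 * (1 - rho) ^+ k * sqn2 (G (p 0%N)).
  by field; rewrite gt_eqF.
rewrite !ler_wpM2r ?sqn2_ge0//; lra.
Qed.

(** Warm start: consecutive subproblems differ in the proximal center only.  The
    bound is a multiple of the tolerance of the next subproblem, so that the
    work needed there does not depend on how small the tolerance has become. *)
Lemma warm_start k (r : E) : G r - (0, tau *: (r.2 - z k)) = 0 ->
  saddle_field L (mu + tau) (4 * L)
    (fun x y => g x y - tau / 2 * sqn (y - z k))
    (fun q => G q - (0, tau *: (q.2 - z k))) ->
  (4 * L) ^+ 2 * sqn2 (p k - r) <=
    10 ^+ 9 * kappa ^+ 5 * (mu * (1 - rho) ^+ k.+1 * gap0).
Proof.
move=> hr sfk.
have := saddle_expansion sfk (p k) r mt0 mtL (lexx _); rewrite hr subr0 => h.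
have h1 : sqn2 (G (p k) - (0, tau *: ((p k).2 - z k))) <=
    10 ^+ 6 * (mu * kappa ^+ 3) * D k.
  apply: (le_trans (sqn2B_le _ _)); rewrite sqn2_zero_left.
  have := tau_dist (dist_y k) (dist_z k); have := field_decay k.
  have : 0 <= mu * kappa ^+ 3 * D k.
    by rewrite mulr_ge0// mulrC mk_ge0.
  by lra.
have /andP[r1 r2] := rho_bounds.
have D10 : D k <= 10 * D k.+1 by rewrite /D exprS; have := D_ge0 k; rewrite /D; nra.
have h2 : mu ^+ 2 * sqn2 (p k - r) <= 10 ^+ 7 * (mu * kappa ^+ 3) * D k.+1.
  apply: (@le_trans _ _ ((mu + tau) ^+ 2 * sqn2 (p k - r))).
    rewrite ler_wpM2r ?sqn2_ge0// lerXn2r ?nnegrE ?(ltW mu0) ?(ltW mt0)//.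
    by rewrite lerDl.
  apply: (le_trans h); apply: (le_trans h1).
  have mk : 0 <= mu * kappa ^+ 3.
    by rewrite mulr_ge0 ?exprn_ge0 ?(ltW mu0).
  by have := ler_wpM2l mk D10; lra.
have -> : (4 * L) ^+ 2 * sqn2 (p k - r) = 16 * kappa ^+ 2 * (mu ^+ 2 * sqn2 (p k - r)).
  by rewrite /kappa; field; rewrite gt_eqF.
have k2 : 0 <= 16 * kappa ^+ 2 by rewrite mulr_ge0// sqr_ge0.
apply: (le_trans (ler_wpM2l k2 h2)).
have -> : 16 * kappa ^+ 2 * (10 ^+ 7 * (mu * kappa ^+ 3) * D k.+1) =
  16 * 10 ^+ 7 * (kappa ^+ 5 * mu * D k.+1) by ring.
have -> : 10 ^+ 9 * kappa ^+ 5 * (mu * (1 - rho) ^+ k.+1 * gap0) =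
  10 ^+ 9 * (kappa ^+ 5 * mu * D k.+1) by rewrite /D; ring.
apply: ler_wpM2r; last by lra.
by rewrite mulr_ge0// mulrC mk_ge0.
Qed.

End InexactProximal.

(** * The outer loop: inexact proximal points for the primal function *)

Section OuterLoop.
Context (R : realType) (d1 d2 : nat).
Local Notation E := ('rV[R]_d1 * 'rV[R]_d2)%type.
Context (f : 'rV[R]_d1 -> 'rV[R]_d2 -> R) (G : E -> E) (L mu : R).
Hypotheses (mu0 : 0 < mu) (muL : mu <= L).
Hypothesis sf : saddle_field (- L) mu L f G.
Let L0 : 0 < L. Proof. exact: lt_le_trans muL. Qed.
Let kappa := L / mu.
Let kappa1 : 1 <= kappa. Proof. by rewrite ler_pdivlMr// mul1r. Qed.
Let kappa0 : 0 < kappa. Proof. by rewrite divr_gt0. Qed.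

Definition ystar (x : 'rV[R]_d1) : 'rV[R]_d2 :=
  xget 0 [set y | (G (x, y)).2 = 0].

Lemma ystarP x : (G (x, ystar x)).2 = 0.
Proof.
rewrite /ystar; case: xgetP => [y _ //|h].
by have [y hy] := exists_argmax x sf mu0 L0; case: (h y).
Qed.

Lemma primalE x : primal f x = f x (ystar x).
Proof. exact: (sup_stationary sf mu0 (ystarP x)). Qed.

Lemma primal_ge x y : f x y <= primal f x.
Proof. exact: (range_sup_ge sf mu0 L0). Qed.

Lemma argmaxE x : argmax (f x) = ystar x.
Proof.
have hmax : forall y', f x y' <= f x (argmax (f x)).
  apply: (@getPex _ (fun y => forall y', f x y' <= f x y)).
  by exists (ystar x) => y'; rewrite -primalE; exact: primal_ge.
have h1 := stationary_max sf (argmax (f x)) (ystarP x).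
have h2 := hmax (ystar x); apply/eqP; rewrite -subr_eq0 -sqn_eq0 eq_le sqn_ge0 andbT.
have m2 : 0 < mu / 2 by rewrite divr_gt0.
by rewrite -(pmulr_rle0 _ m2); lra.
Qed.

(** Strong concavity in the second variable. *)
Lemma error_bound x y : mu ^+ 2 * sqn (y - ystar x) <= sqn (G (x, y)).2.
Proof.
have := monotone_y sf x y (ystar x); rewrite ystarP subr0 -dotNl => h.
have mi : 0 < mu^-1 by rewrite invr_gt0.
have := dot_young (- (G (x, y)).2) (y - ystar x) mi.
rewrite invrK sqnN; set a := sqn (y - _) in h *; set b := sqn _ => h2.
have {}h : mu / 2 * a <= mu^-1 / 2 * b by lra.
have := ler_wpM2l (ltW (mulr_gt0 mu0 (ltr0n R 2))) h.
have -> : mu * 2 * (mu / 2 * a) = mu ^+ 2 * a by field.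
by have -> : mu * 2 * (mu^-1 / 2 * b) = b by field; rewrite gt_eqF.
Qed.

Lemma ystar_lipschitz x u : sqn (ystar u - ystar x) <= kappa ^+ 2 * sqn (u - x).
Proof.
have := error_bound x (ystar u).
have [_ _ /(_ (x, ystar u) (u, ystar u))] := sf.
rewrite /sqn2 [X in _ <= _ * (_ + X)]/= subrr sqn0 addr0.
have -> : (G (x, ystar u) - G (u, ystar u)).2 = (G (x, ystar u)).2.
  by rewrite [LHS]/= ystarP subr0.
rewrite (sqnB_sym x) => h1 h2.
have h : mu ^+ 2 * sqn (ystar u - ystar x) <= L ^+ 2 * sqn (u - x).
  by apply: le_trans h2 (le_trans _ h1); rewrite lerDr sqn_ge0.
rewrite -(ler_pM2l (exprn_gt0 2 mu0)); apply: (le_trans h).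
by rewrite mulrA /kappa expr_div_n [_ ^+ 2 * (_ / _)]mulrC divfK// expf_neq0// gt_eqF.
Qed.

(** Danskin's theorem in quantitative form: the gradient of the maximum is the
    partial gradient at the maximizer, which moves in a Lipschitz way. *)
Lemma primal_quadratic x u :
  `|primal f u - primal f x - dot (G (x, ystar x)).1 (u - x)| <=
    2 * (kappa * L) * sqn (u - x).
Proof.
set g := (G (x, ystar x)).1.
have [hx _ hl] := sf.
have kL : 1 * L <= kappa * L by rewrite ler_wpM2r// ltW.
have s0 := sqn_ge0 (u - x).
have kLs := ler_wpM2r s0 kL.
have h1 := hx x (ystar x) u; rewrite -/g in h1.
have h2 := primal_ge u (ystar x).
have h3 := hx u (ystar u) x.
have h4 := primal_ge x (ystar u).
set g' := (G (u, ystar u)).1 in h3.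
have hg : sqn (g' - g) <= 2 * (kappa * L) ^+ 2 * sqn (u - x).
  have h := hl (u, ystar u) (x, ystar x).
  have h' : sqn (g' - g) <= sqn2 (G (u, ystar u) - G (x, ystar x)).
    by rewrite /sqn2 /= lerDl sqn_ge0.
  apply: (le_trans (le_trans h' h)); rewrite /sqn2 /= exprMn.
  have := ystar_lipschitz x u => hy.
  have k2 : 1 <= kappa ^+ 2 by rewrite exprn_ege1.
  have -> : 2 * (kappa ^+ 2 * L ^+ 2) * sqn (u - x) =
     L ^+ 2 * (2 * kappa ^+ 2 * sqn (u - x)) by ring.
  rewrite ler_wpM2l ?sqr_ge0//.
  have := ler_wpM2r s0 k2; lra.
have kLi : 0 < (kappa * L)^-1 by rewrite invr_gt0 mulr_gt0.
have hd := dot_young (g' - g) (u - x) kLi; rewrite invrK in hd.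
have hq : (kappa * L)^-1 / 2 * sqn (g' - g) <= kappa * L * sqn (u - x).
  have k20 : 0 <= (kappa * L)^-1 / 2 by rewrite divr_ge0// ltW.
  apply: (le_trans (ler_wpM2l k20 hg)); rewrite le_eqVlt; apply/orP; left.
  by apply/eqP; field; rewrite !gt_eqF.
have e1 := primalE x; have e2 := primalE u.
rewrite -(opprB u x) dotNr sqnN in h3; rewrite dotDl dotNl in hd.
by rewrite ler_norml; apply/andP; split; lra.
Qed.

Lemma has_grad_primal x : has_grad (primal f) x (G (x, ystar x)).1.
Proof.
move=> h; apply: (@is_derive_quadratic _ _ _ _ _ _ (2 * (kappa * L) * sqn h)) => t.
have := primal_quadratic x (x + t *: h).
by rewrite [x + _]addrC addrK dotZr sqnZ [_ * (t ^+ 2 * _)]mulrCA [t ^+ 2 * _]mulrC.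
Qed.

Lemma grad_primal x : grad (primal f) x = (G (x, ystar x)).1.
Proof. exact: has_gradE (has_grad_primal x). Qed.

Hypothesis lb : has_lbound (range (primal f)).
Let Phi_inf := inf (range (primal f)).

Lemma primal_inf x : Phi_inf <= primal f x.
Proof. by apply: ge_inf => //; exists x. Qed.

(** A gradient step of length [(4 * (kappa * L))^-1] cannot go below the
    infimum. *)
Lemma grad_primal_le x :
  sqn (grad (primal f) x) <= 8 * (kappa * L) * (primal f x - Phi_inf).
Proof.
rewrite grad_primal; set g := (G _).1.
pose u := x - (4 * (kappa * L))^-1 *: g.
have kL : 0 < kappa * L by rewrite mulr_gt0.
have := primal_quadratic x u; rewrite -/g.
have -> : u - x = - ((4 * (kappa * L))^-1 *: g) by rewrite /u addrAC subrr sub0r.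
rewrite dotNr dotZr -sqn_dot sqnN sqnZ => /ler_normlP[_ h].
have := primal_inf u => hi.
have {}h : (8 * (kappa * L))^-1 * sqn g <= primal f x - Phi_inf.
  have -> : (8 * (kappa * L))^-1 * sqn g = (4 * (kappa * L))^-1 * sqn g -
     2 * (kappa * L) * ((4 * (kappa * L))^-1 ^+ 2 * sqn g).
    by field; rewrite !gt_eqF.
  by lra.
by rewrite -ler_pdivrMl// mulr_gt0.
Qed.

(** The gradient field of the objective of a stage centered at [c]. *)
Definition stage_field (c : 'rV[R]_d1) (p : E) : E :=
  G p + ((2 * L) *: (p.1 - c), 0).

Lemma stage_field_center p : stage_field p.1 p = G p.
Proof. by rewrite /stage_field subrr scaler0; exact: addr0. Qed.

Section OneStage.
Context (p p' : E).
Let st := stage_field p.1 p'.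
Let dx := sqn (p'.1 - p.1).
Let e := sqn2 st.

Let stE : G p' = st - ((2 * L) *: (p'.1 - p.1), 0).
Proof. by rewrite /st /stage_field addrK. Qed.

Lemma field_next_le : sqn2 (G p') <= 2 * e + 8 * L ^+ 2 * dx.
Proof.
rewrite stE; apply: (le_trans (sqn2B_le _ _)); rewrite lerD2l.
by rewrite {1}/sqn2 /= sqn0 addr0 sqnZ -/dx; lra.
Qed.

(** The stage gradient corrected for replacing [p'.2] by the maximizer. *)
Let cor := st.1 + ((G (p'.1, ystar p'.1)).1 - (G p').1).

Let cor_le : sqn cor <= 2 * kappa ^+ 2 * e.
Proof.
apply: (le_trans (sqnD_le _ _)).
have [_ _ hl] := sf.
have h1 : sqn2 (G (p'.1, ystar p'.1) - G p') <= L ^+ 2 * sqn (p'.2 - ystar p'.1).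
  have -> : sqn (p'.2 - ystar p'.1) = sqn2 ((p'.1, ystar p'.1) - p').
    by rewrite /sqn2 /= subrr sqn0 add0r sqnB_sym.
  exact: hl.
have h2 := error_bound p'.1 p'.2.
have e2 : (G (p'.1, p'.2)).2 = st.2.
  by rewrite -surjective_pairing stE [LHS]/= subr0.
rewrite e2 in h2.
have k2 : 1 <= kappa ^+ 2 by rewrite exprn_ege1.
have h3 : L ^+ 2 * sqn (p'.2 - ystar p'.1) <= kappa ^+ 2 * sqn st.2.
  have -> : L ^+ 2 * sqn (p'.2 - ystar p'.1) =
     kappa ^+ 2 * (mu ^+ 2 * sqn (p'.2 - ystar p'.1)).
    by rewrite /kappa; field; rewrite gt_eqF.
  by rewrite ler_wpM2l// sqr_ge0.
have h4 : sqn ((G (p'.1, ystar p'.1)).1 - (G p').1) <= kappa ^+ 2 * sqn st.2.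
  by apply: le_trans h3; apply: le_trans h1; rewrite lerDl sqn_ge0.
have h5 := ler_wpM2r (sqn_ge0 st.1) k2.
by rewrite /e /sqn2; lra.
Qed.

Lemma grad_primal_next_le :
  sqn (grad (primal f) p'.1) <= 4 * (kappa ^+ 2 * e) + 8 * L ^+ 2 * dx.
Proof.
have -> : grad (primal f) p'.1 = cor - (2 * L) *: (p'.1 - p.1).
  rewrite grad_primal /cor.
  have -> : (G p').1 = st.1 - (2 * L) *: (p'.1 - p.1) by rewrite stE.
  by apply/rowP => i; rewrite !mxE; ring.
apply: (le_trans (sqnB_le _ _)); rewrite sqnZ -/dx.
by have := cor_le; lra.
Qed.

(** The stage objective, taken at the maximizer belonging to the new point, is
    strongly convex along the step; the step therefore pays for itself up to the
    inexactness of the stage. *)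
Lemma stage_descent :
  L ^+ 2 * dx <= L * (primal f p.1 - primal f p'.1) + kappa ^+ 2 * e.
Proof.
have [hx _ _] := sf; have := hx p'.1 (ystar p'.1) p.1.
have -> : (G (p'.1, ystar p'.1)).1 = cor - (2 * L) *: (p'.1 - p.1).
  rewrite /cor.
  have -> : (G p').1 = st.1 - (2 * L) *: (p'.1 - p.1) by rewrite stE.
  by apply/rowP => i; rewrite !mxE; ring.
have := primal_ge p.1 (ystar p'.1); rewrite (primalE p'.1).
rewrite -(opprB p'.1 p.1) sqnN dotNr dotDl dotNl dotZl -sqn_dot -/dx.
have Li : 0 < L^-1 by rewrite invr_gt0.
have := dot_young cor (p'.1 - p.1) Li; rewrite invrK -/dx => h1 h2 h3.
have h4 : L * dx <= primal f p.1 - f p'.1 (ystar p'.1) + L^-1 / 2 * sqn cor by lra.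
have := ler_wpM2l (ltW L0) h4.
have -> : L * (primal f p.1 - f p'.1 (ystar p'.1) + L^-1 / 2 * sqn cor) =
   L * (primal f p.1 - f p'.1 (ystar p'.1)) + sqn cor / 2.
  by field; rewrite gt_eqF.
by rewrite mulrA -expr2; have := cor_le; lra.
Qed.

End OneStage.

Context (p : nat -> E).
Hypothesis stop : forall t,
  sqn2 (stage_field (p t).1 (p t.+1)) <=
    stage_tol L mu t * sqn2 (G (p t)).

Let Delta := primal f (p 0%N).1 - Phi_inf.
Let Dy0 := sqn ((p 0%N).2 - argmax (f (p 0%N).1)).
Let e t := kappa ^+ 2 * sqn2 (stage_field (p t).1 (p t.+1)).
Let dx t := L ^+ 2 * sqn ((p t.+1).1 - (p t).1).

Let Delta_ge0 : 0 <= Delta. Proof. by rewrite subr_ge0 primal_inf. Qed.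

(** The first stage tolerance contains enough powers of [mu] and [L] to bring the
    initial gradient down to [L * (Delta + Dy0)] for small as well as for large
    [L]. *)
Lemma first_stage : e 0%N <= L * (Delta + Dy0).
Proof.
have hG : sqn2 (G (p 0%N)) <= 16 * (kappa * L) * Delta + 2 * L ^+ 2 * Dy0.
  set x := (p 0%N).1.
  have -> : G (p 0%N) = G (x, ystar x) +
     (G (p 0%N) - G (x, ystar x)) by rewrite addrC subrK.
  apply: (le_trans (sqn2D_le _ _)).
  have [_ _ /(_ (p 0%N) (x, ystar x))] := sf.
  have -> : sqn2 (p 0%N - (x, ystar x)) = Dy0.
    by rewrite /sqn2 /= subrr sqn0 add0r /Dy0 argmaxE.
  have -> : sqn2 (G (x, ystar x)) = sqn (grad (primal f) x).
    by rewrite grad_primal /sqn2 ystarP sqn0 addr0.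
  by have := grad_primal_le x; rewrite -/Delta; lra.
rewrite /e; have h := stop 0.
have k20 : 0 <= kappa ^+ 2 by rewrite sqr_ge0.
apply: (le_trans (ler_wpM2l k20 h)); rewrite /stage_tol.
set m := Num.max 1 (L ^+ 7).
have m1 : 1 <= m by rewrite le_max lexx.
have m0 : 0 < m := lt_le_trans ltr01 m1.
have pow_le k : (k <= 7)%N -> L ^+ k <= m.
  move=> k7; rewrite le_max; apply/orP.
  have [l1|l1] := leP L 1; [left; by rewrite exprn_ile1 ?(ltW L0)|right].
  by apply: ler_weXn2l => //; exact: ltW.
have c0 : 0 <= kappa ^+ 2 * (mu ^+ 5 / (576 * m)) := mulr_ge0 k20
  (divr_ge0 (exprn_ge0 5 (ltW mu0)) (mulr_ge0 (ler0n R 576) (ltW m0))).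
rewrite mulrA; apply: (le_trans (ler_wpM2l c0 hG)).
rewrite mulrDr [leRHS]mulrDr; apply: lerD.
  have -> : kappa ^+ 2 * (mu ^+ 5 / (576 * m)) * (16 * (kappa * L) * Delta) =
     (L ^+ 3 * mu ^+ 2 / (36 * m)) * (L * Delta).
    by rewrite /kappa; field; rewrite !gt_eqF.
  rewrite ler_piMl ?mulr_ge0 ?(ltW L0)// ler_pdivrMr ?mulr_gt0// mul1r.
  apply: (@le_trans _ _ (L ^+ 5)).
    rewrite (exprD L 3 2) ler_wpM2l ?exprn_ge0 ?(ltW L0)//.
    by apply: lerXn2r => //; rewrite nnegrE ltW.
  by have := pow_le 5 isT; lra.
have -> : kappa ^+ 2 * (mu ^+ 5 / (576 * m)) * (2 * L ^+ 2 * Dy0) =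
   (L ^+ 3 * mu ^+ 3 / (288 * m)) * (L * Dy0).
  by rewrite /kappa; field; rewrite !gt_eqF.
have d0 : 0 < 288 * m := mulr_gt0 (ltr0Sn R 287) m0.
apply: ler_piMl; first by rewrite mulr_ge0 ?sqn_ge0 ?(ltW L0).
rewrite ler_pdivrMr// mul1r.
apply: (@le_trans _ _ (L ^+ 6)).
  rewrite (exprD L 3 3) ler_wpM2l ?exprn_ge0 ?(ltW L0)//.
  by apply: lerXn2r => //; rewrite nnegrE ltW.
by have := pow_le 6 isT; lra.
Qed.

(** The next stage starts with a gradient of the order of the last step and the
    last error, and its tolerance divides this by more than [kappa ^+ 2]. *)
Lemma later_stage t : e t.+1 <= (e t + 4 * dx t) / 252.
Proof.
rewrite {1}/e; have := stop t.+1; rewrite /stage_tol => h.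
have k20 : 0 <= kappa ^+ 2 by rewrite sqr_ge0.
apply: (le_trans (ler_wpM2l k20 h)).
have hn := field_next_le (p t) (p t.+1).
have c0 : 0 <= kappa ^+ 2 * (mu ^+ 5 / (504 * L ^+ 5)) := mulr_ge0 k20
  (divr_ge0 (exprn_ge0 5 (ltW mu0)) (mulr_ge0 (ler0n R 504) (exprn_ge0 5 (ltW L0)))).
rewrite mulrA; apply: (le_trans (ler_wpM2l c0 hn)).
have c1 : kappa ^+ 2 * (mu ^+ 5 / (504 * L ^+ 5)) <= 504^-1.
  have -> : kappa ^+ 2 * (mu ^+ 5 / (504 * L ^+ 5)) = (mu / L) ^+ 3 / 504.
    by rewrite /kappa; field; rewrite !gt_eqF.
  rewrite -[leRHS]mul1r; apply: ler_wpM2r; first by rewrite invr_ge0 ler0n.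
  apply: exprn_ile1; first exact: divr_ge0 (ltW mu0) (ltW L0).
  by rewrite ler_pdivrMr// mul1r.
set S := sqn2 (stage_field (p t).1 (p t.+1)) in hn *; have S0 : 0 <= S := sqn2_ge0 _.
have Dx0 : 0 <= dx t by rewrite mulr_ge0 ?sqr_ge0 ?sqn_ge0.
have k2 : 1 <= kappa ^+ 2 by rewrite exprn_ege1.
rewrite /e -/S; rewrite -[8 * _ * _]mulrA -/(dx t).
have X0 : 0 <= 2 * S + 8 * dx t :=
  addr_ge0 (mulr_ge0 (ler0n R 2) S0) (mulr_ge0 (ler0n R 8) Dx0).
apply: (le_trans (ler_wpM2r X0 c1)).
have := ler_wpM2r S0 k2; lra.
Qed.

(** Steps are bounded by the decrease of the primal function and by the errors,
    errors by a small multiple of steps and earlier errors: the two sums control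
    each other. *)
Lemma sum_grad_primal_le T :
  \sum_(1 <= t < T.+1) sqn (grad (primal f) (p t).1) <= 26 * (L * (Delta + Dy0)).
Proof.
have e0 t : 0 <= e t by rewrite mulr_ge0 ?sqr_ge0 ?sqn2_ge0.
have Dx0 t : 0 <= dx t by rewrite mulr_ge0 ?sqr_ge0 ?sqn_ge0.
have h1 : \sum_(1 <= t < T.+1) sqn (grad (primal f) (p t).1) <=
    4 * (\sum_(0 <= t < T) e t) + 8 * (\sum_(0 <= t < T) dx t).
  rewrite big_add1 /= !mulr_sumr -big_split /=; apply: ler_sum_nat => t _.
  have := grad_primal_next_le (p t) (p t.+1); rewrite -/(e t) /dx; lra.
have h2 : \sum_(0 <= t < T) dx t <= L * Delta + \sum_(0 <= t < T) e t.
  suff : \sum_(0 <= t < T) dx t <= L * (primal f (p 0%N).1 - primal f (p T).1)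
      + \sum_(0 <= t < T) e t.
    move=> h; apply: (le_trans h); rewrite lerD2r ler_wpM2l ?(ltW L0)//.
    by rewrite lerB// primal_inf.
  elim: T {h1} => [|T IH]; first by rewrite !big_nil subrr mulr0 addr0.
  rewrite !big_nat_recr//=; have := stage_descent (p T) (p T.+1).
  rewrite -/(e T) -/(dx T); lra.
have h3 : \sum_(0 <= t < T) e t <= e 0%N +
    (\sum_(0 <= t < T) e t + 4 * \sum_(0 <= t < T) dx t) / 252.
  case: T {h1 h2} => [|T].
    by rewrite !big_nil; have := e0 0%N; lra.
  rewrite {1}big_nat_recl// lerD2l.
  have : \sum_(0 <= t < T) e t.+1 <= (\sum_(0 <= t < T) (e t + 4 * dx t)) / 252.
    by rewrite mulr_suml; apply: ler_sum_nat => t _; exact: later_stage.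
  rewrite big_split /= -[X in _ + X]mulr_sumr !big_nat_recr//=.
  by have := e0 T; have := Dx0 T; lra.
have := first_stage; have := mulr_ge0 (ltW L0) Delta_ge0.
have : 0 <= L * Dy0 by rewrite mulr_ge0 ?sqn_ge0// ltW.
by lra.
Qed.

End OuterLoop.

(** * Borel measurability on products *)

Section BorelProduct.
Context (R : realType).

Lemma lipschitz_continuous (d1 d2 : nat) (V : normedModType R)
    (g : 'rV[R]_d1 * 'rV[R]_d2 -> V) (C : R) :
  (forall p q, `|g p - g q| ^+ 2 <= C * sqn2 (p - q)) -> continuous g.
Proof.
move=> hg p; apply/cvgrPdist_le => e e0.
pose D : R := (`|C| + 1) * (d1%:R + d2%:R + 1).
have D0 : 0 < D by rewrite mulr_gt0// ltr_wpDl// addr_ge0.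
have D1 : 1 <= D.
  by rewrite -[leLHS]mulr1 ler_pM// lerDr ?addr_ge0.
near=> q; rewrite -(@ler_pXn2r _ 2)// ?nnegrE ?(ltW e0)//.
have pq : `|p - q| <= e / D.
  by near: q; apply: cvgr_dist_le; [exact: cvg_id|rewrite divr_gt0].
apply: (le_trans (hg p q)).
have h1 : `|(p - q).1| ^+ 2 <= (e / D) ^+ 2.
  rewrite lerXn2r ?nnegrE ?divr_ge0 ?(ltW e0) ?(ltW D0)//.
  by apply: le_trans pq; rewrite [leRHS]prod_normE le_max lexx.
have h2 : `|(p - q).2| ^+ 2 <= (e / D) ^+ 2.
  rewrite lerXn2r ?nnegrE ?divr_ge0 ?(ltW e0) ?(ltW D0)//.
  by apply: le_trans pq; rewrite [leRHS]prod_normE le_max lexx orbT.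
have h3 : sqn2 (p - q) <= (d1%:R + d2%:R) * (e / D) ^+ 2.
  rewrite mulrDl /sqn2; apply: lerD; apply: (le_trans (sqn_le_norm _)).
    exact: ler_wpM2l.
  exact: ler_wpM2l.
have h4 : C * sqn2 (p - q) <= (`|C| + 1) * (d1%:R + d2%:R + 1) * (e / D) ^+ 2.
  apply: (@le_trans _ _ ((`|C| + 1) * sqn2 (p - q))).
    by rewrite ler_wpM2r ?sqn2_ge0// (le_trans (ler_norm _))// lerDl.
  rewrite -mulrA ler_wpM2l ?addr_ge0//; apply: (le_trans h3).
  by rewrite ler_wpM2r ?sqr_ge0// lerDl.
apply: (le_trans h4); rewrite -/D.
have -> : D * (e / D) ^+ 2 = e ^+ 2 / D by field; rewrite gt_eqF.
by rewrite ler_pdivrMr// ler_peMr// sqr_ge0.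
Unshelve. all: by end_near. Qed.

(** The Borel sigma-algebra of a product of finite-dimensional spaces is the
    product of the Borel sigma-algebras: rational boxes form a countable
    base. *)
Lemma open_measurable_prod (d1 d2 : nat) (U : set ('rV[R]_d1 * 'rV[R]_d2)) :
  open U -> measurable (U : set (borel R d1 * borel R d2)).
Proof.
move=> oU.
pose I := ('rV[rat]_d1 * 'rV[rat]_d2 * nat)%type.
pose ctr d (a : 'rV[rat]_d) : 'rV[R]_d := map_mx ratr a.
pose B (i : I) : set ('rV[R]_d1 * 'rV[R]_d2) :=
  ball (ctr _ i.1.1) (i.2.+1%:R^-1) `*` ball (ctr _ i.1.2) (i.2.+1%:R^-1).
have rat_near d (x : 'rV[R]_d) (e : R) : 0 < e -> exists a, ball (ctr d a) e x.
  move=> e0.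
  have h j : exists q : rat, `|ratr q - x ord0 j| < e.
    have [|q] := @rat_in_itvoo R (x ord0 j - e) (x ord0 j + e).
      by rewrite ltrD2l gtrN.
    rewrite in_itv /= => /andP[h1 h2]; exists q; rewrite ltr_distl.
    by apply/andP; split; lra.
  exists (\row_j xchoose (h j)); split=> // i j.
  by rewrite (ord1 i) !mxE; exact: (xchooseP (h j)).
have -> : U = \bigcup_(i in [set: I]) (if `[< B i `<=` U >] then B i else set0).
  apply/seteqP; split=> [p Up|p [i _]]; last first.
    by case: asboolP => // BU Bp; exact: BU.
  have /nbhs_ballP[e /= e0 pe] : nbhs p U by exact: open_nbhs_nbhs.
  have [m] := @ltr_add_invr R 0 (e / 2) (divr_gt0 e0 (ltr0n R 2)).
  rewrite add0r => hm.
  have m0 : (0 : R) < m.+1%:R^-1 by rewrite invr_gt0 ltr0n.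
  have [a ha] := rat_near d1 p.1 _ m0; have [b hb] := rat_near d2 p.2 _ m0.
  exists (a, b, m) => //.
  have Bp : B (a, b, m) p by split.
  case: asboolP => // -[] q [/= qa qb]; apply: pe.
  have em : m.+1%:R^-1 + m.+1%:R^-1 <= e by rewrite [leRHS]splitr lerD// ltW.
  split; apply: le_ball em _ _.
    by apply: ball_triangle qa; exact: ball_sym.
  by apply: ball_triangle qb; exact: ball_sym.
apply: countable_bigcupT_measurable => [|i]; first exact: countableP.
case: asboolP => // _.
by apply: measurableX; apply: sub_sigma_algebra; exact: ball_open.
Qed.

Context (d1 d2 : nat).
Local Notation B1 := (borel R d1).
Local Notation B2 := (borel R d2).

Lemma continuous_measurable_real (g : 'rV[R]_d1 * 'rV[R]_d2 -> R) :
  continuous g -> measurable_fun [set: B1 * B2] (g : B1 * B2 -> R).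
Proof.
move=> cg; apply: (measurability _ (RGenOpens.measurableE R)).
move=> _ [_ [a [b ->] <-]]; rewrite setTI; apply: open_measurable_prod.
by move/continuousP: cg; apply; exact: interval_open.
Qed.

Lemma continuous_measurable_borel d (g : 'rV[R]_d1 * 'rV[R]_d2 -> 'rV[R]_d) :
  continuous g -> measurable_fun [set: B1 * B2] (g : B1 * B2 -> borel R d).
Proof.
move=> cg; apply: (@measurability _ _ _ (borel R d) _ _ open) => //.
move=> _ [U oU <-]; rewrite setTI; apply: open_measurable_prod.
by move/continuousP: cg; apply.
Qed.

End BorelProduct.

Section MeasurableVectors.
Context (R : realType) (dT : measure_display) (T : measurableType dT).

Lemma lipschitz_measurable (d1 d2 d : nat)
    (g : 'rV[R]_d1 * 'rV[R]_d2 -> 'rV[R]_d) (C : R)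
    (X : T -> borel R d1) (Y : T -> borel R d2) :
  (forall p q, sqn (g p - g q) <= C * sqn2 (p - q)) ->
  measurable_fun [set: T] X -> measurable_fun [set: T] Y ->
  measurable_fun [set: T] (fun w => g (X w, Y w) : borel R d).
Proof.
move=> hg mX mY.
have cg : continuous g.
  apply: (@lipschitz_continuous _ _ _ _ _ C) => p q.
  by apply: le_trans (hg p q); exact: sqn_norm_le.
exact: (measurableT_comp (continuous_measurable_borel cg) (measurable_fun_pair mX mY)).
Qed.

Lemma measurable_lin (d : nat) (a b : R) (X Y : T -> borel R d) :
  measurable_fun [set: T] X -> measurable_fun [set: T] Y ->
  measurable_fun [set: T]
    (fun w => (a *: (X w : 'rV[R]_d) + b *: (Y w : 'rV[R]_d)) : borel R d).
Proof.
pose g (p : 'rV[R]_d * 'rV[R]_d) := a *: p.1 + b *: p.2.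
apply: (@lipschitz_measurable _ _ _ g (2 * (a ^+ 2 + b ^+ 2))) => p q.
have -> : g p - g q = a *: (p.1 - q.1) + b *: (p.2 - q.2).
  by rewrite /g !scalerBr opprD addrACA.
apply: (le_trans (sqnD_le _ _)); rewrite !sqnZ /sqn2 /=.
have := mulr_ge0 (sqr_ge0 a) (sqn_ge0 (p.2 - q.2)).
have := mulr_ge0 (sqr_ge0 b) (sqn_ge0 (p.1 - q.1)).
by lra.
Qed.

Lemma measurable_sqn (d : nat) (X : T -> borel R d) :
  measurable_fun [set: T] X -> measurable_fun [set: T] (fun w => sqn (X w : 'rV[R]_d)).
Proof.
move=> mX; apply: measurable_sum => i; apply: measurable_funX.
pose g (p : 'rV[R]_d * 'rV[R]_d) := p.1 ord0 i.
have cg : continuous g.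
  apply: (@lipschitz_continuous _ _ _ _ _ 1) => p q; rewrite mul1r.
  rewrite real_normK ?num_real// /sqn2 /sqn (bigD1 i)//= -!addrA !mxE lerDl.
  by rewrite addr_ge0 ?sumr_ge0// => *; exact: sqr_ge0.
exact: (measurableT_comp (continuous_measurable_real cg) (measurable_fun_pair mX mX)).
Qed.

End MeasurableVectors.

(** * Measurability of the oracles and of the tolerances *)

Section FirstIndex.

Lemma first_indexP (A : nat -> Prop) : (exists N, A N) ->
  A (first_index A) /\ forall m, (m < first_index A)%N -> ~ A m.
Proof.
move=> exA; rewrite /first_index; case: xgetP => [N _ //|none]; exfalso.
have [N AN] := exA; move: AN; elim/ltn_ind: N => N IH AN.
by apply: (none N); split => // m mN Am; exact: IH mN Am.
Qed.

Lemma first_index_eq (A : nat -> Prop) N :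
  A N -> (forall m, (m < N)%N -> ~ A m) -> first_index A = N.
Proof.
move=> AN hN; have [|h1 h2] := @first_indexP A; first by exists N.
apply/eqP; rewrite eqn_leq; apply/andP; split; rewrite leqNgt; apply/negP.
  by move=> /h2.
by move=> /hN.
Qed.

Lemma first_index_le (A : nat -> Prop) N : A N -> (first_index A <= N)%N.
Proof.
move=> AN; have [|h1 h2] := @first_indexP A; first by exists N.
by rewrite leqNgt; apply/negP => /h2.
Qed.

Lemma first_index_none (A : nat -> Prop) : (forall N, ~ A N) -> first_index A = 0%N.
Proof. by move=> h; rewrite /first_index; case: xgetP => // N _ [/h]. Qed.

Context (dT dY : measure_display) (T : measurableType dT) (Y : measurableType dY).

Lemma measurable_first_index (A : nat -> T -> Prop) (X : nat -> T -> Y) :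
  (forall N, measurable [set w | A N w]) ->
  (forall N, measurable_fun [set: T] (X N)) ->
  measurable_fun [set: T] (fun w => X (first_index (A ^~ w)) w).
Proof.
move=> mA mX _ B mB; rewrite setTI.
pose I N := [set w | A N w] `&` \bigcap_(m in [set m | (m < N)%N]) ~` [set w | A m w].
have -> : (fun w => X (first_index (A ^~ w)) w) @^-1` B =
    (\bigcup_N (I N `&` X N @^-1` B)) `|`
    ((\bigcap_N ~` [set w | A N w]) `&` X 0%N @^-1` B).
  apply/seteqP; split => w /=.
    have [exA BX|nA] := pselect (exists N, A N w).
      by left; have [h1 h2] := first_indexP exA; exists (first_index (A ^~ w)).
    have {}nA : forall N, ~ A N w by move=> N AN; apply: nA; exists N.
    by rewrite first_index_none// => BX; right; split => // N _; exact: nA.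
  move=> [[N _ [[AN hN] BX]]|[hN BX]].
    by rewrite (@first_index_eq (A ^~ w) N).
  by rewrite first_index_none// => N; exact: hN.
apply: measurableU.
  apply: bigcupT_measurable => N; apply: measurableI; last first.
    by rewrite -[X in measurable X]setTI; exact: mX.
  apply: measurableI => //; apply: bigcap_measurableType => m _.
  exact: measurableC.
apply: measurableI; last by rewrite -[X in measurable X]setTI; exact: mX.
by apply: bigcapT_measurable => N; exact: measurableC.
Qed.

End FirstIndex.

Section MeasurableRun.
Context (R : realType) (n d1 d2 : nat).
Local Notation E := ('rV[R]_d1 * 'rV[R]_d2)%type.
Local Notation B1 := (borel R d1).
Local Notation B2 := (borel R d2).
Context (f : 'rV[R]_d1 -> 'rV[R]_d2 -> R) (G : E -> E) (L mu : R).
Hypotheses (L0 : 0 < L) (mu0 : 0 < mu) (muL : mu <= L).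
Hypothesis sf : saddle_field (- L) mu L f G.
Hypothesis cf : continuous (joint f).
Hypothesis sub_gradE : forall s c z p,
  grad2 (sub_obj L s f c z) p = G p + ((2 * L) *: (p.1 - c), - (s *: (p.2 - z))).
Hypothesis sf_sub : forall s c z, 0 <= s -> s <= L ->
  saddle_field L (mu + s) (4 * L) (sub_obj L s f c z) (grad2 (sub_obj L s f c z)).

Section Oracle.
Context (dT : measure_display) (T : measurableType dT).
Context (X c : T -> B1) (Y z : T -> B2).
Hypotheses (mX : measurable_fun [set: T] X) (mY : measurable_fun [set: T] Y).
Hypotheses (mc : measurable_fun [set: T] c) (mz : measurable_fun [set: T] z).

Lemma measurable_objective : measurable_fun [set: T] (fun w => f (X w) (Y w)).
Proof.
exact: (measurableT_comp (continuous_measurable_real cf) (measurable_fun_pair mX mY)).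
Qed.

Lemma measurable_field1 :
  measurable_fun [set: T] (fun w => (G (X w, Y w)).1 : borel R d1).
Proof.
apply: (@lipschitz_measurable _ _ _ _ _ _ (fun p => (G p).1) (L ^+ 2)) => // p q.
by have [_ _ /(_ p q)] := sf; apply: le_trans; rewrite lerDl sqn_ge0.
Qed.

Lemma measurable_field2 :
  measurable_fun [set: T] (fun w => (G (X w, Y w)).2 : borel R d2).
Proof.
apply: (@lipschitz_measurable _ _ _ _ _ _ (fun p => (G p).2) (L ^+ 2)) => // p q.
by have [_ _ /(_ p q)] := sf; apply: le_trans; rewrite lerDr sqn_ge0.
Qed.

Lemma measurable_sub_grad (s : R) :
  measurable_fun [set: T]
    (fun w => sqn2 (grad2 (sub_obj L s f (c w) (z w)) (X w, Y w))).
Proof.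
have e w : sqn2 (grad2 (sub_obj L s f (c w) (z w)) (X w, Y w)) =
    sqn (1 *: (G (X w, Y w)).1 + (2 * L) *: (1 *: (X w : 'rV_d1) + (- 1) *: (c w : 'rV_d1))) +
    sqn (1 *: (G (X w, Y w)).2 + (- s) *: (1 *: (Y w : 'rV_d2) + (- 1) *: (z w : 'rV_d2))).
  by rewrite sub_gradE /sqn2 !scaleN1r !scale1r !scaleNr.
apply: (eq_measurable_fun _ (fun w _ => esym (e w))).
apply: measurable_funD; apply: measurable_sqn; apply: measurable_lin.
- exact: measurable_field1.
- exact: measurable_lin.
- exact: measurable_field2.
- exact: measurable_lin.
Qed.

End Oracle.

Section StageGap.

(** The gap is a supremum minus an infimum over uncountably many points; it is
    measurable because the maximizer and the minimizer depend in a Lipschitz way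
    on the point where the gap is taken. *)
Let xmin (p : E) : 'rV[R]_d1 :=
  xget 0 [set x | (grad2 (stage_obj L f p.1) (x, p.2)).1 = 0].

Lemma saddle_field_stage (x : 'rV[R]_d1) :
  saddle_field L mu (4 * L) (stage_obj L f x) (grad2 (stage_obj L f x)).
Proof.
rewrite (stage_objE f L x 0) -[X in saddle_field _ X]addr0.
by apply: sf_sub => //; exact: ltW.
Qed.

Lemma stage_gradE (x : 'rV[R]_d1) (p : E) :
  grad2 (stage_obj L f x) p = G p + ((2 * L) *: (p.1 - x), 0).
Proof. by rewrite (stage_objE f L x 0) sub_gradE scale0r oppr0. Qed.

Let L40 : 0 < 4 * L. Proof. by rewrite mulr_gt0. Qed.

Let xminP p : (grad2 (stage_obj L f p.1) (xmin p, p.2)).1 = 0.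
Proof.
rewrite /xmin; case: xgetP => [x _ //|none].
have [x hx] := exists_argmin p.2 (saddle_field_stage p.1) L0 L40.
by case: (none x).
Qed.

Lemma stage_argmin_lipschitz (p q : E) x x' :
  (grad2 (stage_obj L f p.1) (x, p.2)).1 = 0 ->
  (grad2 (stage_obj L f q.1) (x', q.2)).1 = 0 ->
  sqn (x - x') <= 10 * sqn2 (p - q).
Proof.
move=> hx hx'.
have h1 := monotone_x (saddle_field_stage p.1) x x' p.2; rewrite hx sub0r in h1.
set u := (grad2 (stage_obj L f p.1) (x', p.2)).1 in h1.
have uE : u = ((G (x', p.2)).1 - (G (x', q.2)).1) + (2 * L) *: (q.1 - p.1).
  rewrite -[LHS]subr0 -hx' /u !stage_gradE /=.
  by apply/rowP => i; rewrite !mxE; ring.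
have hu : sqn u <= 10 * L ^+ 2 * sqn2 (p - q).
  rewrite uE; apply: (le_trans (sqnD_le _ _)); rewrite sqnZ.
  have [_ _ /(_ (x', p.2) (x', q.2))] := sf.
  rewrite {2}/sqn2 /= subrr sqn0 add0r => hl.
  have h2 : sqn ((G (x', p.2)).1 - (G (x', q.2)).1) <= L ^+ 2 * sqn (p.2 - q.2).
    by apply: le_trans hl; rewrite lerDl sqn_ge0.
  rewrite (sqnB_sym q.1) /sqn2 /=.
  have := mulr_ge0 (sqr_ge0 L) (sqn_ge0 (p.1 - q.1)).
  have := mulr_ge0 (sqr_ge0 L) (sqn_ge0 (p.2 - q.2)).
  by lra.
have Li : 0 < L^-1 by rewrite invr_gt0.
have := dot_young (- u) (x - x') Li; rewrite invrK sqnN => h3.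
have {}h3 : L / 2 * sqn (x - x') <= L^-1 / 2 * sqn u by lra.
have L2 : 0 <= L^-1 / 2 by rewrite divr_ge0// ltW.
have := le_trans h3 (ler_wpM2l L2 hu).
have -> : L^-1 / 2 * (10 * L ^+ 2 * sqn2 (p - q)) = L / 2 * (10 * sqn2 (p - q)).
  by field; rewrite gt_eqF.
by rewrite ler_pM2l// divr_gt0.
Qed.

Context (dT : measure_display) (T : measurableType dT).
Context (X : T -> B1) (Y : T -> B2).
Hypotheses (mX : measurable_fun [set: T] X) (mY : measurable_fun [set: T] Y).

Lemma measurable_gap :
  measurable_fun [set: T] (fun w => gap (stage_obj L f (X w)) (X w, Y w)).
Proof.
pose Xm w : B1 := xmin (X w, Y w).
pose Ym w : B2 := ystar G (X w).
have mXm : measurable_fun [set: T] Xm.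
  apply: (@lipschitz_measurable _ _ _ _ _ _ xmin 10 X Y _ mX mY) => p q.
  exact: stage_argmin_lipschitz.
have mYm : measurable_fun [set: T] Ym.
  apply: (@lipschitz_measurable _ _ _ _ _ _ (fun p : 'rV[R]_d1 * 'rV[R]_d1 => ystar G p.1)
    ((L / mu) ^+ 2) X X _ mX mX) => p q.
  apply: (le_trans (ystar_lipschitz mu0 muL sf _ _)); rewrite ler_wpM2l ?sqr_ge0//.
  by rewrite lerDl sqn_ge0.
have e w : gap (stage_obj L f (X w)) (X w, Y w) =
    f (X w) (Ym w) - (f (Xm w) (Y w) +
      L * sqn (1 *: (Xm w : 'rV_d1) + (- 1) *: (X w : 'rV_d1))).
  rewrite /gap /= (inf_stationary (saddle_field_stage (X w)) L0 (xminP (X w, Y w))).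
  have es : (grad2 (stage_obj L f (X w)) (X w, Ym w)).2 = 0.
    by rewrite stage_gradE /= addr0; exact: (ystarP mu0 muL sf).
  rewrite (sup_stationary (saddle_field_stage (X w)) mu0 es).
  by rewrite /stage_obj subrr sqn0 mulr0 addr0 scale1r scaleN1r.
suff h : measurable_fun [set: T] (fun w => f (X w) (Ym w) - (f (Xm w) (Y w) +
    L * sqn (1 *: (Xm w : 'rV_d1) + (- 1) *: (X w : 'rV_d1)))).
  by apply: eq_measurable_fun h => w _; exact/esym/e.
apply: measurable_funB; first exact: measurable_objective.
apply: measurable_funD; first exact: measurable_objective.
by apply: measurable_funM => //; apply: measurable_sqn; exact: measurable_lin.
Qed.

End StageGap.
End MeasurableRun.

(** * Measurability of the iterates *)

Section AlgorithmMeasurable.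
Context (R : realType) (n d1 d2 : nat).
Local Notation E := ('rV[R]_d1 * 'rV[R]_d2)%type.
Local Notation B1 := (borel R d1).
Local Notation B2 := (borel R d2).
Local Notation B := (borel R d1 * borel R d2)%type.
Context (F : 'I_n -> 'rV[R]_d1 -> 'rV[R]_d2 -> R) (L mu tau : R).
Context (dS : measure_display) (S : measurableType dS) (M : solver R n d1 d2 S).
Context (alpha : nat -> R) (tol : nat -> E -> nat -> R).
Hypothesis mM : forall N : nat, measurable_fun [set: _]
  (fun u : B * B * S =>
     M (fun i => sub_obj L tau (F i) u.1.1.1 u.1.1.2) u.1.2 u.2 N : B).
Hypothesis mgrad : forall (dT : measure_display) (T : measurableType dT)
  (s : R) (c : T -> B1) (z : T -> B2) (p : T -> B),
  measurable_fun [set: T] c -> measurable_fun [set: T] z ->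
  measurable_fun [set: T] p ->
  measurable_fun [set: T]
    (fun w => sqn2 (grad2 (sub_obj L s (average F) (c w) (z w)) (p w : E))).
Hypothesis mtol : forall (dT : measure_display) (T : measurableType dT)
  (t k : nat) (p : T -> B), measurable_fun [set: T] p ->
  measurable_fun [set: T] (fun w => tol t (p w : E) k).

Context (dT : measure_display) (T : measurableType dT).

Lemma measurable_sub_run (p0 p : T -> B) (z : T -> B2) (seed : nat -> T -> S)
    (k N : nat) :
  measurable_fun [set: T] p0 -> measurable_fun [set: T] p ->
  measurable_fun [set: T] z -> measurable_fun [set: T] (seed k) ->
  measurable_fun [set: T]
    (fun w => sub_run F L tau M (p0 w) (seed^~ w) (p w) (z w) k N : B).
Proof.
move=> mp0 mp mz ms.
have mu' : measurable_fun [set: T] (fun w => ((p0 w).1, z w, p w, seed k w) : B * B * S).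
  apply: measurable_fun_pair => //; apply: measurable_fun_pair => //.
  apply: measurable_fun_pair => //; exact: (measurableT_comp measurable_fst mp0).
exact: (measurableT_comp (mM N) mu').
Qed.

Lemma measurable_sub_solved (t : nat) (p0 p : T -> B) (z : T -> B2)
    (seed : nat -> T -> S) (k N : nat) :
  measurable_fun [set: T] p0 -> measurable_fun [set: T] p ->
  measurable_fun [set: T] z -> measurable_fun [set: T] (seed k) ->
  measurable [set w | sub_solved F L tau M tol t (p0 w) (seed^~ w) (p w) (z w) k N].
Proof.
move=> mp0 mp mz ms; rewrite -[X in measurable X]setTI.
have h1 := mgrad tau (measurableT_comp measurable_fst mp0) mz
  (measurable_sub_run N mp0 mp mz ms).
exact: (measurable_fun_le measurableT h1 (mtol t k mp0)).
Qed.

Lemma measurable_inner (t : nat) (p0 : T -> B) (seed : nat -> T -> S) k :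
  measurable_fun [set: T] p0 ->
  (forall j, (0 < j <= k)%N -> measurable_fun [set: T] (seed j)) ->
  measurable_fun [set: T]
    (fun w => inner F L mu tau M tol t (p0 w) (seed^~ w) k : B * B2).
Proof.
move=> mp0; elim: k => [|k IH] ms.
  apply: measurable_fun_pair => //; exact: (measurableT_comp measurable_snd mp0).
have {}IH : measurable_fun [set: T]
    (fun w => inner F L mu tau M tol t (p0 w) (seed^~ w) k : B * B2).
  by apply: IH => j /andP[j0 jk]; apply: ms; rewrite j0 ltnW.
pose p w : B := (inner F L mu tau M tol t (p0 w) (seed^~ w) k).1.
pose z w : B2 := (inner F L mu tau M tol t (p0 w) (seed^~ w) k).2.
have mp : measurable_fun [set: T] p := measurableT_comp measurable_fst IH.
have mz : measurable_fun [set: T] z := measurableT_comp measurable_snd IH.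
have mk : measurable_fun [set: T] (seed k.+1) by apply: ms; rewrite ltnS leqnn.
pose p' w : B := sub_run F L tau M (p0 w) (seed^~ w) (p w) (z w) k.+1
  (first_index (sub_solved F L tau M tol t (p0 w) (seed^~ w) (p w) (z w) k.+1)).
have mp' : measurable_fun [set: T] p'.
  apply: (@measurable_first_index _ _ T _
    (fun N w => sub_solved F L tau M tol t (p0 w) (seed^~ w) (p w) (z w) k.+1 N)
    (fun N w => sub_run F L tau M (p0 w) (seed^~ w) (p w) (z w) k.+1 N : B)) => N.
    exact: measurable_sub_solved.
  exact: measurable_sub_run.
set q := mu / (mu + tau); set mom := (Num.sqrt q - q) / (Num.sqrt q + q).
have e w : inner F L mu tau M tol t (p0 w) (seed^~ w) k.+1 =
    (p' w, (1 + mom) *: ((p' w).2 : 'rV_d2) + (- mom) *: ((p w).2 : 'rV_d2)).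
  rewrite /= /p' /p /z; case: (inner _ _ _ _ _ _ _ _ _ k) => pp zz /=.
  by congr pair; rewrite -/q -/mom; apply/rowP => i; rewrite !mxE; ring.
have me : measurable_fun [set: T] (fun w =>
    (p' w, (1 + mom) *: ((p' w).2 : 'rV_d2) + (- mom) *: ((p w).2 : 'rV_d2)) : B * B2).
  apply: measurable_fun_pair => //; apply: measurable_lin.
    exact: (measurableT_comp measurable_snd mp').
  exact: (measurableT_comp measurable_snd mp).
by apply: eq_measurable_fun me => w _; rewrite e.
Qed.

Lemma measurable_stage_output (t : nat) (p0 : T -> B) (seed : nat -> T -> S) :
  measurable_fun [set: T] p0 -> (forall j, measurable_fun [set: T] (seed j)) ->
  measurable_fun [set: T]
    (fun w => stage_output F L mu tau M alpha tol t (p0 w) (seed^~ w) : B).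
Proof.
move=> mp0 ms.
have mi k : measurable_fun [set: T]
    (fun w => (inner F L mu tau M tol t (p0 w) (seed^~ w) k).1 : B).
  exact: (measurableT_comp measurable_fst (measurable_inner t mp0 (fun j _ => ms j))).
have mst (p : T -> B) : measurable_fun [set: T] p -> measurable_fun [set: T]
    (fun w => sqn2 (grad2 (stage_obj L (average F) (p0 w).1) (p w : E))).
  move=> mp; have := mgrad 0 (measurableT_comp measurable_fst mp0)
    (@measurable_cst _ _ T B2 setT (0 : 'rV[R]_d2)) mp.
  by apply: eq_measurable_fun => w _; rewrite (stage_objE (average F) L _ 0).
apply: (@measurable_first_index _ _ T _
  (fun k w => stage_stop F L mu tau M alpha tol t (p0 w) (seed^~ w) k)
  (fun k w => (inner F L mu tau M tol t (p0 w) (seed^~ w) k).1 : B)) => // k.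
rewrite /stage_stop; case: k => [|k].
  by rewrite [X in measurable X](_ : _ = set0)//; apply/seteqP; split => w // [].
rewrite [X in measurable X](_ : _ = setT `&` [set w |
  sqn2 (grad2 (stage_obj L (average F) (p0 w).1)
          (inner F L mu tau M tol t (p0 w) (seed^~ w) k.+1).1) <=
  alpha t * sqn2 (grad2 (stage_obj L (average F) (p0 w).1) (p0 w))]); last first.
  by apply/seteqP; split => w //= [].
exact: (measurable_fun_le measurableT (mst _ (mi k.+1))
  (measurable_funM (measurable_cst (alpha t)) (mst _ mp0))).
Qed.

Lemma measurable_outer (p0 : E) (seed : nat -> nat -> T -> S) t :
  (forall s j, (s < t)%N -> measurable_fun [set: T] (seed s j)) ->
  measurable_fun [set: T]
    (fun w => outer F L mu tau M alpha tol p0 (fun s j => seed s j w) t : B).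
Proof.
elim: t => [|t IH] ms; first exact: measurable_cst.
have mo := IH (fun s j st => ms s j (ltnW st)).
exact: (measurable_stage_output t mo (fun j => ms t j (ltnSn t))).
Qed.

End AlgorithmMeasurable.

(** * Conditioning on the past *)

Section Past.
Context (R : realType) (I : choiceType) (dO dS : measure_display).
Context (Omega : measurableType dO) (S : measurableType dS).
Context (P : probability Omega R) (Q : probability S R) (xi : I -> Omega -> S).
Hypothesis hxi : iid P Q xi.
Context (j : I).

(** Events determined by finitely many of the variables other than [xi j]. *)
Definition other_cylinders : set (set Omega) :=
  [set A | exists (J : seq I) (B : I -> set S),
    [/\ uniq J, j \notin J, (forall i, measurable (B i)) &
      A = \bigcap_(i in [set` J]) (xi i @^-1` B i)]].

Lemma other_cylinders_setI : setI_closed other_cylinders.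
Proof.
move=> _ _ [J1 [B1 [u1 j1 m1 ->]]] [J2 [B2 [u2 j2 m2 ->]]].
exists (undup (J1 ++ J2)), (fun i => (if i \in J1 then B1 i else setT) `&`
  (if i \in J2 then B2 i else setT)); split.
- exact: undup_uniq.
- by rewrite mem_undup mem_cat negb_or j1.
- by move=> i; apply: measurableI; case: ifP.
- apply/seteqP; split => w /=.
    move=> [h1 h2] i /=; rewrite mem_undup mem_cat => _; split => /=.
      by case: ifP => // iJ; exact: h1.
    by case: ifP => // iJ; exact: h2.
  move=> h; split => i /= iJ.
    by have := h i; rewrite /= mem_undup mem_cat iJ => /(_ isT) [].
  by have := h i; rewrite /= mem_undup mem_cat iJ orbT => /(_ isT) [].
Qed.

Lemma other_cylinders_measurable A : other_cylinders A -> measurable A.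
Proof.
move=> [J [B [_ _ mB ->]]]; rewrite bigcap_seq; apply: bigsetI_measurable => i _.
by rewrite -[X in measurable X]setTI; exact: hxi.1.
Qed.

Lemma other_cylinders_setT : other_cylinders setT.
Proof.
exists [::], (fun=> setT); split => //.
by apply/seteqP; split => // w _ i.
Qed.

(** The sample space carrying the information of all variables but [xi j]. *)
Definition past := g_sigma_algebraType other_cylinders.

Lemma past_measurable (A : set past) : measurable A -> measurable (A : set Omega).
Proof.
apply: smallest_sub; first exact: sigma_algebra_measurable.
exact: other_cylinders_measurable.
Qed.

Lemma measurable_past_xi i : i != j ->
  measurable_fun [set: past] (xi i : past -> S).
Proof.
move=> ij _ B mB; rewrite setTI; apply: sub_sigma_algebra.
exists [:: i], (fun=> B); split => //; first by rewrite inE eq_sym.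
apply/seteqP; split => [w Bw k /=|w /(_ i)]; last by apply; rewrite /= inE.
by rewrite inE => /eqP ->.
Qed.

(** Two finite measures that agree on the cylinders agree everywhere. *)
Lemma past_independent (A : set Omega) (D : set S) :
  <<s other_cylinders >> A -> measurable D ->
  P (A `&` xi j @^-1` D) = (P A * Q D)%E.
Proof.
move=> sA mD.
have mxD : measurable (xi j @^-1` D) by rewrite -[X in measurable X]setTI; exact: hxi.1.
have QD : (Q D = (fine (Q D))%:E) by rewrite fineK// fin_num_measure.
have q0 : 0 <= fine (Q D) by rewrite fine_ge0.
rewrite muleC QD -[LHS]/(mrestr P mxD A) -[RHS]/(mscale (NngNum q0) P A).
apply: (g_sigma_algebra_measure_unique other_cylinders _ (fun=> setT)) => //.
- exact: other_cylinders_measurable.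
- by move=> _; exact: other_cylinders_setT.
- by apply/seteqP; split => // w _; exists 0%N.
- exact: other_cylinders_setI.
- move=> _ [J [B [uJ jJ mB ->]]]; set A0 := \bigcap_(i in _) _.
  suff : P (A0 `&` xi j @^-1` D) = ((fine (Q D))%:E * P A0)%E by [].
  rewrite {2}/A0 (hxi.2 J B uJ mB).
  pose B' i := if i == j then D else B i.
  have hB' i : i \in J -> B' i = B i.
    by move=> iJ; rewrite /B'; case: eqP => // ij; move: jJ; rewrite -ij iJ.
  have := hxi.2 (j :: J) B'; rewrite /= jJ uJ => /(_ isT) h.
  rewrite [X in P X = _](_ : _ = \bigcap_(i in [set` j :: J]) (xi i @^-1` B' i)).
    rewrite h; last by move=> i; rewrite /B'; case: ifP.
    rewrite big_cons {1}/B' eqxx EFinM; congr (_ * _%:E)%E.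
    by rewrite big_seq [RHS]big_seq; apply: eq_bigr => i iJ; rewrite hB'.
  apply/seteqP; split => w /=.
    move=> [hw Dw] i /=; rewrite inE => /predU1P[->|iJ]; first by rewrite /B' eqxx.
    by rewrite hB'//; exact: hw.
  move=> hw; split.
    by move=> i iJ /=; have := hw i; rewrite /= inE iJ orbT hB'//; exact.
  by have := hw j; rewrite /= inE eqxx /B' eqxx; exact.
- move=> _; suff : (P (setT `&` xi j @^-1` D) < +oo)%E by [].
  by rewrite setTI (le_lt_trans (probability_le1 P mxD))// ltry.
Qed.

Let past_id : Omega -> past := id.
Let past_pair : Omega -> (past * S)%type := fun w => (w, xi j w).

Let measurable_past_id : measurable_fun [set: Omega] past_id.
Proof. by move=> _ A mA; rewrite setTI; exact: past_measurable. Qed.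

Let measurable_past_pair : measurable_fun [set: Omega] past_pair.
Proof. by apply: measurable_fun_pair; [exact: measurable_past_id|exact: hxi.1]. Qed.

HB.instance Definition _ := isMeasurableFun.Build _ _ _ _ past_id measurable_past_id.
HB.instance Definition _ := isMeasurableFun.Build _ _ _ _ past_pair measurable_past_pair.

(** Conditioning on the past: [xi j] may be replaced by an independent copy. *)
Lemma past_fubini (X : set (past * S)) : measurable X ->
  P [set w | X (w : past, xi j w)] =
  (\int[distribution P past_id]_w Q (xsection X w))%E.
Proof.
move=> mX; rewrite -[LHS]/(distribution P past_pair X).
rewrite -[RHS]/((distribution P past_id \x Q)%E X); apply/esym.
apply: product_measure_unique => // A D mA mD.
by rewrite /distribution /pushforward -past_independent.
Qed.

(** A bound on the conditional probabilities is a bound on the probability.  The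
    null set need not belong to the past, since the set where the bound fails
    does. *)
Lemma past_bound (X : set (past * S)) (b : R) (N : set Omega) :
  measurable X -> 0 <= b -> P.-negligible N ->
  (forall w, ~ N w -> (Q (xsection X w) <= b%:E)%E) ->
  (P [set w | X (w : past, xi j w)] <= b%:E)%E.
Proof.
move=> mX b0 nN hb; rewrite past_fubini//.
have mq : measurable_fun [set: past] (fun w => Q (xsection X w)).
  exact: measurable_fun_xsection.
apply: (@le_trans _ _ (\int[distribution P past_id]_w (b%:E : \bar R))%E).
  apply: ae_ge0_le_integral => //.
  pose C := [set w : past | ~ (Q (xsection X w) <= b%:E)%E].
  have mC : measurable C.
    rewrite /C [X in measurable X](_ : _ =
        [set: past] `&` [set w | (b%:E < Q (xsection X w))%E]).
      by apply: emeasurable_fun_lt.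
    apply/seteqP; split => w /=; rewrite ltNge; last by move=> [_ /negP].
    by move=> h; split => //; exact/negP.
  have CN : (C : set Omega) `<=` N by move=> w Cw; apply: contrapT => /hb.
  exists C; split => //; last by move=> w /= h h'; apply: h.
  exact: measure_negligible (past_measurable mC) (negligibleS CN nN).
rewrite integral_cst// [X in (_ * X)%E](_ : _ = 1%E) ?mule1//.
exact: (probability_setT (distribution P past_id)).
Qed.

End Past.

(** * Survival sums, Markov's inequality and monotone bounds of integrals *)

Section Bounds.
Context (R : realType).

Lemma nneseries_le (u : nat -> \bar R) (c : \bar R) :
  (forall N, 0 <= u N)%E -> (forall n, \sum_(0 <= N < n) u N <= c)%E ->
  (\sum_(0 <= N <oo) u N <= c)%E.
Proof.
move=> u0 h; apply: lime_le; first by apply: is_cvg_nneseries => N _ _; exact: u0.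
by apply: nearW => n; exact: h.
Qed.

(** Waiting time of a process whose survival probability decays at rate
    [1 - Lam^-1] from a possibly large constant [B]: about [Lam * ln B] steps
    are lost before the decay bites. *)
Lemma sum_survival_le (u : nat -> \bar R) (B Lam : R) :
  1 <= B -> 1 <= Lam ->
  (forall N, 0 <= u N)%E -> (forall N, u N <= 1)%E ->
  (forall N, u N <= (B * (1 - Lam^-1) ^+ N)%:E)%E ->
  (\sum_(0 <= N <oo) u N <= (Lam * (ln B + 2))%:E)%E.
Proof.
move=> B1 Lam1 u0 u1 uB.
have Lam0 : 0 < Lam := lt_le_trans ltr01 Lam1.
have lB : 0 <= ln B by exact: ln_ge0.
set th := 1 - Lam^-1.
have th0 : 0 <= th by rewrite subr_ge0 invf_le1.
have th1 : th <= 1 by rewrite gerBl invr_ge0 ltW.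
(* from step [N0] on, the survival bound is below one *)
pose N0 := (Num.truncn (Lam * ln B)).+1.
have LB0 : 0 <= Lam * ln B by rewrite mulr_ge0// ltW.
have N0ge : Lam * ln B <= N0%:R by rewrite ltW// truncnS_gt.
have N0le : N0%:R <= Lam * ln B + 1 by rewrite /N0 -natr1 lerD2r truncn_le.
have hN0 : B * th ^+ N0 <= 1.
  have hth : th <= expR (- Lam^-1) by exact: expR_ge1Dx.
  have : th ^+ N0 <= expR (- Lam^-1) ^+ N0 by rewrite lerXn2r ?nnegrE ?expR_ge0.
  rewrite -expRM_natl => h.
  have B0 : 0 < B by exact: lt_le_trans B1.
  rewrite -ler_pdivlMl// mulr1; apply: (le_trans h).
  rewrite -[in leRHS](lnK B0) -expRN ler_expR mulrN lerN2.
  by rewrite ler_pdivlMr// mulrC.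
have part k : (\sum_(0 <= N < k) u N <= k%:R%:E)%E.
  elim: k => [|k IHk]; first by rewrite big_nil.
  by rewrite big_nat_recr//= -natr1 EFinD leeD.
have bound m : (\sum_(0 <= N < N0 + m) u N <= (N0%:R + Lam * (1 - th ^+ m))%:E)%E.
  elim: m => [|m IH].
    by rewrite addn0 expr0 subrr mulr0 addr0.
  rewrite addnS big_nat_recr//=.
  have -> : N0%:R + Lam * (1 - th ^+ m.+1) = (N0%:R + Lam * (1 - th ^+ m)) + th ^+ m.
    by rewrite exprS /th; field; rewrite gt_eqF.
  rewrite EFinD leeD//; apply: (le_trans (uB _)); rewrite lee_fin.
  rewrite exprD mulrA -[leRHS]mul1r ler_wpM2r// exprn_ge0//.
apply: nneseries_le => // n.
apply: (@le_trans _ _ (\sum_(0 <= N < N0 + n) u N)%E).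
  by rewrite addnC (big_cat_nat (leq0n n) (leq_addr N0 n))/= leeDl// sume_ge0.
apply: (le_trans (bound n)); rewrite lee_fin mulrDr.
have tn : 0 <= th ^+ n by rewrite exprn_ge0.
have : Lam * (1 - th ^+ n) <= Lam by rewrite ler_piMr ?(ltW Lam0)// gerBl.
by move: N0le Lam1; lra.
Qed.

Lemma hitting_time_le (A : nat -> Prop) :
  (hitting_time R A <= \sum_(0 <= N <oo) (`[< ~ A N >] : nat)%:R%:E)%E.
Proof.
rewrite /hitting_time; case: asboolP => [exA|nA].
  have [_ h] := first_indexP exA.
  apply: (@le_trans _ _ (\sum_(0 <= N < first_index A) (`[< ~ A N >] : nat)%:R%:E)%E).
    rewrite sumEFin lee_fin; apply: (@le_trans _ _ (\sum_(0 <= N < first_index A) 1)).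
      by rewrite sumr_const_nat subn0.
    by apply: ler_sum_nat => N /andP[_ hN]; rewrite asboolT//; exact: h.
  by apply: nneseries_lim_ge => N _ _; rewrite lee_fin.
rewrite leye_eq; apply/eqP/eqyP => b b0.
apply: (@le_trans _ _ (\sum_(0 <= N < (Num.truncn b).+1) (`[< ~ A N >] : nat)%:R%:E)%E).
  rewrite sumEFin lee_fin (eq_bigr (fun=> 1)).
    by rewrite sumr_const_nat subn0 ltW// truncnS_gt.
  by move=> N _; rewrite asboolT// => AN; apply: nA; exists N.
by apply: nneseries_lim_ge => N _ _; rewrite lee_fin.
Qed.

Context (d : measure_display) (T : measurableType d) (P : probability T R).

(** With a strict inequality in the event, Markov's inequality holds at level
    zero as well; there it says that a nonnegative function of mean zero vanishes
    almost surely. *)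
Lemma markov_strict (h : T -> R) (b c : R) :
  measurable_fun [set: T] h -> (forall w, 0 <= h w) -> 0 <= b -> 0 <= c ->
  ('E_P[h] <= (b * c)%:E)%E -> (P [set w | (c < h w)%R] <= b%:E)%E.
Proof.
move=> mh h0 b0 c0; rewrite unlock => hE.
set A := [set w | _].
have mA : measurable A.
  rewrite /A [X in measurable X](_ : _ = ~` (setT `&` [set w | (h w <= cst c w)%R])).
    by apply: measurableC; apply: measurable_fun_le.
  by rewrite setTI; apply/seteqP; split => w /=; rewrite ltNge => /negP.
have mEh : measurable_fun [set: T] (EFin \o h) by exact/measurable_EFinP.
have [c_eq0|cpos] := eqVneq c 0.
  have int0 : (\int[P]_w `|(EFin \o h) w| = 0)%E.
    apply/eqP; rewrite eq_le integral_ge0 ?andbT//.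
    have -> : (\int[P]_w `|(EFin \o h) w| = \int[P]_w (h w)%:E)%E.
      by apply: eq_integral => w _; rewrite /= ger0_norm.
    by apply: (le_trans hE); rewrite c_eq0 mulr0.
  have [N [mN N0 sub]] := (ae_eq_integral_abs P measurableT mEh).1 int0.
  suff -> : P A = 0%E by rewrite lee_fin.
  apply: measure_negligible => //; exists N; split => // w Aw; apply: sub => /= /(_ I) [].
  by move=> e; move: Aw; rewrite /A /= c_eq0 e ltxx.
have {}cpos : 0 < c by rewrite lt_neqAle eq_sym cpos.
have : (c%:E * P A <= (b * c)%:E)%E.
  apply: le_trans hE.
  rewrite -[X in P X]setIT -(integral_indic P measurableT mA) -ge0_integralZl_EFin//.
  - apply: ge0_le_integral => //.
    + by move=> w _; rewrite lee_fin mulr_ge0.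
    + by apply/measurable_EFinP; apply: measurable_funM => //; exact: measurable_indic.
    + move=> w _; rewrite lee_fin indicE; case: (boolP (w \in A)) => [|_].
        by rewrite inE /A /= mulr1 => /ltW.
      by rewrite mulr0.
  - by apply/measurable_EFinP; exact: measurable_indic.
have fP : P A \is a fin_num by rewrite fin_num_measure.
by rewrite -(fineK fP) -EFinM !lee_fin mulrC ler_pM2r.
Qed.

(** The integral of a nonnegative function is a supremum over simple functions
    below it, hence monotone without measurability of the smaller function. *)
Lemma nnintegral_le_ae (f g : T -> \bar R) (N : set T) :
  (forall w, 0 <= f w)%E -> (forall w, 0 <= g w)%E ->
  measurable_fun [set: T] g -> P.-negligible N ->
  (forall w, ~ N w -> f w <= g w)%E ->
  (\int[P]_w f w <= \int[P]_w g w)%E.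
Proof.
move=> f0 g0 mg [N' [mN' PN' NN']] fg.
pose g' w := if w \in N' then +oo%E else g w.
have g'0 w : (0 <= g' w)%E by rewrite /g'; case: ifP.
have mg' : measurable_fun [set: T] g'.
  apply: measurable_fun_ifT => //.
  apply: (measurable_fun_bool true).
  have -> : (fun w => w \in N') @^-1` [set true] = N'.
    by apply/seteqP; split => w /=; [move/set_mem|move/mem_set].
  exact: measurableI.
apply: (@le_trans _ _ (\int[P]_w g' w)%E).
  rewrite !ge0_integralTE//; apply: ereal_sup_le => _ [h hf <-].
  exists h => // w; apply: (le_trans (hf w)).
  rewrite /g'; case: (boolP (w \in N')) => [_|]; first exact: leey.
  by rewrite notin_setE => nw; apply: fg => /NN'.
rewrite (ge0_ae_eq_integral (g := g))//.
exists N'; split => // w /= hw; apply: contrapT => nw; apply: hw => _.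
by rewrite /g' memNset.
Qed.

End Bounds.

(** * Waiting times driven by fresh randomness *)

Section Waiting.
Context (R : realType) (I : choiceType) (dO dS : measure_display).
Context (Omega : measurableType dO) (S : measurableType dS).
Context (P : probability Omega R) (Q : probability S R) (xi : I -> Omega -> S).
Hypothesis hxi : iid P Q xi.
Context (j : I) (Lam : R) (X : nat -> set (past xi j * S)).
Hypothesis Lam1 : 1 <= Lam.
Hypothesis mX : forall N, measurable (X N).

Let th0 : 0 <= 1 - Lam^-1.
Proof. by rewrite subr_ge0 invf_le1// (lt_le_trans ltr01). Qed.

Let measurable_event (Y : set (past xi j * S)) : measurable Y ->
  measurable [set w : Omega | Y (w : past xi j, xi j w)].
Proof.
move=> mY.
have mpair : measurable_fun [set: Omega] (fun w : Omega => ((w : past xi j), xi j w)).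
  apply: measurable_fun_pair; last exact: hxi.1.
  by move=> _ A mA; rewrite setTI; exact: (past_measurable hxi mA).
by rewrite -[X in measurable X]setTI; exact: mpair.
Qed.

Lemma eventually_stops :
  (forall w, exists b : R, forall N,
     (Q (xsection (X N) w) <= (b * (1 - Lam^-1) ^+ N)%:E)%E) ->
  P.-negligible [set w | forall N, X N (w : past xi j, xi j w)].
Proof.
move=> hb; pose Xoo := \bigcap_N X N.
have mXoo : measurable Xoo by exact: bigcapT_measurable.
exists [set w : Omega | Xoo (w : past xi j, xi j w)]; split.
- exact: measurable_event.
- apply/eqP; rewrite eq_le measure_ge0 andbT.
  apply: (past_bound hxi mXoo (lexx 0) (negligible_set0 P)) => w _.
  have [b hbw] := hb w.
  have Qle N : (Q (xsection Xoo w) <= (b * (1 - Lam^-1) ^+ N)%:E)%E.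
    apply: le_trans (hbw N); apply: le_measure.
    + by rewrite inE; exact: measurable_xsection.
    + by rewrite inE; exact: measurable_xsection.
    + by move=> s; rewrite /xsection /= !inE => /(_ N Logic.I).
  have fQ : Q (xsection Xoo w) \is a fin_num.
    by rewrite fin_num_measure//; exact: measurable_xsection.
  rewrite -(fineK fQ) lee_fin leNgt; apply/negP => Q0.
  have cv : (fun N => b * (1 - Lam^-1) ^+ N) @ \oo --> b * 0.
    apply: cvgMr; apply: cvg_expr.
    by rewrite ger0_norm// gtrBl invr_gt0 (lt_le_trans ltr01).
  rewrite mulr0 in cv; have /cvgrPdist_lt /(_ _ Q0) [N _ /(_ N (leqnn N))] := cv.
  rewrite sub0r normrN => h; have := Qle N; rewrite -(fineK fQ) lee_fin.
  by apply/negP; rewrite -ltNge; apply: le_lt_trans h; exact: ler_norm.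
- by move=> w h N _; exact: h.
Qed.

(** The number of steps at which [X] still holds: a measurable majorant of the
    first step at which it fails. *)
Definition waiting (w : Omega) : \bar R :=
  (\sum_(0 <= N <oo) (`[< X N (w : past xi j, xi j w) >] : nat)%:R%:E)%E.

Lemma waiting_ge0 w : (0 <= waiting w)%E.
Proof. by apply: nneseries_ge0 => N _ _; rewrite lee_fin. Qed.

Let indicE' N w : (`[< X N (w : past xi j, xi j w) >] : nat)%:R =
  \1_[set w : Omega | X N (w : past xi j, xi j w)] w :> R.
Proof. by rewrite indicE; congr (nat_of_bool _)%:R. Qed.

Let mindic N : measurable_fun [set: Omega]
  (fun w => (`[< X N (w : past xi j, xi j w) >] : nat)%:R%:E : \bar R).
Proof.
apply/measurable_EFinP; rewrite (funext (indicE' N)).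
exact: measurable_indic (measurable_event (mX N)).
Qed.

Lemma measurable_waiting : measurable_fun [set: Omega] waiting.
Proof.
apply: ge0_emeasurable_sum => [N w _ _|N _]; first by rewrite lee_fin.
exact: mindic.
Qed.

Lemma expected_waiting (B : R) (Nul : set Omega) : 1 <= B -> P.-negligible Nul ->
  (forall w, ~ Nul w -> forall N,
     (Q (xsection (X N) w) <= (B * (1 - Lam^-1) ^+ N)%:E)%E) ->
  (\int[P]_w waiting w <= (Lam * (ln B + 2))%:E)%E.
Proof.
move=> B1 nN hB.
have iP N : (\int[P]_w (`[< X N (w : past xi j, xi j w) >] : nat)%:R%:E =
    P [set w : Omega | X N (w : past xi j, xi j w)])%E.
  under eq_integral do rewrite indicE'.
  by rewrite integral_indic ?setIT//; exact: measurable_event.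
rewrite integral_nneseries//.
apply: sum_survival_le => // N.
- by apply: integral_ge0 => w _; rewrite lee_fin.
- by rewrite iP; apply: probability_le1; exact: measurable_event.
- rewrite iP; apply: (past_bound hxi (mX N) _ nN) => [|w /hB]; last exact.
  by rewrite mulr_ge0 ?exprn_ge0// (le_trans ler01).
Qed.

End Waiting.

(** * One stage of the algorithm *)

Section CatalystStage.
Context (R : realType) (n d1 d2 : nat).
Local Notation E := ('rV[R]_d1 * 'rV[R]_d2)%type.
Local Notation B1 := (borel R d1).
Local Notation B2 := (borel R d2).
Local Notation B := (borel R d1 * borel R d2)%type.
Context (F : 'I_n -> 'rV[R]_d1 -> 'rV[R]_d2 -> R) (L mu tau : R).
Hypotheses (n0 : (0 < n)%N) (L0 : 0 < L) (mu0 : 0 < mu).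
Hypothesis sm : averaged_smooth L F.
Hypothesis sc : forall x, strongly_concave mu (average F x).
Hypotheses (tau0 : 0 <= tau) (mtL : mu + tau <= L).
Context (dS : measure_display) (S : measurableType dS) (Q : probability S R).
Context (M : solver R n d1 d2 S) (Lam : R).
Hypothesis Lam1 : 1 <= Lam.
Hypothesis hM : linearly_convergent F L tau Lam Q M.

Local Notation f := (average F).
Local Notation tol := (inner_tol F L mu tau).
Local Notation alpha := (stage_tol L mu).
Local Notation kappa := (L / mu).
Local Notation rho := (9 / 10 * Num.sqrt (mu / (mu + tau))).

Let muL : mu <= L. Proof. by apply: le_trans mtL; rewrite lerDl. Qed.
Let tauL : tau <= L. Proof. by apply: le_trans mtL; rewrite lerDr ltW. Qed.
Let mt0 : 0 < mu + tau. Proof. by rewrite ltr_wpDr. Qed.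
Let L40 : 0 < 4 * L. Proof. by rewrite mulr_gt0. Qed.

Let sfs (c : 'rV[R]_d1) (z : 'rV[R]_d2) : saddle_field L (mu + tau) (4 * L)
  (sub_obj L tau f c z) (grad2 (sub_obj L tau f c z)).
Proof. exact: saddle_field_sub. Qed.

Let sfst (c : 'rV[R]_d1) : saddle_field L mu (4 * L)
  (stage_obj L f c) (grad2 (stage_obj L f c)).
Proof.
rewrite (stage_objE (average F) L c 0) -[X in saddle_field _ X]addr0.
by apply: saddle_field_sub => //; exact: ltW.
Qed.

Lemma sub_stage_grad c z p : grad2 (sub_obj L tau f c z) p =
  grad2 (stage_obj L f c) p - (0, tau *: (p.2 - z)).
Proof.
rewrite (stage_objE (average F) L c 0) !(grad2_sub_obj sm) /sub_grad scale0r oppr0 -addrA.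
by congr (_ + _); congr pair => /=; rewrite ?subr0 ?sub0r ?addr0.
Qed.

Lemma stage_gap_ge0 (p : E) : 0 <= gap (stage_obj L f p.1) p.
Proof.
have [r hr] := saddle_zero (sfst p.1) L0 mu0 L40.
have hr' : grad2 (stage_obj L f p.1) (r.1, r.2) = 0 by rewrite -surjective_pairing.
apply: le_trans (gap_ge (sfst p.1) L0 mu0 L40 hr' p).
by rewrite addr_ge0// mulr_ge0 ?sqn_ge0// divr_ge0// ltW.
Qed.

Let rho_bound : 0 < rho <= 9 / 10.
Proof.
have h : 0 < mu / (mu + tau) <= 1.
  by rewrite divr_gt0//= ler_pdivrMr// mul1r lerDl.
have /andP[h0 h1] := h.
rewrite mulr_gt0 ?sqrtr_gt0//= -[leRHS]mulr1 ler_wpM2l//.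
by rewrite -(sqrtr1 R) ler_sqrt.
Qed.

Let sqrt2 : 1 <= Num.sqrt (2 : R) <= 2.
Proof.
rewrite -{1}(sqrtr1 R) ler_sqrt// ler1n /=.
by rewrite -(@ler_pXn2r _ 2)// ?nnegrE ?sqrtr_ge0// sqr_sqrtr// -natrX ler_nat.
Qed.

Lemma tol_le t (p : E) k :
  tol t p k <= mu * (1 - rho) ^+ k * gap (stage_obj L f p.1) p.
Proof.
rewrite /inner_tol; have /andP[_ s2] := sqrt2; have /andP[r0 r1] := rho_bound.
rewrite ler_wpM2r ?stage_gap_ge0// ler_wpM2r//.
  by rewrite exprn_ge0//; lra.
by rewrite ler_pdivrMr// mulrC ler_wpM2l// ltW.
Qed.

Lemma tol_ge t (p : E) k :
  mu * (1 - rho) ^+ k * gap (stage_obj L f p.1) p <= 2 * tol t p k.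
Proof.
rewrite /inner_tol; have /andP[s1 _] := sqrt2; have /andP[r0 r1] := rho_bound.
rewrite !mulrA ler_wpM2r ?stage_gap_ge0// ler_wpM2r//.
  by rewrite exprn_ge0//; lra.
by rewrite -!mulrA [_ / 2]mulrC [Num.sqrt 2 * _]mulrCA !mulrA divff// mul1r ler_peMl// ltW.
Qed.

Lemma tol_ge0 t (p : E) k : 0 <= tol t p k.
Proof.
have /andP[r0 r1] := rho_bound.
have : 0 <= 2 * tol t p k.
  apply: le_trans (tol_ge t p k).
  by rewrite mulr_ge0 ?stage_gap_ge0// mulr_ge0 ?(ltW mu0)// exprn_ge0//; lra.
by lra.
Qed.

Lemma measurable_sqn_grad_sub (dT : measure_display) (T : measurableType dT)
  (s : R) (c : T -> B1) (z : T -> B2) (p : T -> B) :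
  measurable_fun [set: T] c -> measurable_fun [set: T] z ->
  measurable_fun [set: T] p ->
  measurable_fun [set: T]
    (fun w => sqn2 (grad2 (sub_obj L s f (c w) (z w)) (p w : E))).
Proof.
move=> mc mz mp.
have := measurable_sub_grad (saddle_field_average n0 L0 sm sc)
  (fun s c z p => grad2_sub_obj sm s c z p)
  (measurableT_comp measurable_fst mp) (measurableT_comp measurable_snd mp) mc mz s.
by apply: eq_measurable_fun => w _ /=; case: (p w).
Qed.

Lemma measurable_inner_tol (dT : measure_display) (T : measurableType dT)
  (t k : nat) (p : T -> B) : measurable_fun [set: T] p ->
  measurable_fun [set: T] (fun w => tol t (p w : E) k).
Proof.
move=> mp; apply: measurable_funM => //.
have cf : continuous (joint f).
  move=> u; apply: differentiable_continuous.
  by apply: differentiable_average => i; exact: sm.1.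
have := measurable_gap L0 mu0 muL (saddle_field_average n0 L0 sm sc) cf
  (fun s c z p => grad2_sub_obj sm s c z p)
  (fun s c z => saddle_field_sub n0 L0 sm sc c z)
  (measurableT_comp measurable_fst mp) (measurableT_comp measurable_snd mp).
by apply: eq_measurable_fun => w _ /=; case: (p w).
Qed.

Section OneStage.
Context (t : nat) (p0 : E) (seed : nat -> S).
Local Notation run k := (inner F L mu tau M tol t p0 seed k).

Lemma innerS k : run k.+1 =
  (let p' := sub_run F L tau M p0 seed (run k).1 (run k).2 k.+1
     (first_index (sub_solved F L tau M tol t p0 seed (run k).1 (run k).2 k.+1)) in
   let q := mu / (mu + tau) in
   (p', p'.2 + ((Num.sqrt q - q) / (Num.sqrt q + q)) *: (p'.2 - (run k).1.2))).
Proof. by rewrite /=; case: (run k). Qed.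

Let saddle_of (z : 'rV[R]_d2) :=
  @saddle_zero R d1 d2 L (mu + tau) (4 * L) _ _ (sfs p0.1 z) L0 mt0 L40.

(** A stage that starts at the saddle point of its objective has zero
    tolerances, and stays where it is. *)
Lemma inner_stationary k : gap (stage_obj L f p0.1) p0 = 0 ->
  run k = (p0, p0.2) /\ grad2 (sub_obj L tau f p0.1 p0.2) p0 = 0.
Proof.
move=> g0.
have Gp0 : grad2 (stage_obj L f p0.1) p0 = 0.
  have [r hr] := saddle_zero (sfst p0.1) L0 mu0 L40.
  have hr' : grad2 (stage_obj L f p0.1) (r.1, r.2) = 0 by rewrite -surjective_pairing.
  have := gap_ge_sqn2 (sfst p0.1) L0 mu0 L40 hr' p0 mu0 muL (lexx _).
  rewrite g0 -surjective_pairing pmulr_rle0 ?divr_gt0// => h.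
  have /eqP : sqn2 (p0 - r) == 0 by rewrite eq_le h sqn2_ge0.
  move/eqP; rewrite sqn2_eq0 subr_eq0 => /eqP e.
  by rewrite [X in grad2 _ X]e.
have Gs : grad2 (sub_obj L tau f p0.1 p0.2) p0 = 0.
  by rewrite sub_stage_grad Gp0 subrr scaler0 subr0.
split=> //; elim: k => [//|k IH]; rewrite innerS IH /=.
have [M0 _ _] := hM.
have -> : first_index (sub_solved F L tau M tol t p0 seed p0 p0.2 k.+1) = 0%N.
  apply: first_index_eq => //; rewrite /sub_solved /sub_run M0 Gs sqn2_0.
  exact: tol_ge0.
by rewrite /sub_run M0 subrr scaler0 addr0.
Qed.

(** Markov's inequality for the solver: an unsolved subproblem is one whose
    iterate is still far from the saddle point. *)
Lemma unsolved_probability (p r : E) (z : 'rV[R]_d2) (k N : nat) (b : R) :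
  grad2 (sub_obj L tau f p0.1 z) r = 0 -> 0 <= b ->
  (4 * L) ^+ 2 * sqn2 (p - r) <= b * tol t p0 k ->
  (Q [set s | ~ sub_solved F L tau M tol t p0 (fun=> s) p z k N]
    <= (b * (1 - Lam^-1) ^+ N)%:E)%E.
Proof.
move=> Gr b0 hb; have [_ mM cM] := hM.
have rs : is_saddle (sub_obj L tau f p0.1 z) r.
  exact: (zero_is_saddle (sfs p0.1 z) (ltW L0) (ltW mt0) Gr).
pose X s : B := M (fun i => sub_obj L tau (F i) p0.1 z) p s N.
have mX : measurable_fun [set: S] X.
  have mc : measurable_fun [set: S] (fun s : S => (((p0.1, z), p), s) : B * B * S).
    by apply: measurable_fun_pair => //; exact: measurable_cst.
  exact: (measurableT_comp (mM N) mc).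
pose h s := (4 * L) ^+ 2 * sqn2 ((X s : E) - r).
have mh : measurable_fun [set: S] h.
  apply: measurable_funM => //; apply: measurable_funD; apply: measurable_sqn.
    have := @measurable_lin R dS S d1 1 (- 1) _ (fun=> r.1)
      (measurableT_comp measurable_fst mX) (measurable_cst _).
    by apply: eq_measurable_fun => s _ /=; rewrite scale1r scaleN1r.
  have := @measurable_lin R dS S d2 1 (- 1) _ (fun=> r.2)
    (measurableT_comp measurable_snd mX) (measurable_cst _).
  by apply: eq_measurable_fun => s _ /=; rewrite scale1r scaleN1r.
have h0 s : 0 <= h s by rewrite mulr_ge0 ?sqr_ge0 ?sqn2_ge0.
have th0 : 0 <= 1 - Lam^-1.
  by rewrite subr_ge0 invf_le1// (lt_le_trans ltr01).
have Eh : ('E_Q[h] <= (b * (1 - Lam^-1) ^+ N * tol t p0 k)%:E)%E.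
  have := cM _ _ p r rs N; rewrite !unlock => hE.
  rewrite (eq_integral (fun s => ((4 * L) ^+ 2)%:E * (sqn2 ((X s : E) - r))%:E)%E) => [|s _ //].
  rewrite ge0_integralZl_EFin//; last 3 first.
  - by move=> s _; rewrite lee_fin sqn2_ge0.
  - apply/measurable_EFinP.
    have e : (fun s => sqn2 ((X s : E) - r)) = (fun s => ((4 * L) ^+ 2)^-1 * h s).
      by apply/funext => s; rewrite /h mulKf// expf_neq0// gt_eqF.
    by rewrite e; apply: measurable_funM.
  - exact: sqr_ge0.
  apply: (@le_trans _ _ (((4 * L) ^+ 2)%:E * ((1 - Lam^-1) ^+ N * sqn2 (p - r))%:E)%E).
    by apply: lee_wpmul2l => //; rewrite lee_fin sqr_ge0.
  rewrite -EFinM lee_fin mulrCA [b * _]mulrC -[leRHS]mulrA ler_wpM2l//.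
  exact: exprn_ge0.
have mA : measurable [set s | (tol t p0 k < h s)%R].
  rewrite [X in measurable X](_ : _ = ~` (setT `&` [set s | (h s <= cst (tol t p0 k) s)%R])).
    by apply: measurableC; apply: measurable_fun_le.
  by rewrite setTI; apply/seteqP; split => w /=; rewrite ltNge => /negP.
have sub : [set s | ~ sub_solved F L tau M tol t p0 (fun=> s) p z k N] `<=`
    [set s | (tol t p0 k < h s)%R].
  move=> s /= /negP; rewrite -ltNge => hs; apply: (lt_le_trans hs).
  have [_ _ /(_ (X s) r)] := sfs p0.1 z.
  by rewrite Gr subr0.
apply: (@le_trans _ _ (Q [set s | (tol t p0 k < h s)%R])).
  apply: le_measure; rewrite ?inE//; apply: measurableC.
  exact: (measurable_sub_solved mM measurable_sqn_grad_sub measurable_inner_tol t N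
    (seed := fun _ s => s) (k := k)
    (measurable_cst (p0 : B)) (measurable_cst (p : B)) (measurable_cst (z : B2))).
apply: (markov_strict mh h0 _ (tol_ge0 t p0 k) Eh).
by rewrite mulr_ge0// exprn_ge0.
Qed.

(** Valid even if earlier subproblems were left unsolved; the constant is then
    not controlled, but it still shows that the subproblem is almost surely
    solved at some step. *)
Lemma unsolved_decay k : exists b : R, forall N,
  (Q [set s | ~ sub_solved F L tau M tol t p0 (fun=> s) (run k).1 (run k).2 k.+1 N]
    <= (b * (1 - Lam^-1) ^+ N)%:E)%E.
Proof.
have [g0|gN0] := eqVneq (gap (stage_obj L f p0.1) p0) 0.
  have [-> Gs] := inner_stationary k g0; exists 0 => N.
  apply: (@unsolved_probability _ _ _ _ N _ Gs) => //=.
  by rewrite subrr sqn2_0 mulr0 mul0r.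
have [r hr] := saddle_of (run k).2.
have tp : 0 < tol t p0 k.+1.
  have g0 : 0 < gap (stage_obj L f p0.1) p0 by rewrite lt_neqAle eq_sym gN0 stage_gap_ge0.
  have /andP[r0 r1] := rho_bound.
  have : 0 < 2 * tol t p0 k.+1.
    apply: lt_le_trans (tol_ge t p0 k.+1).
    by rewrite mulr_gt0// mulr_gt0// exprn_gt0//; lra.
  by lra.
exists ((4 * L) ^+ 2 * sqn2 ((run k).1 - r) / tol t p0 k.+1) => N.
apply: (@unsolved_probability _ _ _ _ N _ hr).
  by rewrite divr_ge0 ?(ltW tp)// mulr_ge0 ?sqr_ge0 ?sqn2_ge0.
by rewrite divfK// gt_eqF.
Qed.

Hypothesis solved : forall k, exists N,
  sub_solved F L tau M tol t p0 seed (run k).1 (run k).2 k.+1 N.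

Let p k := (run k).1.
Let z k := (run k).2.
Let zS k : z k.+1 = (p k.+1).2 +
  ((Num.sqrt (mu / (mu + tau)) - mu / (mu + tau)) /
   (Num.sqrt (mu / (mu + tau)) + mu / (mu + tau))) *: ((p k.+1).2 - (p k).2).
Proof. by rewrite /z /p innerS. Qed.

Let res_le k :
  sqn2 (grad2 (stage_obj L f p0.1) (p k.+1) - (0, tau *: ((p k.+1).2 - z k))) <=
    mu * (1 - rho) ^+ k.+1 * gap (stage_obj L f p0.1) (p 0%N).
Proof.
rewrite -sub_stage_grad; apply: le_trans (tol_le t p0 k.+1).
have [h _] := first_indexP (solved k).
by rewrite /p innerS; exact: h.
Qed.

(** When all subproblems are solvable, the constant is the one of the warm
    start. *)
Lemma unsolved_decay_uniform k N :
  (Q [set s | ~ sub_solved F L tau M tol t p0 (fun=> s) (run k).1 (run k).2 k.+1 N]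
    <= (2 * 10 ^+ 9 * kappa ^+ 5 * (1 - Lam^-1) ^+ N)%:E)%E.
Proof.
have [r hr] := saddle_of (z k).
have k0 : 0 <= 10 ^+ 9 * kappa ^+ 5.
  by apply: mulr_ge0; rewrite exprn_ge0// divr_ge0// ltW.
apply: (@unsolved_probability _ _ _ _ N _ hr); first by rewrite -mulrA mulr_ge0.
have hr' : grad2 (stage_obj L f p0.1) r - (0, tau *: (r.2 - z k)) = 0.
  by rewrite -sub_stage_grad.
have sfk : saddle_field L (mu + tau) (4 * L)
    (fun x y => stage_obj L f p0.1 x y - tau / 2 * sqn (y - z k))
    (fun q => grad2 (stage_obj L f p0.1) q - (0, tau *: (q.2 - z k))).
  by rewrite -(funext (sub_stage_grad p0.1 (z k))); exact: sfs.
have := warm_start mu0 tau0 mtL (sfst p0.1) erefl zS res_le hr' sfk.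
move=> /le_trans; apply.
apply: (le_trans (ler_wpM2l k0 (tol_ge t p0 k.+1))).
by rewrite mulrCA !mulrA.
Qed.

Lemma stage_stops_at k : (0 < k)%N ->
  10 ^+ 5 * kappa ^+ 3 * (1 - rho) ^+ k <= alpha t ->
  stage_stop F L mu tau M alpha tol t p0 seed k.
Proof.
move=> k0 hk; split => //.
apply: (le_trans (stage_decay mu0 tau0 mtL (sfst p0.1) erefl zS res_le k)).
by rewrite ler_wpM2r ?sqn2_ge0.
Qed.

End OneStage.
End CatalystStage.

(** * Expected cost and output of a random run *)

Section RandomRun.
Context (R : realType) (n d1 d2 : nat).
Local Notation E := ('rV[R]_d1 * 'rV[R]_d2)%type.
Local Notation B := (borel R d1 * borel R d2)%type.
Context (F : 'I_n -> 'rV[R]_d1 -> 'rV[R]_d2 -> R) (L mu tau : R).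
Hypotheses (n0 : (0 < n)%N) (L0 : 0 < L) (mu0 : 0 < mu).
Hypothesis sm : averaged_smooth L F.
Hypothesis sc : forall x, strongly_concave mu (average F x).
Hypotheses (tau0 : 0 <= tau) (mtL : mu + tau <= L).
Context (dS : measure_display) (S : measurableType dS) (Q : probability S R).
Context (M : solver R n d1 d2 S) (Lam : R).
Hypothesis Lam1 : 1 <= Lam.
Hypothesis hM : linearly_convergent F L tau Lam Q M.
Context (dO : measure_display) (Omega : measurableType dO).
Context (P : probability Omega R) (xi : nat * nat -> Omega -> S).
Hypothesis hxi : iid P Q xi.
Context (p0 : E).

Local Notation f := (average F).
Local Notation tol := (inner_tol F L mu tau).
Local Notation alpha := (stage_tol L mu).
Local Notation kappa := (L / mu).
Local Notation rho := (9 / 10 * Num.sqrt (mu / (mu + tau))).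
Local Notation seed w := (fun t k => xi (t, k) w).
Local Notation start w t := (outer F L mu tau M alpha tol p0 (seed w) t).
Local Notation state w t k :=
  (inner F L mu tau M tol t (start w t) (fun i => xi (t, i) w) k).

Let mM := let: And3 _ mM _ := hM in mM.
Let mg := @measurable_sqn_grad_sub R n d1 d2 F L mu n0 L0 sm sc.

(** The [k.+1]-st subproblem of stage [t] is still unsolved after [N] steps, as
    an event in the past and a fresh seed. *)
Definition unsolved (t k N : nat) : set (past xi (t, k.+1) * S) :=
  [set u | ~ sub_solved F L tau M tol t (start u.1 t) (fun=> u.2)
     (state u.1 t k).1 (state u.1 t k).2 k.+1 N].

Arguments unsolved : clear implicits.

Lemma measurable_unsolved t k N : measurable (unsolved t k N).
Proof.
apply: measurableC.
pose T := past xi (t, k.+1).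
have mt := @measurable_inner_tol R n d1 d2 F L mu tau n0 L0 mu0 sm sc tau0 mtL.
have ms : measurable_fun [set: T] (fun w : T => start (w : Omega) t : B).
  apply: (@measurable_outer _ _ _ _ F L mu tau _ _ M alpha tol mM mg mt _ T p0
    (fun s i => xi (s, i)) t) => s i st.
  by apply: measurable_past_xi; rewrite xpair_eqE (ltn_eqF st).
have mi : measurable_fun [set: T] (fun w : T => state (w : Omega) t k : B * borel R d2).
  apply: (@measurable_inner _ _ _ _ F L mu tau _ _ M tol mM mg mt _ T t
    (fun w => start w t) (fun i => xi (t, i)) k ms).
  move=> i /andP[_ ik]; apply: measurable_past_xi.
  by rewrite xpair_eqE eqxx /= ltn_eqF// ltnS.
have ms' := measurableT_comp ms (@measurable_fst _ _ T S).
have mi' := measurableT_comp mi (@measurable_fst _ _ T S).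
exact: (measurable_sub_solved mM mg mt t N (seed := fun _ u => u.2) (k := k.+1)
  ms' (measurableT_comp measurable_fst mi') (measurableT_comp measurable_snd mi')
  (@measurable_snd _ _ T S)).
Qed.

Arguments measurable_unsolved : clear implicits.

Lemma xsection_unsolved t k N (w : Omega) :
  xsection (unsolved t k N) (w : past xi (t, k.+1)) =
  [set s | ~ sub_solved F L tau M tol t (start w t) (fun=> s)
     (state w t k).1 (state w t k).2 k.+1 N].
Proof. by apply/seteqP; split => s; rewrite /xsection /= inE. Qed.

(** Runs in which some subproblem is never solved. *)
Definition stuck : set Omega :=
  \bigcup_t \bigcup_k [set w |
    forall N, unsolved t k N ((w : past xi (t, k.+1)), xi (t, k.+1) w)].

Lemma stuck_negligible : P.-negligible stuck.
Proof.
apply: negligible_bigcup => t; apply: negligible_bigcup => k.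
apply: (eventually_stops hxi Lam1 (measurable_unsolved t k)) => w.
have [b hb] := unsolved_decay n0 L0 mu0 sm sc tau0 mtL Lam1 hM t (start w t)
  (fun i => xi (t, i) w) k.
by exists b => N; rewrite xsection_unsolved.
Qed.

Lemma not_stuck_solved (w : Omega) : ~ stuck w -> forall t k, exists N,
  sub_solved F L tau M tol t (start w t) (fun i => xi (t, i) w)
    (state w t k).1 (state w t k).2 k.+1 N.
Proof.
move=> nw t k; apply: contrapT => /forallNP h; apply: nw.
by exists t => //; exists k => // N; exact: h.
Qed.

Context (K : nat).
Hypothesis K0 : (0 < K)%N.
Hypothesis hK : forall t, 10 ^+ 5 * kappa ^+ 3 * (1 - rho) ^+ K <= alpha t.

(** Outside a null set, all stages have at most [K] iterations. *)
Lemma not_stuck_stops (w : Omega) t : ~ stuck w ->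
  stage_stop F L mu tau M alpha tol t (start w t) (fun i => xi (t, i) w) K.
Proof.
move=> nw.
exact: (stage_stops_at n0 L0 mu0 sm sc tau0 mtL (not_stuck_solved nw t) K0 (hK t)).
Qed.

Lemma not_stuck_next (w : Omega) t : ~ stuck w ->
  sqn2 (grad2 (stage_obj L f (start w t).1) (start w t.+1)) <=
    alpha t * sqn2 (grad2 (stage_obj L f (start w t).1) (start w t)).
Proof.
move=> nw; by have [[_ h] _] := first_indexP (ex_intro _ K (not_stuck_stops t nw)).
Qed.

Context (cN : R) (T : nat).
Hypothesis cN0 : 0 < cN.

Local Notation wait t k := (waiting R (unsolved t k)).

(** Charging [K] iterations to every stage makes the number of summands
    deterministic, and the hitting times become measurable waiting times. *)
Definition cost_bound (w : Omega) : \bar R :=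
  (\sum_(0 <= t < T.+1)
     (n%:R%:E + \sum_(0 <= k < K) (cN%:E * wait t k w + n%:R%:E)))%E.

Lemma total_cost_le (w : Omega) : ~ stuck w ->
  (total_cost F L mu tau M alpha tol p0 (seed w) cN T <= cost_bound w)%E.
Proof.
move=> nw; apply: lee_sum => t _; rewrite /stage_cost asboolT; last first.
  by exists K; exact: not_stuck_stops.
rewrite leeD2l//.
have h : (first_index (stage_stop F L mu tau M alpha tol t (start w t)
    (fun i => xi (t, i) w)) <= K)%N.
  by apply: first_index_le; exact: not_stuck_stops.
have w0 k : (0 <= cN%:E * wait t k w + n%:R%:E)%E.
  by rewrite adde_ge0 ?lee_fin// mule_ge0 ?lee_fin ?(ltW cN0)// waiting_ge0.
rewrite big_add1 /=.
apply: (@le_trans _ _ (\sum_(0 <= k < first_index (stage_stop F L mu tau M alpha tol t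
    (start w t) (fun i => xi (t, i) w))) (cN%:E * wait t k w + n%:R%:E))%E).
  apply: lee_sum => k _; rewrite leeD2r//; apply: lee_wpmul2l.
    by rewrite lee_fin ltW.
  exact: hitting_time_le.
by rewrite (big_cat_nat (leq0n _) h)/= leeDl// sume_ge0.
Qed.

Lemma measurable_cost_bound : measurable_fun [set: Omega] cost_bound.
Proof.
apply: emeasurable_sum => t _; apply: emeasurable_funD => //.
apply: emeasurable_sum => k _; apply: emeasurable_funD => //.
apply: measurable_funeM; apply: (measurable_waiting hxi).
exact: measurable_unsolved.
Qed.

Lemma expected_cost_bound :
  (\int[P]_w cost_bound w <=
    (T.+1%:R * (n%:R + K%:R *
       (cN * (Lam * (ln (2 * 10 ^+ 9 * kappa ^+ 5) + 2)) + n%:R)))%:E)%E.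
Proof.
have k1 : 1 <= kappa.
  by rewrite ler_pdivlMr// mul1r (le_trans _ mtL)// lerDl.
have B1 : 1 <= 2 * 10 ^+ 9 * kappa ^+ 5.
  rewrite -[leLHS]mulr1; apply: ler_pM => //; last by rewrite exprn_ege1.
  rewrite -[leLHS]mulr1; apply: ler_pM => //; first by rewrite ler1n.
  by rewrite exprn_ege1// ler1n.
set c := Lam * _.
have hw t k : (\int[P]_w wait t k w <= c%:E)%E.
  apply: (expected_waiting hxi Lam1 (measurable_unsolved t k) B1 stuck_negligible).
  move=> w nw N; rewrite xsection_unsolved.
  exact: (unsolved_decay_uniform n0 L0 mu0 sm sc tau0 mtL Lam1 hM (not_stuck_solved nw t)).
have mw t k : measurable_fun [set: Omega] (wait t k).
  by apply: (measurable_waiting hxi); exact: measurable_unsolved.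
have w0 t k w : (0 <= wait t k w)%E by exact: waiting_ge0.
have cw0 t k w : (0 <= cN%:E * wait t k w)%E by rewrite mule_ge0 ?lee_fin ?(ltW cN0).
have mcw t k : measurable_fun [set: Omega] (fun w => cN%:E * wait t k w)%E.
  exact: measurable_funeM.
have msum t : measurable_fun [set: Omega]
    (fun w => \sum_(0 <= k < K) (cN%:E * wait t k w + n%:R%:E))%E.
  by apply: emeasurable_sum => k _; apply: emeasurable_funD.
have s0 t w : (0 <= \sum_(0 <= k < K) (cN%:E * wait t k w + n%:R%:E))%E.
  by apply: sume_ge0 => k _; rewrite adde_ge0 ?lee_fin.
have icst (a : R) : (\int[P]_w a%:E = a%:E)%E.
  by rewrite integral_cst// [X in (_ * X)%E]probability_setT mule1.
rewrite ge0_integral_sum//; last 2 first.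
- by move=> t; apply: emeasurable_funD.
- by move=> t w _; rewrite adde_ge0 ?lee_fin.
apply: (@le_trans _ _ (\sum_(0 <= t < T.+1)
    (n%:R + K%:R * (cN * c + n%:R))%:E)%E); last first.
  by rewrite sumEFin lee_fin sumr_const_nat subn0 -[leLHS]mulr_natl.
apply: lee_sum => t _; rewrite ge0_integralD//.
rewrite icst EFinD leeD2l//.
rewrite ge0_integral_sum//; last 2 first.
- by move=> k; apply: emeasurable_funD.
- by move=> k w _; rewrite adde_ge0 ?lee_fin.
apply: (@le_trans _ _ (\sum_(0 <= k < K) (cN * c + n%:R)%:E)%E); last first.
  by rewrite sumEFin lee_fin sumr_const_nat subn0 -[leLHS]mulr_natl.
apply: lee_sum => k _; rewrite ge0_integralD//.
rewrite icst EFinD leeD2r// ge0_integralZl_EFin ?(ltW cN0)// EFinM.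
by apply: lee_wpmul2l; rewrite ?lee_fin ?(ltW cN0).
Qed.

Lemma expected_total_cost :
  (\int[P]_w total_cost F L mu tau M alpha tol p0 (seed w) cN T <=
    (T.+1%:R * (n%:R + K%:R *
       (cN * (Lam * (ln (2 * 10 ^+ 9 * kappa ^+ 5) + 2)) + n%:R)))%:E)%E.
Proof.
apply: le_trans expected_cost_bound.
have b0 w : (0 <= cost_bound w)%E.
  apply: sume_ge0 => t _; rewrite adde_ge0 ?lee_fin//; apply: sume_ge0 => k _.
  by rewrite adde_ge0 ?lee_fin// mule_ge0 ?lee_fin ?(ltW cN0)// waiting_ge0.
apply: nnintegral_le_ae stuck_negligible _ => //; last exact: total_cost_le.
- move=> w; apply: sume_ge0 => t _; rewrite /stage_cost; case: asboolP => // _.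
  rewrite adde_ge0 ?lee_fin//; apply: sume_ge0 => k _.
  rewrite adde_ge0 ?lee_fin// mule_ge0 ?lee_fin ?(ltW cN0)//.
  by rewrite /inner_time /hitting_time; case: asboolP => // _; rewrite lee_fin.
- exact: measurable_cost_bound.
Qed.

Hypothesis lb : has_lbound (range (primal f)).

Lemma expected_output :
  (('E_P[fun w => output_sq_grad F L mu tau M alpha tol p0 (seed w) T])
    <= (T%:R^-1 * (26 * (L * ((primal f p0.1 - inf (range (primal f)))
          + sqn (p0.2 - argmax (f p0.1)))))) %:E)%E.
Proof.
rewrite unlock; set c := T%:R^-1 * _.
have muL : mu <= L by rewrite (le_trans _ mtL)// lerDl.
have bound w : ~ stuck w ->
    output_sq_grad F L mu tau M alpha tol p0 (seed w) T <= c.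
  move=> nw; rewrite /output_sq_grad /c ler_wpM2l ?invr_ge0//.
  apply: (@sum_grad_primal_le R d1 d2 f (grad2 f) L mu mu0 muL
    (saddle_field_average n0 L0 sm sc) lb (fun t => start w t)) => t.
  have e (p q : E) : stage_field (grad2 f) L p.1 q = grad2 (stage_obj L f p.1) q.
    rewrite (stage_objE (average F) L p.1 0) (grad2_sub_obj sm) /sub_grad /stage_field.
    by rewrite scale0r oppr0.
  have := not_stuck_next t nw; rewrite -!e stage_field_center.
  exact.
have c0 : 0 <= c.
  have [w nw] : exists w, ~ stuck w.
    apply: contrapT => /forallNP h.
    have : P.-negligible [set: Omega].
      by apply: negligibleS stuck_negligible => w _; exact: contrapT (h w).
    move=> /(measure_negligible measurableT) e; have := probability_setT P.
    by rewrite e => /eqP; rewrite eq_sym onee_eq0.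
  apply: le_trans (bound w nw); rewrite mulr_ge0 ?invr_ge0// sumr_ge0// => t _.
  exact: sqn_ge0.
apply: (@le_trans _ _ (\int[P]_w c%:E)%E); last first.
  by rewrite integral_cst// [X in (_ * X)%E]probability_setT mule1.
apply: nnintegral_le_ae stuck_negligible _ => //.
by move=> w; rewrite lee_fin mulr_ge0 ?invr_ge0// sumr_ge0// => t _; exact: sqn_ge0.
Qed.

End RandomRun.

(** * Sizes of the parameters *)

Section ParameterSizes.
Context (R : realType) (n : nat) (L mu : R).
Hypotheses (n0 : (0 < n)%N) (mu0 : 0 < mu) (muL : mu <= L).

Let L0 : 0 < L. Proof. exact: lt_le_trans muL. Qed.
Let nR : (0 : R) < n%:R. Proof. by rewrite ltr0n. Qed.
Let sn := Num.sqrt (n%:R : R).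
Let sn0 : 0 < sn. Proof. by rewrite sqrtr_gt0. Qed.
Let sn1 : 1 <= sn. Proof. by rewrite -(sqrtr1 R) ler_sqrt// ler1n. Qed.
Let tau := Num.max (L / sn - mu) 0.
Let kappa := L / mu.
Let kappa1 : 1 <= kappa. Proof. by rewrite ler_pdivlMr// mul1r. Qed.
Let polylog := 1 + `|ln L| + `|ln mu| + `|ln kappa|.

Lemma tau_ge0 : 0 <= tau. Proof. by rewrite le_max lexx orbT. Qed.

Lemma mu_tau_le : mu + tau <= L.
Proof.
rewrite -lerBrDl ge_max subr_ge0 muL andbT lerD2r.
by rewrite ler_pdivrMr// ler_peMr// ltW.
Qed.

Lemma mu_tau_ge : L / sn <= mu + tau.
Proof. by rewrite -lerBlDl le_max lexx. Qed.

Lemma mu_tau_le_sum : mu + tau <= mu + L / sn.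
Proof.
rewrite lerD2l ge_max divr_ge0 ?(ltW L0) ?(ltW sn0)// andbT.
by rewrite gerBl ltW.
Qed.

(** The proximal term is chosen so that the condition number of a subproblem is
    of order [Num.sqrt n], which makes its square comparable with the [n] terms
    of the sum. *)
Lemma solver_rate_le (cLam : R) : 0 < cLam ->
  cLam * (n%:R + ((L + Num.sqrt 2 * Num.max (2 * L) tau) / Num.min L (mu + tau)) ^+ 2)
    <= 16 * cLam * n%:R.
Proof.
move=> c0; have mtL := mu_tau_le; have mt := mu_tau_ge.
have mt0 : 0 < mu + tau by rewrite ltr_wpDr// tau_ge0.
rewrite (min_r mtL) (max_l (_ : tau <= 2 * L)); last by move: mtL mu0 L0; lra.
have s2 : Num.sqrt (2 : R) <= 3 / 2.
  rewrite -(@ler_pXn2r _ 2)// ?nnegrE ?sqrtr_ge0// ?divr_ge0//.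
  by rewrite sqr_sqrtr// expr_div_n; lra.
have s20 := sqrtr_ge0 (2 : R).
have s2e : Num.sqrt (2 : R) ^+ 2 = 2 by rewrite sqr_sqrtr.
have q : L / (mu + tau) <= sn by rewrite ler_pdivrMr// mulrC -ler_pdivrMr.
have h : ((L + Num.sqrt 2 * (2 * L)) / (mu + tau)) ^+ 2 <= 15 * n%:R.
  have -> : (L + Num.sqrt 2 * (2 * L)) / (mu + tau) =
     (1 + 2 * Num.sqrt 2) * (L / (mu + tau)) by ring.
  rewrite exprMn; apply: ler_pM; rewrite ?sqr_ge0//.
    have -> : (1 + 2 * Num.sqrt (2 : R)) ^+ 2 =
      1 + 4 * Num.sqrt 2 + 4 * Num.sqrt 2 ^+ 2 by ring.
    by rewrite s2e; lra.
  have -> : (n%:R : R) = sn ^+ 2 by rewrite /sn sqr_sqrtr// ltW.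
  by rewrite lerXn2r ?nnegrE ?divr_ge0 ?(ltW L0) ?(ltW mt0) ?(ltW sn0).
by rewrite [16 * _]mulrC -mulrA ler_wpM2l ?(ltW c0)//; lra.
Qed.

(** The balance behind the choice of [tau]: solving one proximal subproblem
    costs [n], and their number is the square root of the condition number of
    the prox-regularized problem. *)
Lemma acceleration_cost :
  n%:R / Num.sqrt (mu / (mu + tau)) <= n%:R + n%:R `^ (3 / 4) * Num.sqrt kappa.
Proof.
have mt0 : 0 < mu + tau by rewrite ltr_wpDr// tau_ge0.
have q0 : 0 <= mu / (mu + tau) by rewrite divr_ge0// ltW.
have h : (Num.sqrt (mu / (mu + tau)))^-1 <= 1 + Num.sqrt (kappa / sn).
  have -> : (Num.sqrt (mu / (mu + tau)))^-1 = Num.sqrt ((mu + tau) / mu).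
    by rewrite -sqrtrV ?invf_div.
  have k0 : 0 <= kappa / sn by rewrite divr_ge0 ?(ltW sn0)// (le_trans ler01).
  have sk0 := sqrtr_ge0 (kappa / sn).
  rewrite -(@ler_pXn2r _ 2)// ?nnegrE ?sqrtr_ge0 ?addr_ge0//.
  rewrite sqr_sqrtr ?divr_ge0 ?(ltW mt0) ?(ltW mu0)//.
  apply: (@le_trans _ _ (1 + kappa / sn)).
    rewrite ler_pdivrMr//; apply: (le_trans mu_tau_le_sum).
    rewrite le_eqVlt; apply/orP; left; apply/eqP.
    by rewrite /kappa; field; rewrite !gt_eqF.
  rewrite sqrrD expr1n mul1r sqr_sqrtr// -addrA lerD2l lerDr.
  by rewrite mulrn_wge0.
apply: (le_trans (ler_wpM2l (ltW nR) h)); rewrite mulrDr mulr1 lerD2l.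
rewrite sqrtrM; last by rewrite (le_trans ler01).
rewrite mulrCA mulrC ler_wpM2r ?sqrtr_ge0//.
have -> : Num.sqrt sn^-1 = n%:R `^ (- (1 / 4)).
  rewrite powRN sqrtrV ?(ltW sn0)//; congr (_^-1).
  have n0' : (0 : R) <= n%:R by rewrite ler0n.
  rewrite /sn -powR12_sqrt ?sqrtr_ge0// -powR12_sqrt// -powRrM.
  by congr (_ `^ _); field.
rewrite -{1}(@powRr1 _ (n%:R : R)) ?ler0n// -powRD; last by rewrite (gt_eqF nR) implybT.
by have -> : 1 + - (1 / 4) = 3 / 4 :> R by field.
Qed.

Lemma polylog_ge1 : 1 <= polylog.
Proof. by rewrite /polylog -!addrA lerDl !addr_ge0. Qed.

Lemma ln_survival_le :
  ln (2 * 10 ^+ 9 * kappa ^+ 5) + 2 <= (ln (2 * 10 ^+ 9) + 7) * polylog.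
Proof.
have c1 : (1 : R) <= 2 * 10 ^+ 9.
  rewrite -[leLHS]mulr1; apply: ler_pM => //; first by rewrite ler1n.
  by rewrite exprn_ege1// ler1n.
have c0 : (0 : R) < 2 * 10 ^+ 9 := lt_le_trans ltr01 c1.
have k0 : 0 < kappa := lt_le_trans ltr01 kappa1.
have k5 : 0 < kappa ^+ 5 := exprn_gt0 5 k0.
rewrite lnM ?posrE// (lnXn 5 k0) -(mulr_natl (ln kappa)).
have l0 : 0 <= ln (2 * 10 ^+ 9 : R) by exact: ln_ge0.
set c := ln (2 * 10 ^+ 9) in l0 *.
have h := ler_norm (ln kappa).
have := normr_ge0 (ln L); have := normr_ge0 (ln mu); have := normr_ge0 (ln kappa).
have cp : c <= c * polylog by rewrite ler_peMr// polylog_ge1.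
move: cp; rewrite /polylog mulrDl.
by move: h; lra.
Qed.

Let c0 : R := ln (576 * 10 ^+ 5) + 7.

(** The stage tolerances are polynomial in the parameters. *)
Lemma stage_tol_ge t : 10 ^+ 5 * kappa ^+ 3 * expR (- (c0 * polylog)) <= stage_tol L mu t.
Proof.
have k0 : 0 < kappa := lt_le_trans ltr01 kappa1.
have p5 : (0 : R) < 10 ^+ 5 by rewrite exprn_gt0.
have k3 : 0 < kappa ^+ 3 := exprn_gt0 3 k0.
have m5 : 0 < mu ^+ 5 := exprn_gt0 5 mu0.
have L5 : 0 < L ^+ 5 := exprn_gt0 5 L0.
have m1 : 0 < Num.max 1 (L ^+ 7) by rewrite lt_max ltr01.
have c504 : (0 : R) < 504 by rewrite ltr0n.
have c576 : (0 : R) < 576 by rewrite ltr0n.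
have d0 : 0 < 576 * Num.max 1 (L ^+ 7) := mulr_gt0 c576 m1.
have d1 : 0 < 504 * L ^+ 5 := mulr_gt0 c504 L5.
have tol0 : 0 < stage_tol L mu t.
  by case: t => [|t]; [exact: divr_gt0 m5 d0|exact: divr_gt0 m5 d1].
have pk : 0 < 10 ^+ 5 * kappa ^+ 3 := mulr_gt0 p5 k3.
rewrite -[stage_tol L mu t]lnK ?posrE// -[10 ^+ 5 * kappa ^+ 3]lnK ?posrE//.
rewrite -expRD ler_expR (lnM (x := 10 ^+ 5)) ?posrE// (lnXn 3 k0).
have l576 : ln (576 * 10 ^+ 5 : R) = ln 576 + ln (10 ^+ 5) by rewrite lnM ?posrE.
have l504 : ln (504 : R) <= ln 576 by rewrite ler_ln ?posrE// ler_nat.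
have c00 : 0 <= ln (576 * 10 ^+ 5 : R).
  apply: ln_ge0; rewrite -[leLHS]mulr1; apply: ler_pM => //; first by rewrite ler1n.
  by rewrite exprn_ege1// ler1n.
have aL := ler_norm (ln L); have aM := ler_norm (- ln mu); rewrite normrN in aM.
have aK := ler_norm (ln kappa).
have nL := normr_ge0 (ln L); have nM := normr_ge0 (ln mu).
have nK := normr_ge0 (ln kappa).
have cp : ln (576 * 10 ^+ 5) <= ln (576 * 10 ^+ 5) * polylog.
  by rewrite ler_peMr// polylog_ge1.
have hc : ln (576 * 10 ^+ 5) + 7 * (`|ln L| + `|ln mu| + `|ln kappa|) <= c0 * polylog.
  rewrite /c0 [leRHS]mulrDl; apply: lerD => //.
  by rewrite ler_wpM2l// /polylog; lra.
have hstage : 5 * ln mu - ln 576 - 7 * `|ln L| <= ln (stage_tol L mu t).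
  case: t tol0 => [|t] _; rewrite /stage_tol.
    rewrite (ln_div (x := mu ^+ 5)) ?posrE// (lnM (x := 576)) ?posrE// (lnXn 5 mu0).
    have lm : ln (Num.max 1 (L ^+ 7)) <= 7 * `|ln L|.
      rewrite maxElt; case: ifP => _; last by rewrite ln1 mulr_ge0.
      by rewrite (lnXn 7 L0) -(mulr_natl (ln L)) ler_wpM2l.
    by rewrite -(mulr_natl (ln mu)); lra.
  rewrite (ln_div (x := mu ^+ 5)) ?posrE// (lnM (x := 504)) ?posrE//.
  rewrite (lnXn 5 mu0) (lnXn 5 L0).
  by rewrite -(mulr_natl (ln mu)) -(mulr_natl (ln L)); lra.
rewrite -(mulr_natl (ln kappa)); rewrite l576 in hc.
move: hc hstage aL aM aK nL nM nK; move: (c0 * polylog) (ln (stage_tol L mu t)).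
move: (ln 576) (ln (10 ^+ 5)) (ln mu) (ln kappa) (ln L) => a b c d e x y.
lra.
Qed.

(** The number of iterations of a stage is logarithmic up to the factor
    [rho^-1]. *)
Lemma exists_stage_length : let rho := 9 / 10 * Num.sqrt (mu / (mu + tau)) in
  exists K : nat, [/\ (0 < K)%N,
    forall t, 10 ^+ 5 * kappa ^+ 3 * (1 - rho) ^+ K <= stage_tol L mu t &
    K%:R <= c0 * polylog / rho + 1].
Proof.
move=> rho.
have mt0 : 0 < mu + tau by rewrite ltr_wpDr// tau_ge0.
have s0 : 0 < Num.sqrt (mu / (mu + tau)) by rewrite sqrtr_gt0 divr_gt0.
have s1 : Num.sqrt (mu / (mu + tau)) <= 1.
  by rewrite -(sqrtr1 R) ler_sqrt// ler_pdivrMr// mul1r lerDl tau_ge0.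
have r0 : 0 < rho by rewrite mulr_gt0.
have r1 : rho <= 1 by rewrite /rho; lra.
have c00 : 0 <= c0.
  rewrite /c0 addr_ge0// ln_ge0// -[leLHS]mulr1; apply: ler_pM => //.
    by rewrite ler1n.
  by rewrite exprn_ege1// ler1n.
have p0 : 0 <= polylog := le_trans ler01 polylog_ge1.
have x0 : 0 <= c0 * polylog / rho by rewrite divr_ge0 ?mulr_ge0// ltW.
pose K := (Num.truncn (c0 * polylog / rho)).+1.
have K1 : c0 * polylog / rho <= K%:R by rewrite ltW// truncnS_gt.
exists K; split => // [t|]; last by rewrite -natr1 lerD2r truncn_le.
apply: le_trans (stage_tol_ge t); rewrite ler_wpM2l//.
  by rewrite mulr_ge0 ?exprn_ge0// (le_trans ler01).
have hr : (1 - rho) ^+ K <= expR (- rho) ^+ K.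
  by rewrite lerXn2r ?nnegrE ?expR_ge0 ?subr_ge0// expR_ge1Dx.
apply: (le_trans hr); rewrite -expRM_natl ler_expR mulrN lerN2.
by move: K1; rewrite ler_pdivrMr.
Qed.

End ParameterSizes.

(** * Complexity of the algorithm *)

Theorem mainTheorem5 (R : realType) (cLam cN : R)
    (hcLam : 0 < cLam) (hcN : 0 < cN) :
  exists (C : R) (m : nat), 0 < C /\
  forall (n d1 d2 : nat) (F : 'I_n -> 'rV[R]_d1 -> 'rV[R]_d2 -> R)
    (L mu : R) (x0 : 'rV[R]_d1) (y0 : 'rV[R]_d2)
    (dS : measure_display) (S : measurableType dS) (Q : probability S R)
    (M : solver R n d1 d2 S)
    (dO : measure_display) (Omega : measurableType dO)
    (P : probability Omega R) (xi : nat * nat -> Omega -> S),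
  let f := average F in
  let kappa := L / mu in
  let Delta := primal f x0 - inf (range (primal f)) in
  let Dy0 := sqn (y0 - argmax (f x0)) in
  let tau := Num.max (L / Num.sqrt n%:R - mu) 0 in
  let Lam := cLam * (n%:R + ((L + Num.sqrt 2 * Num.max (2 * L) tau)
                             / Num.min L (mu + tau)) ^+ 2) in
  let alpha := stage_tol L mu in
  let tol := inner_tol F L mu tau in
  let seed := fun w t k => xi (t, k) w in
  (0 < n)%N -> (0 < d1)%N -> (0 < d2)%N -> 0 < L -> 0 < mu ->
  averaged_smooth L F ->
  (forall x, strongly_concave mu (f x)) ->
  has_lbound (range (primal f)) ->
  1 <= Lam ->
  linearly_convergent F L tau Lam Q M ->
  iid P Q xi ->
  forall eps : R, 0 < eps ->
  exists T : nat,
  [/\ (0 < T)%N,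
      ('E_P[fun w => output_sq_grad F L mu tau M alpha tol
                       (x0, y0) (seed w) T]
         <= (eps ^+ 2)%:E)%E &
      (\int[P]_w total_cost F L mu tau M alpha tol (x0, y0) (seed w) cN T
         <= (C * (1 + `|ln L| + `|ln mu| + `|ln kappa|) ^+ m
             * (n%:R + n%:R `^ (3 / 4) * Num.sqrt kappa)
             * Num.max 1 (L * (Delta + Dy0) / eps ^+ 2))%:E)%E].
Proof.
pose c0 : R := ln (576 * 10 ^+ 5) + 7.
pose c1 : R := ln (2 * 10 ^+ 9) + 7.
pose c2 : R := 16 * cN * cLam * c1 + 1.
have large (k m : nat) : (0 < k)%N -> 0 <= ln (k%:R * 10 ^+ m : R).
  move=> k0; apply: ln_ge0; rewrite -[leLHS]mulr1; apply: ler_pM => //.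
    by rewrite ler1n.
  by rewrite exprn_ege1// ler1n.
have c00 : 0 <= c0 by rewrite addr_ge0// large.
have c10 : 0 <= c1 by rewrite addr_ge0// large.
have c20 : 0 < c2.
  by rewrite ltr_wpDl// !mulr_ge0// ltW.
have C0 : 0 < 28 * (1 + (2 * c0 + 1) * c2).
  by rewrite mulr_gt0// ltr_pwDl// mulr_ge0 ?(ltW c20)// addr_ge0// mulr_ge0.
exists (28 * (1 + (2 * c0 + 1) * c2)), 2%N; split => //.
move=> n d1 d2 F L mu x0 y0 dS S Q M dO Omega P xi f kappa Delta Dy0 tau Lam
  alpha tol seed n0 d10 d20 L0 mu0 sm sc lb Lam1 hM hxi eps eps0.
have muL : mu <= L := strong_concavity_le_smoothness n0 d20 L0 sm sc.
have tau0 : 0 <= tau := tau_ge0 n L mu.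
have mtL : mu + tau <= L := mu_tau_le n0 mu0 muL.
have [K [K0 hK Kle]] := exists_stage_length n mu0 muL.
set X := L * (Delta + Dy0) / eps ^+ 2.
have X0 : 0 <= X.
  rewrite divr_ge0 ?sqr_ge0// mulr_ge0 ?(ltW L0)// addr_ge0 ?sqn_ge0// subr_ge0.
  by apply: ge_inf => //; exists x0.
(* averaging the bound [26 * X * eps ^+ 2] over [T > 26 * X] stages gives
   [eps ^+ 2]; the constant [28] comes from [T.+1 <= 26 * X + 2] *)
pose T := (Num.truncn (26 * X)).+1.
have X26 : 0 <= 26 * X by rewrite mulr_ge0.
have TX : 26 * X <= T%:R by rewrite ltW// truncnS_gt.
have TX' : T.+1%:R <= 28 * Num.max 1 X.
  have h1 : 1 <= Num.max 1 X by rewrite le_max lexx.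
  have h2 : X <= Num.max 1 X by rewrite le_max lexx orbT.
  have h3 : (Num.truncn (26 * X))%:R <= 26 * X by rewrite truncn_le.
  have -> : T.+1%:R = (Num.truncn (26 * X))%:R + 2 :> R by rewrite /T -natrD addn2.
  have a1 := ler_wpM2l (ler0n R 26) h2; lra.
exists T; split => //.
- apply: (le_trans (expected_output n0 L0 mu0 sm sc tau0 mtL Lam1 hM hxi
    (x0, y0) K0 hK T lb)).
  rewrite lee_fin ler_pdivrMl ?ltr0n//.
  move: TX; rewrite /X mulrA ler_pdivrMr ?exprn_gt0//.
- apply: (le_trans (expected_total_cost n0 L0 mu0 sm sc tau0 mtL Lam1 hM hxi
    (x0, y0) K0 hK T hcN)).
  rewrite lee_fin.
  set pl := 1 + `|ln L| + `|ln mu| + `|ln kappa|.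
  have pl1 : 1 <= pl := polylog_ge1 L mu.
  set W := n%:R + n%:R `^ (3 / 4) * Num.sqrt kappa.
  have nW : n%:R <= W by rewrite lerDl mulr_ge0 ?powR_ge0 ?sqrtr_ge0.
  have W0 : 0 <= W := le_trans (ler0n _ _) nW.
  have acc := acceleration_cost n0 mu0 muL.
  have rate : Lam <= 16 * cLam * n%:R := solver_rate_le n0 mu0 muL hcLam.
  have hln := ln_survival_le mu0 muL.
  rewrite -/kappa -/pl -/c1 in hln.
  rewrite -/kappa -/tau -/W in acc.
  rewrite -/tau -/pl -/c0 in Kle.
  have pl0 : 0 <= pl := le_trans ler01 pl1.
  set s := Num.sqrt (mu / (mu + tau)) in acc Kle.
  have s0 : 0 < s.
    by rewrite sqrtr_gt0 divr_gt0// ltr_wpDr.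
  (* expected cost of one iteration of a stage *)
  have one : cN * (Lam * (ln (2 * 10 ^+ 9 * kappa ^+ 5) + 2)) + n%:R <= n%:R * (c2 * pl).
    have h : Lam * (ln (2 * 10 ^+ 9 * kappa ^+ 5) + 2) <= 16 * cLam * n%:R * (c1 * pl).
      apply: (@le_trans _ _ (Lam * (c1 * pl))).
        by rewrite ler_wpM2l// (le_trans ler01).
      by rewrite ler_wpM2r// mulr_ge0.
    have := ler_wpM2l (ltW hcN) h.
    have npl : n%:R <= n%:R * pl by rewrite ler_peMr.
    have -> : n%:R * (c2 * pl) = cN * (16 * cLam * n%:R * (c1 * pl)) + n%:R * pl.
      by rewrite /c2; ring.
    by move=> h'; lra.
  (* [K] iterations at cost [n] each *)
  have Kn : K%:R * n%:R <= (2 * c0 + 1) * pl * W.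
    apply: (le_trans (ler_wpM2r (ler0n R n) Kle)).
    have -> : (c0 * pl / (9 / 10 * s) + 1) * n%:R = 10 / 9 * (c0 * pl) * (n%:R / s) + n%:R.
      by field; rewrite gt_eqF.
    have cp : 0 <= c0 * pl := mulr_ge0 c00 pl0.
    have a1 := ler_wpM2l cp acc.
    have a2 : W <= pl * W by rewrite ler_peMl.
    have a3 : 0 <= c0 * pl * W := mulr_ge0 cp W0.
    by lra.
  have stage : n%:R + K%:R * (cN * (Lam * (ln (2 * 10 ^+ 9 * kappa ^+ 5) + 2)) + n%:R)
      <= (1 + (2 * c0 + 1) * c2) * pl ^+ 2 * W.
    have b1 := ler_wpM2l (ler0n R K) one.
    have c2pl : 0 <= c2 * pl := mulr_ge0 (ltW c20) pl0.
    have b2 := ler_wpM2r c2pl Kn.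
    have pl2 : 1 <= pl ^+ 2 by rewrite exprn_ege1.
    have b3 : W <= pl ^+ 2 * W by rewrite ler_peMl.
    have -> : (1 + (2 * c0 + 1) * c2) * pl ^+ 2 * W =
      pl ^+ 2 * W + (2 * c0 + 1) * pl * W * (c2 * pl) by ring.
    by lra.
  have st0 : 0 <= (1 + (2 * c0 + 1) * c2) * pl ^+ 2 * W.
    rewrite mulr_ge0// mulr_ge0 ?sqr_ge0//.
    by move: C0; rewrite pmulr_rgt0// => /ltW.
  apply: (le_trans (ler_wpM2l (ler0n R T.+1) stage)).
  apply: (le_trans (ler_wpM2r st0 TX')).
  by rewrite le_eqVlt; apply/orP; left; apply/eqP; ring.
Qed.
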